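(* Let $Z$ be an offspring distribution with $1<\mathbb{E}(Z)<\infty$ and $\mathbb{P}(Z=0)=0$, and let $(T,\rho)$ be either the Galton–Watson tree $(T_{\mathrm{GW}},\rho)$ or the unimodular Galton–Watson tree $(T_{\mathrm{UGW}},\rho)$ with offspring distribution $Z$, with $T=(V,E)$. Put i.i.d. Exponential$(1)$ weights on $\vec E$. Then almost surely the wired MSA limit exists, the limit has infinitely many infinite components, and each component is one-ended.
   Context: $(T_{\mathrm{GW}},\rho)$ is the Galton–Watson tree rooted at its ancestor. The augmented Galton–Watson tree is obtained by giving the root $Z+1$ children each independently generating a Galton–Watson tree; $(T_{\mathrm{UGW}},\rho)$ is its law biased by $1/\deg(\rho)$ (normalized). $\vec E$: both orientations of each edge. MSA: for a finite graph with boundary vertex $\partial$, a spanning arborescence is a set of oriented edges with no oriented cycle, each vertex except $\partial$ having exactly one outgoing edge and $\partial$ none; the MSA has minimal total weight. Wired MSA limit: for an exhaustion $G_1\subset G_2\subset\cdots$ by finite subgraphs, let $G_i^{\mathsf w}$ be the graph with all vertices outside $G_i$ identified to one vertex $\partial_i$ and self-loops erased, $T_i$ its MSA; the limit exists if for every vertex $v$ a.s. the outgoing edge of $v$ in $T_i$ is eventually constant and the limit does not depend on the exhaustion. For an infinite arborescence, the future of $v$ is the oriented path followed from $v$; $u,v$ are in the same component if their futures intersect; a component is one-ended if the undirected tree of its edges contains an infinite path but no two disjoint infinite paths. *)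

(* Defs.v *)
From HB Require Import structures.
From mathcomp Require Import all_boot all_order all_algebra.
From mathcomp Require Import all_classical all_reals all_analysis.
Set Implicit Arguments. Unset Strict Implicit. Unset Printing Implicit Defensive.
Import Order.TTheory GRing.Theory Num.Theory.
Local Open Scope classical_set_scope.
Local Open Scope ring_scope.

(* Vertices are Ulam--Harris labels: the root is [::], the children of u are
   rcons u i for i < (number of children of u). *)
Definition label := seq nat.

Fixpoint in_treeR (nch : label -> nat) (pre : label) (s : label) : bool :=
  if s is i :: s' then (i < nch pre)%N && in_treeR nch (rcons pre i) s' else true.
Definition in_tree (nch : label -> nat) (u : label) : bool := in_treeR nch [::] u.

Definition parent_of (u v : label) : bool :=
  (size v == (size u).+1) && (take (size u) v == u).

Definition tadj (nch : label -> nat) (u v : label) : bool :=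
  [&& in_tree nch u, in_tree nch v & parent_of u v || parent_of v u].

(* Number of children: Galton--Watson tree (aug = false) or augmented
   Galton--Watson tree where the root gets Z+1 children (aug = true). *)
Definition nchildren (aug : bool) (Zs : label -> nat) (u : label) : nat :=
  (Zs u + (aug && (u == [::])))%N.

(* Weight of the oriented edge u -> v (u, v adjacent).  The edge between a
   non-root vertex c and its parent carries two weights:
   W c false for the orientation parent -> c, W c true for c -> parent. *)
Definition owt {R : Type} (W : label -> bool -> R) (u v : label) : R :=
  if (size u < size v)%N then W v false else W u true.

(* Spanning arborescences of the wired graph G^w (vertex set G plus the
   boundary vertex ∂ standing for all vertices outside G, self-loops erased):
   [out v] is the head of the unique outgoing edge of v in G (it stands for
   ∂ when out v \notin G); no oriented cycle = every future reaches ∂. *)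
Definition is_arb (nch : label -> nat) (G : seq label) (out : label -> label) :=
  (forall v, v \in G -> tadj nch v (out v)) /\
  (forall v, v \in G -> exists n, iter n out v \notin G).

Definition arb_weight {R : numDomainType} (W : label -> bool -> R)
  (G : seq label) (out : label -> label) : R :=
  \sum_(v <- undup G) owt W v (out v).

Definition is_MSA {R : numDomainType} (nch : label -> nat) (W : label -> bool -> R)
  (G : seq label) (out : label -> label) :=
  is_arb nch G out /\
  forall out', is_arb nch G out' -> arb_weight W G out <= arb_weight W G out'.

Definition exhaustion (nch : label -> nat) (Gs : nat -> seq label) :=
  (forall n, {subset Gs n <= Gs n.+1}) /\
  (forall n v, v \in Gs n -> in_tree nch v) /\
  (forall v, in_tree nch v -> exists n, v \in Gs n).

Definition wired_MSA_limit {R : numDomainType} (nch : label -> nat)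
  (W : label -> bool -> R) (F : label -> label) :=
  forall (Gs : nat -> seq label) (Ts : nat -> label -> label),
    exhaustion nch Gs -> (forall n, is_MSA nch W (Gs n) (Ts n)) ->
    forall v, in_tree nch v -> exists m, forall n, (m <= n)%N -> Ts n v = F v.

Definition same_comp (F : label -> label) (u v : label) :=
  exists m n, iter m F u = iter n F v.

Definition component (nch : label -> nat) (F : label -> label) (u : label) : set label :=
  [set v | in_tree nch v /\ same_comp F u v].

Definition cadj (F : label -> label) (C : set label) (a b : label) :=
  C a /\ C b /\ (F a = b \/ F b = a).

Definition ray (F : label -> label) (C : set label) (p : nat -> label) :=
  injective p /\ forall n, cadj F C (p n) (p n.+1).

Definition one_ended (F : label -> label) (C : set label) :=
  (exists p, ray F C p) /\
  ~ (exists p q, ray F C p /\ ray F C q /\ forall m n, p m <> q n).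

Definition conclusion (nch : label -> nat) {R : numDomainType}
  (W : label -> bool -> R) :=
  exists F : label -> label,
    wired_MSA_limit nch W F /\
    infinite_set [set C : set label |
                  exists2 u, in_tree nch u & C = component nch F u /\ infinite_set C] /\
    (forall u, in_tree nch u -> one_ended F (component nch F u)).

Definition exp1_cdf {R : realType} (t : R) : R :=
  if t < 0 then 0 else 1 - expR (- t).

Definition offspring_law {R : realType} (p : nat -> R) :=
  (forall k, 0 <= p k) /\ (\sum_(k <oo) (p k)%:E = 1)%E /\
  (1 < \sum_(k <oo) (k%:R * p k)%:E < +oo)%E /\ p 0%N = 0.

(* Z u (u label) i.i.d. with law p, W e (e = (c,b), c non-root label)
   i.i.d. Exponential(1), the two families independent: all finite-dimensional
   joint laws are the product laws (on the generating pi-system of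
   events {Z u = k}, {W e <= t}). *)
Definition iid_model {R : realType} {d : measure_display} {Omega : measurableType d}
  (P : probability Omega R) (p : nat -> R)
  (Z : label -> Omega -> nat) (W : label -> bool -> Omega -> R) :=
  (forall u k, measurable [set w | Z u w = k]) /\
  (forall c b t, measurable [set w | W c b w <= t]) /\
  forall (us : seq (label * nat)) (es : seq ((label * bool) * R)),
    uniq (map fst us) -> uniq (map fst es) -> all (fun e => e.1.1 != [::]) es ->
    P [set w | all (fun uk => Z uk.1 w == uk.2) us &&
               all (fun et => W et.1.1 et.1.2 w <= et.2) es]
    = ((\prod_(uk <- us) p uk.2) * (\prod_(et <- es) exp1_cdf et.2))%:E.

(* the law of the tree: GW (aug = false) is P itself; UGW (aug = true) is the
   augmented GW law biased by 1/deg(rho) = 1/(Z [::] + 1), normalized. *)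
Definition tree_law {R : realType} {d : measure_display} {Omega : measurableType d}
  (P : probability Omega R) (aug : bool) (Z : label -> Omega -> nat)
  (A : set Omega) : \bar R :=
  if aug then
    ((\int[P]_(w in A) ((Z [::] w).+1%:R^-1)%:E) /
     (\int[P]_w ((Z [::] w).+1%:R^-1)%:E))%E
  else P A.

(* Main.v *)
(** In a minimal arborescence, redirecting x to a neighbour z and reversing the
    future of x cannot lower the weight.  Hence the future of x in the MSA of a
    large finite subgraph is a walk whose partial costs (each edge is paid for,
    the reversal of the previously used edge is refunded) stay below the budget
    of every competing walk; if an infinite non-backtracking walk survives with
    budget b through the neighbour a of x and through no other neighbour, the
    MSAs eventually send x to a.  Resampling one weight excludes ties, and the
    limit exists as soon as some walk survives.

    Two disjoint rays in a component would produce an infinite chain of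
    descendants, all of them pointing upwards.  With exponential weights, the
    probability f(b) that all walks towards the descendants die on budget b
    solves f = g(h), h' = phi - h, phi' = phi - f, where g is the generating
    function of Z, and (phi - h)^2 / 2 + K(h) with K' = g - id is conserved.
    Comparing it at b = 0 and at infinity shows first that walks do survive,
    and then that the probability of a finite past equals the probability of
    dying, so that almost surely no such infinite chain exists. *)
Require Import Defs.
From HB Require Import structures.
From mathcomp Require Import all_boot all_order all_algebra.
From mathcomp Require Import all_classical all_reals all_analysis.
From mathcomp Require Import measurable_realfun.
From mathcomp Require Import ring lra.
Set Implicit Arguments. Unset Strict Implicit. Unset Printing Implicit Defensive.
Import Order.TTheory GRing.Theory Num.Theory.
Import numFieldNormedType.Exports.
Local Open Scope classical_set_scope.
Local Open Scope ring_scope.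

(** * The exchange argument *)

Section Tree.
Variable nch : label -> nat.

(** With budget 0 no weight can be paid, so the energy at 0 only sees how unaffordable children are
    treated. For dying they are harmless: h(0) = 1, and conservation reads (q - 1)^2 / 2 + K(1) =
    K(0) with q = phi(0). For a finite past of probability s, an unaffordable child must either
    survive or have a finite past itself, so h(0) = 1 - q + s. The kinetic term (s - h(0))^2 / 2 is
    again (1 - q)^2 / 2, hence K(1 - q + s) = K(1), and strict monotonicity of K forces s = q. The
    obstacle is that f = 1 identically also solves the equations, so the limit 0 at infinity has to
    be earned. The finite-depth approximations do tend to 0; their energy is only monotone, but that
    inequality keeps q away from 1 uniformly in the depth. No function is shown to be
    differentiable: the equations are kept as bounds on windows of length d with errors of order
    d^2, and subdivision turns them into monotonicity or conservation. *)

Lemma in_treeR_rcons pre s i :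
  in_treeR nch pre (rcons s i) = in_treeR nch pre s && (i < nch (pre ++ s))%N.
Proof.
elim: s pre => [|j s IH] pre /=; first by rewrite cats0 andbT.
by rewrite IH andbA cat_rcons.
Qed.

Lemma in_tree_rcons u i : in_tree nch (rcons u i) = in_tree nch u && (i < nch u)%N.
Proof. exact: in_treeR_rcons. Qed.

Lemma parent_ofP u v : reflect (exists i, v = rcons u i) (parent_of u v).
Proof.
apply: (iffP andP) => [[/eqP szv /eqP tv]|[i ->]]; last first.
  by rewrite size_rcons eqxx -cats1 take_size_cat.
case/lastP: v szv tv => [//|v i]; rewrite size_rcons => -[szv].
by rewrite -szv -cats1 take_size_cat// => ->; exists i; rewrite cats1.
Qed.

Lemma tadjP u v : reflect
  ((in_tree nch u /\ exists2 i, v = rcons u i & (i < nch u)%N) \/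
   (in_tree nch v /\ exists2 i, u = rcons v i & (i < nch v)%N)) (tadj nch u v).
Proof.
apply: (iffP and3P) => [[tu tv /orP[/parent_ofP[i ev]|/parent_ofP[i eu]]]|].
- by left; move: tv; rewrite ev in_tree_rcons => /andP[_ ?]; split=> //; exists i.
- by right; move: tu; rewrite eu in_tree_rcons => /andP[_ ?]; split=> //; exists i.
case=> -[t [i -> ilt]]; rewrite in_tree_rcons t ilt; split=> //; apply/orP.
  by left; apply/parent_ofP; exists i.
by right; apply/parent_ofP; exists i.
Qed.

Lemma tadj_treer u v : tadj nch u v -> in_tree nch v.
Proof. by case/and3P. Qed.

Lemma tadjC u v : tadj nch u v = tadj nch v u.
Proof. by rewrite /tadj orbC; case: (in_tree nch u); case: (in_tree nch v). Qed.

Lemma tadj_child u i : in_tree nch u -> (i < nch u)%N -> tadj nch u (rcons u i).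
Proof. by move=> tu iu; apply/tadjP; left; split=> //; exists i. Qed.

Lemma tadj_irr u : tadj nch u u = false.
Proof.
apply/negP => /tadjP[] [_ [i /(congr1 size)]]; rewrite size_rcons => /eqP;
by rewrite -[X in X == _]addn0 -addn1 eqn_add2l.
Qed.

Definition nbrs (u : label) : seq label :=
  take (size u).-1 u :: [seq rcons u i | i <- iota 0 (nch u)].

Lemma tadj_nbrs u v : tadj nch u v -> v \in nbrs u.
Proof.
case/tadjP=> -[_ [i -> ilt]]; rewrite /nbrs inE.
  by apply/orP; right; apply/mapP; exists i => //; rewrite mem_iota.
by rewrite size_rcons /= -cats1 take_size_cat ?eqxx.
Qed.

Lemma nonback_down u i v : tadj nch (rcons u i) v -> v <> u ->
  exists2 j, v = rcons (rcons u i) j & (j < nch (rcons u i))%N.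
Proof.
by case/tadjP=> -[_ [j e ?]] neq; [exists j | case: neq; case: (rcons_inj e)].
Qed.

(** Once the walk steps to a child it descends forever: the only upward neighbour is the vertex it
    has just left. *)
Lemma nonback_walk_down (p : nat -> label) k i :
  (forall n, tadj nch (p n) (p n.+1)) -> (forall n, p n.+2 <> p n) ->
  p k.+1 = rcons (p k) i -> forall n, exists j, p (k + n).+1 = rcons (p (k + n)%N) j.
Proof.
move=> adj nb ek; elim=> [|n [j ej]]; first by exists i; rewrite addn0.
rewrite addnS; have := adj (k + n).+1; rewrite ej => /nonback_down.
by case=> [|l -> _]; [rewrite -?ej; exact: nb | exists l].
Qed.

Lemma nonback_walk_size (p : nat -> label) k i :
  (forall n, tadj nch (p n) (p n.+1)) -> (forall n, p n.+2 <> p n) ->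
  p k.+1 = rcons (p k) i -> forall n, size (p (k + n)%N) = (size (p k) + n)%N.
Proof.
move=> adj nb ek; elim=> [|n IH]; first by rewrite !addn0.
by have [j] := nonback_walk_down adj nb ek n; rewrite !addnS => ->; rewrite size_rcons IH.
Qed.

(** Every upward step shortens the label, so a walk cannot climb forever. *)
Lemma nonback_walk_eventually_down (p : nat -> label) :
  (forall n, tadj nch (p n) (p n.+1)) -> exists k i, p k.+1 = rcons (p k) i.
Proof.
move=> adj; apply: contrapT => H.
have up k : (size (p k) + k = size (p 0))%N.
  elim: k => [|k IH]; first by rewrite addn0.
  case/tadjP: (adj k) => -[_ [i e _]]; first by case: H; exists k, i.
  by rewrite -IH e size_rcons addnS addSn.
have := up (size (p 0)%N).+1; move/eqP; rewrite addnC; apply/negP.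
by rewrite neq_ltn; apply/orP; right; rewrite addSn ltnS leq_addr.
Qed.

Lemma nonback_walk_exits (p : nat -> label) (G : seq label) :
  (forall n, tadj nch (p n) (p n.+1)) -> (forall n, p n.+2 <> p n) ->
  exists n, p n \notin G.
Proof.
move=> adj nb; have [k [i ek]] := nonback_walk_eventually_down adj.
have szk := nonback_walk_size adj nb ek.
exists (k + (\max_(x <- G) size x).+1)%N; apply/negP => pG.
have : (size (p (k + (\max_(x <- G) size x).+1)%N) <= \max_(x <- G) size x)%N.
  by apply: (@leq_bigmax_seq _ _ xpredT size).
by rewrite szk leqNgt addnS ltnS leq_addl.
Qed.

End Tree.

Section Arborescence.
Variables (nch : label -> nat) (G : seq label) (out : label -> label).

(** The rank is the number of steps needed to leave [G]; it turns acyclicity into a strictly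
    decreasing quantity. *)
Lemma arb_rank : is_arb nch G out ->
  exists rk : label -> nat, forall v, v \in G -> (rk (out v) < rk v)%N.
Proof.
case=> _ ex; pose rk v := if pselect (exists n, iter n out v \notin G) is left h
   then ex_minn h else 0%N.
exists rk => v vG; rewrite {2}/rk; case: pselect => [h|[]]; last exact: ex.
case: ex_minnP => -[|n]; first by rewrite /= vG.
rewrite iterSr => nG nmin; rewrite ltnS /rk; case: pselect => // h2.
by case: ex_minnP => m _; apply.
Qed.

Lemma arb_no2cycle : is_arb nch G out ->
  forall v, v \in G -> out v \in G -> out (out v) <> v.
Proof.
case/arb_rank => rk rkP v vG oG e.
by have := ltn_trans (rkP _ oG) (rkP _ vG); rewrite e ltnn.
Qed.

(** In a tree the only possible oriented cycles are 2-cycles: a future without immediate reversals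
    is a non-backtracking walk, and such a walk leaves every finite set. *)
Lemma no2cycle_arb : (forall v, v \in G -> tadj nch v (out v)) ->
  (forall v, v \in G -> out v \in G -> out (out v) <> v) -> is_arb nch G out.
Proof.
move=> adj nc; split=> // v vG; apply: contrapT => H.
have inG n : iter n out v \in G by apply/negPn/negP => nG; apply: H; exists n.
case: (@nonback_walk_exits nch (fun n => iter n out v) G) => [n|n|n].
- exact/adj/inG.
- by have /= := nc _ (inG n) (inG n.+1).
- by rewrite inG.
Qed.

Lemma arb_uniq_traject x n : is_arb nch G out ->
  (forall j, (j <= n)%N -> iter j out x \in G) -> uniq (traject out x n.+1).
Proof.
case/arb_rank => rk rkP; elim: n x => [//|n IH] x inG.
rewrite trajectS cons_uniq IH ?andbT; last first.
  by move=> j jn; rewrite -iterSr; exact: inG.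
apply/trajectP => -[i ilt e].
have lt j : (j <= n.+1)%N -> (rk (iter j.+1 out x) < rk x)%N.
  elim: j => [|j IHj] jn; first by apply/rkP/(inG 0%N).
  by apply: (leq_trans (rkP _ (inG _ jn))); apply: ltnW; apply: IHj; exact: ltnW.
by have := lt i (ltnW ilt); rewrite iterSr -e ltnn.
Qed.

End Arborescence.

Section Exchange.
Variables (R : realType) (nch : label -> nat) (W : label -> bool -> R).
Variables (G : seq label) (out : label -> label).
Hypothesis arbout : is_arb nch G out.

(* Redirect [x] to [z] and reverse the first [n] steps of the future of [x]. *)
Definition reroute (x z : label) (n : nat) (y : label) : label :=
  let orb := traject out x n.+1 in
  if y \in orb then nth x (z :: orb) (index y orb) else out y.

Variables (x z : label) (n : nat).
Hypotheses (xz : tadj nch x z) (zout : z <> out x) (zx : z \notin G \/ out z <> x).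
Hypothesis inG : forall j, (j <= n)%N -> iter j out x \in G.

Let orb := traject out x n.+1.
Let uorb : uniq orb := arb_uniq_traject arbout inG.

Lemma rerouteE j : (j <= n)%N ->
  reroute x z n (iter j out x) = if j is k.+1 then iter k out x else z.
Proof.
move=> jn; rewrite /reroute -/orb.
have e : iter j out x = nth x orb j by rewrite nth_traject.
have szj : (j < size orb)%N by rewrite size_traject.
rewrite e mem_nth// index_uniq//.
by case: j jn e szj => [//|k] kn _ _; rewrite [LHS]nth_traject // ltnW.
Qed.

Let reroute0 : reroute x z n x = z.
Proof. exact: (@rerouteE 0%N). Qed.

(** Only 2-cycles have to be excluded. [zout] forbids one along the reversed first edge, [zx]
    forbids one between [x] and a [z] off the orbit, and a 2-cycle inside the orbit would contradict
    its injectivity. *)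
Lemma reroute_arb : is_arb nch G (reroute x z n).
Proof.
have [adj _] := arbout; have nc := arb_no2cycle arbout.
have orbE y : y \in orb -> exists2 j, (j <= n)%N & y = iter j out x.
  by case/trajectP=> j jn ->; exists j.
have injo i j : (i <= n)%N -> (j <= n)%N -> iter i out x = iter j out x -> i = j.
  move=> iin jn e; apply/eqP; rewrite -(nth_uniq x _ _ uorb) ?size_traject//.
  by rewrite !nth_traject// e.
have outE y : y \notin orb -> reroute x z n y = out y.
  by move=> yo; rewrite /reroute -/orb (negbTE yo).
apply: no2cycle_arb => y yG.
  have [/orbE[[|j] jn ->]|yo] := boolP (y \in orb); last by rewrite outE//; exact: adj.
    by rewrite reroute0.
  by rewrite rerouteE// tadjC; apply/adj/inG/ltnW.
have [/orbE[[|j] jn ->]|yo] := boolP (y \in orb).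
- rewrite reroute0 => zG.
  have [/orbE[j jn' ze]|zo] := boolP (z \in orb); last first.
    by rewrite outE//; case: zx => //; rewrite zG.
  rewrite [X in reroute _ _ _ X]ze rerouteE//; case: j jn' ze => [|j] jn' ze.
    by move: xz; rewrite ze /= tadj_irr.
  by move=> /(injo j 0%N (ltnW jn') isT) j0; apply: zout; rewrite ze j0.
- rewrite rerouteE// => _; case: j jn => [|j] jn; first by rewrite reroute0; exact: zout.
  rewrite rerouteE; last exact: ltnW.
  by move=> /injo => /(_ (ltnW (ltnW jn)) jn)/eqP; rewrite -[X in X == _]addn0 -addn2 eqn_add2l.
- rewrite outE// => oG.
  have [/orbE[j jn e]|oo] := boolP (out y \in orb); last by rewrite outE//; exact: nc.
  rewrite e rerouteE//; case: j jn e => [|j] jn e.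
    by move=> zy; case: zx => [|]; rewrite zy ?yG.
  by move=> jy; move: yo; rewrite -jy => /negP; apply; apply/trajectP; exists j; rewrite // ltnS ltnW.
Qed.

Lemma reroute_weight :
  arb_weight W G (reroute x z n) - arb_weight W G out =
  owt W x z + \sum_(j < n) owt W (iter j.+1 out x) (iter j out x)
  - \sum_(j < n.+1) owt W (iter j out x) (iter j.+1 out x).
Proof.
have po : perm_eq [seq y <- undup G | y \in orb] orb.
  apply: uniq_perm => //; first by rewrite filter_uniq ?undup_uniq.
  move=> y; rewrite mem_filter mem_undup; case yo : (y \in orb) => //=.
  by move/trajectP: yo => [j jn ->]; exact: inG.
rewrite /arb_weight -sumrB (bigID (mem orb))/= [X in _ + X]big1 ?addr0; last first.
  by move=> y /negbTE yo; rewrite /reroute -/orb yo subrr.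
rewrite -big_filter (perm_big _ po) (big_nth x) size_traject big_mkord /=.
rewrite sumrB; congr (_ - _); last first.
  by apply: eq_bigr => j _; rewrite nth_traject.
rewrite big_ord_recl; congr (_ + _).
  by rewrite (_ : nth _ _ _ = iter 0 out x) ?rerouteE// nth_traject.
apply: eq_bigr => j _.
have -> : nth x orb (lift ord0 j) = iter j.+1 out x by rewrite nth_traject.
by rewrite rerouteE.
Qed.

End Exchange.

(** * Partial costs of futures and surviving walks *)

Section Potential.
Variables (R : realType) (nch : label -> nat) (W : label -> bool -> R).

(* Partial cost of the oriented path v -> out v -> ... when each oriented edge
   met on the way is traded for the reversal of the previous one. *)
Fixpoint path_cost (out : label -> label) (n : nat) (x : label) : R :=
  if n is m.+1
  then owt W x (out x) - owt W (out x) x + path_cost out m (out x)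
  else owt W x (out x).

Lemma path_costE out n x : path_cost out n x =
  \sum_(j < n.+1) owt W (iter j out x) (iter j.+1 out x)
  - \sum_(j < n) owt W (iter j.+1 out x) (iter j out x).
Proof.
elim: n x => [|n IH] x; first by rewrite big_ord1 big_ord0 subr0.
have eA m : \sum_(j < m.+1) owt W (iter j out x) (iter j.+1 out x) = owt W x (out x) +
    \sum_(j < m) owt W (iter j out (out x)) (iter j.+1 out (out x)).
  by rewrite big_ord_recl; congr (_ + _); apply: eq_bigr => j _; rewrite -!iterSr.
have eB m : \sum_(j < m.+1) owt W (iter j.+1 out x) (iter j out x) = owt W (out x) x +
    \sum_(j < m) owt W (iter j.+1 out (out x)) (iter j out (out x)).
  by rewrite big_ord_recl; congr (_ + _); apply: eq_bigr => j _; rewrite -!iterSr.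
rewrite eA eB [path_cost _ _ _]/= IH; ring.
Qed.

(* [surv k v a b]: some non-backtracking walk of k steps starting with v -> a
   keeps all its partial costs below b. *)
Fixpoint surv (k : nat) (v a : label) (b : R) : Prop :=
  if k is k'.+1 then
    owt W v a <= b /\
    exists c, [/\ tadj nch a c, c <> v & surv k' a c (b - owt W v a + owt W a v)]
  else True.

Definition survives v a b := forall k, surv k v a b.

Lemma surv_mono k v a b b' : b <= b' -> surv k v a b -> surv k v a b'.
Proof.
elim: k v a b b' => [//|k IH] v a b b' bb' /= [wb [c [ac cv s]]].
split; first exact: le_trans bb'.
by exists c; split=> //; apply: IH s; rewrite lerD2r lerB.
Qed.

Lemma survS k v a b : surv k.+1 v a b -> surv k v a b.
Proof.
elim: k v a b => [//|k IH] v a b /= [wb [c [ac cv s]]].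
by split=> //; exists c; split=> //; exact: IH.
Qed.

Lemma survives_mono v a b b' : b <= b' -> survives v a b -> survives v a b'.
Proof. by move=> bb' s k; apply: surv_mono (s k). Qed.

(** The pigeonhole behind every compactness argument below: if each candidate failed at some stage,
    all finitely many would have failed at the largest of these stages. *)
Lemma finite_antitone (T : eqType) (s : seq T) (Q : T -> nat -> Prop) :
  (forall x k, Q x k.+1 -> Q x k) ->
  (forall k, exists2 x, x \in s & Q x k) -> exists2 x, x \in s & forall k, Q x k.
Proof.
move=> dec ex; apply: contrapT => H.
have dec' x k k' : (k' <= k)%N -> Q x k -> Q x k'.
  by move=> /subnK <-; elim: (k - k')%N => [//|m IH] /dec.
suff [K HK] : exists K, forall x, x \in s -> ~ Q x K.
  by have [x xs /(HK _ xs)] := ex K.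
have : forall x, x \in s -> exists k, ~ Q x k.
  move=> x xs; apply: contrapT => nk; apply: H; exists x => // k.
  by apply: contrapT => nQ; apply: nk; exists k.
elim: s {ex H} => [|y s IH] h; first by exists 0%N.
have [|K HK] := IH; first by move=> x xs; apply: h; rewrite inE xs orbT.
have [|k hk] := h y; first by rewrite inE eqxx.
exists (maxn k K) => x; rewrite inE => /orP[/eqP ->|xs].
  by move=> /(dec' _ _ _ (leq_maxl _ _)).
by move=> /(dec' _ _ _ (leq_maxr _ _)); exact: HK.
Qed.

(** By local finiteness a single continuation [c] serves all step counts at once. *)
Lemma survivesP v a b : survives v a b <->
  owt W v a <= b /\
  exists c, [/\ tadj nch a c, c <> v & survives a c (b - owt W v a + owt W a v)].
Proof.
split=> [s|[wb [c [ac cv s]]] [|k] //]; last first.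
  by split=> //; exists c; split=> //; exact: s.
split; first by have [] := s 1%N.
have [||c _ h] := @finite_antitone _ (nbrs nch a)
  (fun c k => [/\ tadj nch a c, c <> v & surv k a c (b - owt W v a + owt W a v)]).
- by move=> c k [? ? /survS].
- move=> k; have [_ [c [ac cv sk]]] := s k.+1; exists c => //.
  exact: (@tadj_nbrs nch).
exists c; split; [by have [] := h 0%N|by have [] := h 0%N|].
by move=> k; have [] := h k.
Qed.

End Potential.

Section Minimal.
Variables (R : realType) (nch : label -> nat) (W : label -> bool -> R).
Variables (G : seq label) (out : label -> label).
Hypothesis msa : is_MSA nch W G out.

Lemma msa_exchange x z n : tadj nch x z -> z <> out x -> z \notin G \/ out z <> x ->
  (forall j, (j <= n)%N -> iter j out x \in G) -> path_cost W out n x <= owt W x z.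
Proof.
case: msa => arb opt xz zout zx inG.
have := opt _ (reroute_arb arb xz zout zx inG).
rewrite -subr_ge0 (reroute_weight W arb z inG) path_costE.
by rewrite -addrA -opprB subr_ge0.
Qed.

(** If [out z] is not [x] (or [z] is outside [G]), one exchange bounds the cost by the weight of the
    edge to [z], hence by [b]. If [out z = x], the future of [z] runs through [x], and the claim for
    [z] with the next vertex [c] of the competing walk is the claim for [x]: costs and budget change
    by the same amount. *)
Lemma msa_cost_surv : exists N, forall x z b, x \in G -> tadj nch x z -> z <> out x ->
  surv nch W N x z b ->
  forall n, (forall j, (j <= n)%N -> iter j out x \in G) -> path_cost W out n x <= b.
Proof.
have arb : is_arb nch G out by case: msa.
have [rk rkP] := arb_rank arb.
have adj : forall v, v \in G -> tadj nch v (out v) by case: arb.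
(* Each passage from [x] to a [z] with [out z = x] raises the rank, so the competing walk is
   followed for at most as many steps as the maximal rank. *)
exists (\max_(v <- G) rk v).+1.
suff: forall N x z b, (\max_(v <- G) rk v < N + rk x)%N -> x \in G ->
    tadj nch x z -> z <> out x -> surv nch W N x z b ->
    forall n, (forall j, (j <= n)%N -> iter j out x \in G) -> path_cost W out n x <= b.
  by move=> H x z b xG; apply: H => //; rewrite addSn ltnS leq_addr.
elim=> [|N IH] x z b Nx xG xz zout.
  suff: (rk x <= \max_(v <- G) rk v)%N by rewrite leqNgt (Nx : is_true (_ < rk x)%N).
  exact: (@leq_bigmax_seq _ _ xpredT rk).
move=> [wb [c [zc cx s]]] n inG.
have [[zG ozx]|nz] := pselect (z \in G /\ out z = x); last first.
  apply: le_trans wb; apply: msa_exchange => //.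
  by have [zG|] := boolP (z \in G); [right => ozx; apply: nz|left].
have := @IH z c (b - owt W x z + owt W z x) _ zG zc _ s n.+1.
rewrite /= ozx => IHz.
suff : owt W z x - owt W x z + path_cost W out n x <= b - owt W x z + owt W z x by lra.
apply: IHz => //.
  by apply: (leq_trans Nx); rewrite addSnnS leq_add2l -ozx; exact: rkP.
by case=> [//|j] jn; rewrite iterSr ozx; exact: inG.
Qed.

(** The future of [v] is itself a non-backtracking walk, so bounds on its partial costs certify that
    [out v] survives. *)
Lemma msa_surv_out k v b :
  (forall j, (j <= k)%N -> iter j out v \in G) ->
  (forall j, (j <= k)%N -> path_cost W out j v <= b) -> surv nch W k v (out v) b.
Proof.
have arb : is_arb nch G out by case: msa.
have adj : forall v, v \in G -> tadj nch v (out v) by case: arb.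
elim: k v b => [//|k IH] v b inG cost; split; first exact: (cost 0%N).
have oG : out v \in G by exact: (inG 1%N).
exists (out (out v)); split; first exact: adj.
  by apply: (arb_no2cycle arb); [exact: (inG 0%N)|].
apply: IH => j jk; first by rewrite -iterSr; exact: inG.
by have /= := cost j.+1 jk; lra.
Qed.

End Minimal.

Lemma infinite_set_inj_nat (T : Type) (A : set T) (f : nat -> T) :
  injective f -> (forall n, A (f n)) -> infinite_set A.
Proof.
move=> inj fA finA; apply: infinite_nat.
rewrite (_ : setT = f @^-1` A); last first.
  by apply/seteqP; split=> [x _|//]; exact: fA.
by apply: finite_preimage => // x y _ _; exact: inj.
Qed.

(** * The wired limit of a fixed weighted tree *)

Section Limit.
Variables (R : realType) (nch : label -> nat) (W : label -> bool -> R).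
Variable F : label -> label.

(** Survival is monotone in the budget, so [b] witnesses that the set of surviving budgets of [F v]
    strictly contains that of every other neighbour. Comparing sets rather than infima avoids asking
    whether a critical budget is attained. *)
Definition best_heads := forall v, in_tree nch v -> tadj nch v (F v) /\
  exists b, survives nch W v (F v) b /\
    forall a, tadj nch v a -> a <> F v -> ~ survives nch W v a b.

Hypothesis FP : best_heads.

(** The ball of radius [k] around [v] is finite, so the rank [m] can be chosen before the map [out];
    the minimal arborescence changes with [n]. *)
Lemma walk_in_exhaustion (Gs : nat -> seq label) k v : exhaustion nch Gs -> in_tree nch v ->
  exists m, forall n, (m <= n)%N -> forall out : label -> label,
    (forall u, u \in Gs n -> tadj nch u (out u)) ->
    forall j, (j <= k)%N -> iter j out v \in Gs n.
Proof.
move=> [incr [_ cover]].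
have mono m n : (m <= n)%N -> {subset Gs m <= Gs n}.
  by move=> /subnK <-; elim: (n - m)%N => [//|l IH] x /IH /incr.
elim: k v => [|k IH] v tv; have [m0 vm0] := cover _ tv.
  by exists m0 => n mn out _ [|//] _; exact: mono vm0.
have {}IH : forall s : seq label, exists m, forall a, a \in s -> in_tree nch a -> forall n, (m <= n)%N ->
    forall out : label -> label,
    (forall u, u \in Gs n -> tadj nch u (out u)) ->
    forall j, (j <= k)%N -> iter j out a \in Gs n.
  elim=> [|a s [m Hm]]; first by exists 0%N.
  have [ta|nta] := boolP (in_tree nch a); last first.
    exists m => x; rewrite inE => /orP[/eqP -> /(negP nta)//|]; exact: Hm.
  have [m' Hm'] := IH _ ta; exists (maxn m m') => x; rewrite inE => /orP[/eqP -> _ n|xs tx n].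
    by rewrite geq_max => /andP[_]; exact: Hm'.
  by rewrite geq_max => /andP[+ _]; exact: Hm.
have [m Hm] := IH (nbrs nch v).
exists (maxn m m0) => n; rewrite geq_max => /andP[mn m0n] out adj [|j] jk.
  exact: mono vm0.
have vo := adj _ (mono _ _ m0n _ vm0).
by rewrite iterSr; apply: Hm => //; [exact: tadj_nbrs|exact: tadj_treer vo].
Qed.

Lemma best_limit : wired_MSA_limit nch W F.
Proof.
move=> Gs Ts exh msa v tv; have [vF [b [sF sb]]] := FP tv.
(* One horizon [k] at which all the wrong neighbours are dead: if [Ts n v] were wrong, its future
   would survive these [k] steps on budget [b]. *)
have [k Hk] : exists k, forall a, tadj nch v a -> a <> F v -> ~ surv nch W k v a b.
  apply: contrapT => H.
  have [||a _ Ha] := @finite_antitone _ (nbrs nch v)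
    (fun a k => [/\ tadj nch v a, a <> F v & surv nch W k v a b]).
  - by move=> a k [? ? /survS].
  - move=> k; apply: contrapT => nk; apply: H; exists k => a va aF s; apply: nk.
    by exists a => //; exact: tadj_nbrs.
  have [va aF _] := Ha 0%N; apply: (sb a) => // k; by have [] := Ha k.
have [m Hm] := walk_in_exhaustion k exh tv; exists m => n mn.
have [[adj _] _] := msa n.
have inG := Hm n mn _ adj; apply: contrapT => TF.
have vG : v \in Gs n := inG 0%N isT.
have [N HN] := msa_cost_surv (msa n).
apply: (Hk (Ts n v)) => //; first exact: adj.
apply: (msa_surv_out (msa n)) => // j jk.
by apply: (HN v (F v)) => // [/esym//|i ij]; apply/inG/(leq_trans ij).
Qed.

Lemma best_adj v : in_tree nch v -> tadj nch v (F v).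
Proof. by case/FP. Qed.

Lemma best_tree v : in_tree nch v -> in_tree nch (F v).
Proof. by move/best_adj/tadj_treer. Qed.

Lemma iter_tree n v : in_tree nch v -> in_tree nch (iter n F v).
Proof. by move=> tv; elim: n => //= n; exact: best_tree. Qed.

(** If [v] and [F v] pointed at each other, the walk witnessing each choice would continue past the
    other vertex through a neighbour that loses there. This gives two strict inequalities between
    [b] and [b'] whose sum is absurd. *)
Lemma best_no2cycle v : in_tree nch v -> F (F v) <> v.
Proof.
move=> tv e; have [vF [b [s sb]]] := FP tv.
have [Fv [b' []]] := FP (best_tree tv); rewrite e => s' sb'.
move: s => /survivesP[_ [c [Fc cv sc]]].
move: s' => /survivesP[_ [c' [vc' c'F sc']]].
have lt : b' < b - owt W v (F v) + owt W (F v) v.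
  by rewrite ltNge; apply/negP => h; apply: (sb' _ Fc cv); exact: survives_mono sc.
have lt' : b < b' - owt W (F v) v + owt W v (F v).
  by rewrite ltNge; apply/negP => h; apply: (sb _ vc' c'F); exact: survives_mono sc'.
by move: lt lt'; clear; lra.
Qed.

Lemma future_adj v n : in_tree nch v -> tadj nch (iter n F v) (iter n.+1 F v).
Proof. by move=> tv; exact/best_adj/iter_tree. Qed.

Lemma future_nonback v n : in_tree nch v -> iter n.+2 F v <> iter n F v.
Proof. by move=> tv; exact/best_no2cycle/iter_tree. Qed.

Lemma down_future w i : in_tree nch w -> F w = rcons w i ->
  forall n, exists s, iter n F w = w ++ s.
Proof.
move=> tw ei; elim=> [|n [s es]]; first by exists [::]; rewrite cats0.
have [j] := @nonback_walk_down nch (fun n => iter n F w) 0 i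
  (fun n => future_adj n tw) (fun n => @future_nonback w n tw) ei n.
by rewrite add0n => ->; exists (rcons s j); rewrite es rcons_cat.
Qed.

(* [c] cannot point at a child if it pays only the weight of its upward edge. *)
Definition upward (c : label) :=
  forall i, (i < nch c)%N -> ~ survives nch W c (rcons c i) (W c true).

Lemma owt_up (c : label) i : owt W (rcons c i) c = W (rcons c i) true.
Proof. by rewrite /owt size_rcons ltnNge leqnSn. Qed.

Lemma owt_down (c : label) i : owt W c (rcons c i) = W (rcons c i) false.
Proof. by rewrite /owt size_rcons leqnn. Qed.

(** Here [F c] is the parent, so the separating budget is at least [W c true]; a child surviving on
    [W c true] would survive on that budget too. *)
Lemma best_upward c : in_tree nch c -> (forall i, F c <> rcons c i) -> upward c.
Proof.
move=> tc nd i ilt s; have [cF [b [sF sb]]] := FP tc.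
apply: (sb (rcons c i)); [exact: tadj_child|by move/esym; exact: nd|].
have [wb _] := (survivesP _ _ _ _ _).1 sF; apply: survives_mono s.
case/tadjP: cF wb => -[_ [j e _]]; first by case: (nd j).
by move: e; move: (F c) => d ->; rewrite owt_up.
Qed.

Hypothesis nch_gt0 : forall u, in_tree nch u -> (0 < nch u)%N.
Hypothesis no_chain : ~ exists p : nat -> label,
  [/\ p 0%N <> [::], forall n, exists2 i, p n.+1 = rcons (p n) i & (i < nch (p n))%N,
      forall n, in_tree nch (p n) & forall n, upward (p n)].

Lemma best_ray_forward u p : in_tree nch u ->
  ray F (component nch F u) p -> forall n, F (p n) = p n.+1.
Proof.
move=> tu [inj adj] n0; apply: contrapT => nF.
have tp n : in_tree nch (p n) by have [[]] := adj n.
(* One edge traversed against its arrow forces all later ones to be so, since each vertex has a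
   single outgoing arrow. The ray finally descends, and there it is a forbidden chain. *)
have back k : F (p (n0 + k).+1)%N = p (n0 + k)%N.
  elim: k => [|k IH]; first by rewrite addn0; case: (adj n0) => _ [_ []].
  rewrite addnS; case: (adj (n0 + k).+1) => _ [_ [|//]].
  by rewrite IH => /inj/eqP; rewrite -[X in X == _]addn0 -addn2 eqn_add2l.
pose q k := p (n0 + k)%N.
have qadj k : tadj nch (q k) (q k.+1).
  by rewrite tadjC /q -(back k) addnS; apply: best_adj.
have qnb k : q k.+2 <> q k.
  by rewrite /q => /inj/eqP; rewrite eqn_add2l -[X in _ == X]addn0 -addn2 eqn_add2l.
have [k [i ek]] := nonback_walk_eventually_down qadj.
have qd := nonback_walk_down qadj qnb ek.
apply: no_chain; exists (fun n => q (k + n).+1); split.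
- by rewrite addn0 ek; case: (q k).
- move=> n; have [j ej] := qd n.+1; rewrite addnS in ej; exists j; first by rewrite addnS.
  have : in_tree nch (q (k + n).+2) by exact: tp.
  by rewrite ej in_tree_rcons => /andP[].
- by move=> n; exact: tp.
- move=> n; apply: best_upward; first exact: tp.
  move=> j; rewrite {1}/q addnS back -/(q _).
  have [l ->] := qd n => /(congr1 size); rewrite !size_rcons => /eqP.
  by rewrite -[X in X == _]addn0 -addn2 eqn_add2l.
Qed.

Lemma component_ray u : in_tree nch u -> exists p, ray F (component nch F u) p.
Proof.
move=> tu; pose p n := iter n F u.
have padj n : tadj nch (p n) (p n.+1) by exact: future_adj.
have pnb n : p n.+2 <> p n by exact: future_nonback.
have [k [i ek]] := nonback_walk_eventually_down padj.
have sz := nonback_walk_size padj pnb ek.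
exists (fun n => p (k + n)%N); split.
  by move=> m n /(congr1 size); rewrite !sz => /eqP; rewrite eqn_add2l => /eqP.
have pC n : component nch F u (p n).
  by split; [exact: iter_tree | exists n, 0%N].
by move=> n; split=> //; split; [exact: pC|left; rewrite addnS].
Qed.

(** Rays follow the arrows, so two rays are the futures of their starting points, and futures within
    one component meet. *)
Lemma best_one_ended u : in_tree nch u -> one_ended F (component nch F u).
Proof.
move=> tu; split; first exact: component_ray.
move=> [p [q [rp [rq]]]]; apply/existsNP.
have fwd (r : nat -> label) : ray F (component nch F u) r -> forall n, r n = iter n F (r 0%N).
  move=> rr; elim=> // n IH; by rewrite iterS -IH (best_ray_forward tu rr).
have [[_ [m [n emn]]] _] := rp.2 0%N.
have [[_ [m' [n' emn']]] _] := rq.2 0%N.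
exists (m' + n)%N; apply/existsNP; exists (m + n')%N; apply.
by rewrite (fwd _ rp) (fwd _ rq) !iterD -emn -emn' -!iterD addnC.
Qed.

Lemma component_infinite u : in_tree nch u -> infinite_set (component nch F u).
Proof.
move=> tu; have [p [inj adj]] := component_ray tu.
by apply: (infinite_set_inj_nat inj) => n; case: (adj n).
Qed.

(** Otherwise the leftmost line of descent from [c] would be a forbidden chain. *)
Lemma exists_downward c : in_tree nch c -> c <> [::] ->
  exists s, in_tree nch (c ++ s) /\ exists i, F (c ++ s) = rcons (c ++ s) i.
Proof.
move=> tc c0; apply: contrapT => H; apply: no_chain.
pose p n := c ++ nseq n 0%N.
have pS n : p n.+1 = rcons (p n) 0%N.
  by rewrite /p rcons_cat; congr cat; elim: n => //= n ->.
have tp n : in_tree nch (p n).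
  elim: n => [|n IH]; first by rewrite /p cats0.
  by rewrite pS in_tree_rcons IH nch_gt0.
exists p; split.
- by rewrite /p cats0.
- by move=> n; exists 0%N => //; exact: nch_gt0.
- by [].
- move=> n; apply: best_upward => // i e; apply: H.
  by exists (nseq n 0%N); split; [exact: tp|exists i].
Qed.

Hypothesis branching : forall m, exists2 n, (m <= n)%N & (1 < nch (nseq n 0%N))%N.

Lemma infinitely_many_components : infinite_set [set C : set label |
  exists2 u, in_tree nch u & C = component nch F u /\ infinite_set C].
Proof.
have t0 n : in_tree nch (nseq n 0%N).
  elim: n => // n IH; rewrite (_ : nseq n.+1 0%N = rcons (nseq n 0%N) 0%N); last first.
    by elim: n {IH} => //= n ->.
  by rewrite in_tree_rcons IH nch_gt0.
have [a aP] := choice (fun m => let: ex_intro2 n x y := branching m in ex_intro _ n (conj x y)).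
pose b n := iter n (fun k => a k.+1) (a 0%N).
have b1 n : (1 < nch (nseq (b n) 0%N))%N.
  by case: n => [|n]; [have [] := aP 0%N|have [] := aP (b n).+1].
have bS n : (b n < b n.+1)%N by have [] := aP (b n).+1.
have bmono m n : (m < n)%N -> (b m < b n)%N.
  elim: n => // n IH; rewrite ltnS leq_eqVlt => /orP[/eqP ->//|/IH h].
  exact: ltn_trans (bS n).
(* The second children of the branching vertices on the leftmost line root disjoint subtrees. Each
   contains a vertex pointing downwards, and from there the future never leaves the subtree. *)
pose x n := rcons (nseq (b n) 0%N) 1%N.
have tx n : in_tree nch (x n) by rewrite in_tree_rcons t0 b1.
have x0 n : x n <> [::] by rewrite /x; case: (nseq _ _).
have [s sP] := choice (fun n => exists_downward (tx n) (@x0 n)).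
have disj m n : (m < n)%N -> ~ same_comp F (x m ++ s m) (x n ++ s n).
  move=> mn [k [l]]; have [tm [i ei]] := sP m; have [tn [j ej]] := sP n.
  have [r ->] := down_future tm ei k; have [r' ->] := down_future tn ej l.
  (* At position [b m] the labels below [x m] have letter 1, those below [x n] letter 0. *)
  move=> /(congr1 (nth 0%N ^~ (b m))).
  rewrite -!catA !nth_cat !size_rcons !size_nseq ltnS leqnn (ltnW _); last first.
    by rewrite ltnS bmono.
  by rewrite !nth_rcons !size_nseq ltnn eqxx bmono// nth_nseq bmono.
apply: (@infinite_set_inj_nat _ _ (fun n => component nch F (x n ++ s n))); last first.
  move=> n; have [tn _] := sP n; exists (x n ++ s n) => //; split=> //.
  exact: component_infinite.
have cself n : component nch F (x n ++ s n) (x n ++ s n).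
  by have [tn _] := sP n; split=> //; exists 0%N, 0%N.
move=> m n e; case: (ltngtP m n) => // mn; exfalso; apply: (disj _ _ mn).
  by have := cself n; rewrite -e => -[].
by have := cself m; rewrite e => -[].
Qed.

Lemma best_conclusion : conclusion nch W.
Proof.
exists F; split; first exact: best_limit.
by split; [exact: infinitely_many_components|exact: best_one_ended].
Qed.

End Limit.

(** * Conservation of energy *)

Section Subdivision.
Variable R : realType.

(** Cutting the interval into n equal pieces leaves a total error of C (b - a)^2 / n. This replaces
    the sign of a derivative. *)
Lemma quadratic_nonincreasing (F : R -> R) (a b C : R) : a <= b ->
  (forall x y : R, a <= x -> x <= y -> y <= b -> F y <= F x + C * (y - x) ^+ 2) -> F b <= F a.
Proof.
move=> ab H; rewrite leNgt; apply/negP => lt.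
pose e := F b - F a; have e0 : 0 < e by rewrite subr_gt0.
pose n := (Num.truncn (`|C| * (b - a) ^+ 2 / e)).+1.
have n0 : 0 < n%:R :> R by rewrite ltr0n.
have nlt : `|C| * (b - a) ^+ 2 / e < n%:R by exact: truncnS_gt.
pose d := (b - a) / n%:R.
have d0 : 0 <= d by rewrite divr_ge0// subr_ge0.
have step k : (k <= n)%N -> F (a + k%:R * d) <= F a + k%:R * (C * d ^+ 2).
  elim: k => [|k IH] kn; first by rewrite !mul0r !addr0.
  have := H (a + k%:R * d) (a + k.+1%:R * d); rewrite [X in C * X ^+ 2](_ : _ = d); last first.
    by rewrite -natr1; ring.
  have h1 : a <= a + k%:R * d by rewrite lerDl mulr_ge0.
  have h2 : a + k%:R * d <= a + k.+1%:R * d.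
    by rewrite lerD2l ler_wpM2r// ler_nat.
  have h3 : a + k.+1%:R * d <= b.
    have -> : b = a + n%:R * d by rewrite /d mulrC divfK ?gt_eqF//; ring.
    by rewrite lerD2l ler_wpM2r// ler_nat.
  move=> /(_ h1 h2 h3) /le_trans; apply.
  rewrite -[k.+1%:R]natr1 mulrDl mul1r addrA lerD2r; exact/IH/ltnW.
have := step n (leqnn _).
have -> : a + n%:R * d = b by rewrite /d mulrC divfK ?gt_eqF//; ring.
apply/negP; rewrite -ltNge.
have -> : n%:R * (C * d ^+ 2) = C * (b - a) ^+ 2 / n%:R.
  by rewrite /d; field; rewrite gt_eqF.
rewrite -ltrBrDl -/e ltr_pdivrMr// [ltRHS]mulrC.
apply: le_lt_trans (_ : `|C| * (b - a) ^+ 2 < _).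
  by rewrite ler_wpM2r ?sqr_ge0// ler_norm.
by rewrite -ltr_pdivrMr.
Qed.

Lemma expR_quad (d : R) : 0 <= d ->
  [/\ 0 <= 1 - expR (- d), 1 - expR (- d) <= d & d - d ^+ 2 <= 1 - expR (- d)].
Proof.
move=> d0; have e1 := expR_ge1Dx (- d); have e2 := expR_ge1Dx d.
split; [|lra|].
  by rewrite subr_ge0 expR_le1; lra.
have : expR (- d) <= 1 - d + d ^+ 2.
  have q0 : 0 < 1 - d + d ^+ 2 by have := sqr_ge0 (d - 1/2); rewrite sqrrB; lra.
  (* Since (1 - d + d^2)(1 + d) = 1 + d^3. *)
  have q1 : 1 <= (1 - d + d ^+ 2) * expR d.
    apply: (@le_trans _ _ ((1 - d + d ^+ 2) * (1 + d))); last by rewrite ler_pM2l.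
    by have := exprn_ge0 3 d0; rewrite !exprS expr0; lra.
  have := ler_wpM2l (expR_ge0 (- d)) q1.
  by rewrite mulr1 mulrCA -expRD addNr expR0 mulr1.
by lra.
Qed.

Lemma relax_dist (c a b : R) : 0 <= c <= 1 -> 0 <= b <= 1 ->
  0 <= a - c * b <= 1 - c -> `|a - b| <= 1 - c.
Proof.
move=> /andP[c0 c1] /andP[b0 b1] /andP[h1 h2].
have : 0 <= (1 - c) * b by rewrite mulr_ge0// subr_ge0.
have : (1 - c) * b <= 1 - c by rewrite ler_piMr// subr_ge0.
by move: h1 h2; rewrite ler_norml => *; apply/andP; split; lra.
Qed.

Lemma expRN01 (d : R) : 0 <= d -> 0 <= expR (- d) <= 1.
Proof. by move=> d0; rewrite expR_ge0 expR_le1 oppr_le0. Qed.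

End Subdivision.

Section Energy.
Variables (R : realType) (g K : R -> R) (m C kap : R).
Hypothesis m0 : 0 <= m.
Hypothesis C0 : 0 <= C.
Hypothesis kap0 : 0 < kap.
Hypothesis g_ge0 : forall x : R, 0 <= x <= 1 -> 0 <= g x.
(** A quantitative form of g(x) < x strictly between 0 and 1. It makes K strictly decreasing and
    leaves 0 and 1 as the only possible limits of f. *)
Hypothesis g_le : forall x : R, 0 <= x <= 1 -> g x <= x - kap * (x * (1 - x)).
Hypothesis g_lip : forall x y : R, 0 <= x <= 1 -> 0 <= y <= 1 -> `|g y - g x| <= m * `|y - x|.
Hypothesis K_quad : forall x y : R, 0 <= x <= 1 -> 0 <= y <= 1 ->
  `|K y - K x - (y - x) * (g x - x)| <= C * (y - x) ^+ 2.

Lemma K_nincr (x y : R) : 0 <= x -> x <= y -> y <= 1 -> K y <= K x.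
Proof.
move=> x0 xy y1; apply: (@quadratic_nonincreasing _ K x y C) => // s t xs st ty.
have s01 : 0 <= s <= 1 by apply/andP; split; lra.
have t01 : 0 <= t <= 1 by apply/andP; split; lra.
have := K_quad s01 t01; rewrite ler_norml => /andP[_].
have gs : g s - s <= 0.
  have := g_le s01; have : 0 <= kap * (s * (1 - s)).
    by apply: mulr_ge0; [exact: ltW|apply: mulr_ge0; lra].
  by lra.
have : (t - s) * (g s - s) <= 0 by rewrite mulr_ge0_le0//; lra.
by lra.
Qed.

Lemma K_decr (x : R) : 0 <= x -> x < 1 -> K 1 < K x.
Proof.
have pos (y : R) : 0 < y -> y < 1 -> K 1 < K y.
  move=> y0 y1; have y01 : 0 <= y <= 1 by apply/andP; split; lra.
  pose c := kap * (y * (1 - y)).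
  have c0 : 0 < c by rewrite !mulr_gt0//; lra.
  (* So small that the quadratic error is at most half of the first-order decrease [c * d]. *)
  pose d := Num.min (1 - y) (c / (2 * (C + 1))).
  have d0 : 0 < d by rewrite lt_min; apply/andP; split; [lra|apply: divr_gt0 => //; move: C0; lra].
  have d1 : d <= 1 - y by rewrite ge_min lexx.
  have d2 : C * d <= c / 2.
    apply: (@le_trans _ _ ((C + 1) * (c / (2 * (C + 1))))); last first.
      by rewrite le_eqVlt; apply/orP; left; apply/eqP; field; rewrite gt_eqF//; move: C0; lra.
    by rewrite ler_pM ?(ltW d0)//; [move: C0; lra|rewrite ge_min lexx orbT].
  have yd01 : 0 <= y + d <= 1 by apply/andP; split; lra.
  have := K_quad y01 yd01; rewrite ler_norml => /andP[_].
  rewrite (_ : y + d - y = d); last by ring.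
  have : d * (g y - y) <= d * (- c).
    by rewrite ler_pM2l//; have := g_le y01; rewrite -/c; lra.
  have : C * d ^+ 2 <= c / 2 * d by rewrite expr2 mulrA ler_pM2r.
  have : 0 < c * d by rewrite mulr_gt0.
  have : K 1 <= K (y + d) by apply: K_nincr; lra.
  by lra.
(* At 0 the slope of K vanishes, so the strict decrease is borrowed from the point 1/2. *)
rewrite le_eqVlt => /orP[/eqP <- _|]; last exact: pos.
apply: (@lt_le_trans _ _ (K 2^-1)); first by apply: pos; lra.
by apply: K_nincr; lra.
Qed.

Lemma K_lip0 (x : R) : 0 <= x <= 1 -> `|K x - K 0| <= (1 + C) * x.
Proof.
move=> x01; have z01 : 0 <= (0:R) <= 1 by rewrite lexx ler01.
have := K_quad z01 x01; rewrite !subr0.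
have -> : g 0 = 0.
  by apply/eqP; rewrite eq_le g_ge0// andbT; have := g_le z01; rewrite !mul0r mulr0 subr0.
rewrite mulr0 subr0 => /le_trans; apply.
have /andP[x0 x1] := x01.
have : x ^+ 2 <= x by rewrite expr2 ler_piMl.
by move=> /(ler_wpM2l C0); lra.
Qed.

(* [ph] averages [f] ahead of [x] with Exponential(1) weights, [h] averages
   [ps] behind [b]; both relations are stated on a window of length [d]. *)
Definition avg_ahead (f ph : R -> R) := forall x d lo hi : R, 0 <= x -> 0 <= d ->
  (forall r, 0 <= r <= d -> lo <= f (x + r) <= hi) ->
  (1 - expR (- d)) * lo <= ph x - expR (- d) * ph (x + d) <= (1 - expR (- d)) * hi.

Definition avg_behind (ps h : R -> R) := forall b d lo hi : R, 0 <= b -> 0 <= d ->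
  (forall r, 0 <= r <= d -> lo <= ps (b + r) <= hi) ->
  (1 - expR (- d)) * lo <= h (b + d) - expR (- d) * h b <= (1 - expR (- d)) * hi.

Definition unit_valued (f : R -> R) := forall x : R, 0 <= x -> 0 <= f x <= 1.

Lemma unit_window f x d : unit_valued f -> 0 <= x ->
  forall r : R, 0 <= r <= d -> 0 <= f (x + r) <= 1.
Proof. by move=> f01 x0 r /andP[r0 _]; apply: f01; exact: addr_ge0. Qed.

Lemma avg_ahead_lip f ph : unit_valued f -> unit_valued ph -> avg_ahead f ph ->
  forall x d : R, 0 <= x -> 0 <= d -> `|ph (x + d) - ph x| <= d.
Proof.
move=> f01 ph01 A x d x0 d0; have [_ e1 _] := expR_quad d0.
apply: le_trans e1; rewrite distrC; apply: relax_dist.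
- exact: expRN01.
- exact/ph01/addr_ge0.
- by have := A x d 0 1 x0 d0 (unit_window f01 x0); rewrite mulr0 mulr1.
Qed.

Lemma avg_behind_lip ps h : unit_valued ps -> unit_valued h -> avg_behind ps h ->
  forall x d : R, 0 <= x -> 0 <= d -> `|h (x + d) - h x| <= d.
Proof.
move=> f01 h01 A x d x0 d0; have [_ e1 _] := expR_quad d0.
apply: le_trans e1; apply: relax_dist.
- exact: expRN01.
- exact: h01.
- by have := A x d 0 1 x0 d0 (unit_window f01 x0); rewrite mulr0 mulr1.
Qed.

End Energy.

Lemma expR_window_mul (R : realType) (d z : R) : 0 <= d -> `|z| <= 1 ->
  `|(1 - expR (- d)) * z - d * z| <= d ^+ 2.
Proof.
move=> d0 z1; have [_ h1 h2] := expR_quad d0.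
rewrite -mulrBl normrM -[leRHS]mulr1 ler_pM//.
by rewrite ler_norml; apply/andP; split; lra.
Qed.

Lemma unit_dist (R : realType) (a b : R) : 0 <= a <= 1 -> 0 <= b <= 1 -> `|a - b| <= 1.
Proof.
move=> /andP[? ?] /andP[? ?]; rewrite ler_norml; apply/andP; split; lra.
Qed.

(** Primed letters are values a step [d] later, and [f] stands for g(h). To first order the energy
    moves at rate (p - h)((p - f) - (s - h)) + (f - h)(s - h) = (p - f)(p - s). The remainder splits
    into five terms of order d^2. *)
Lemma energy_algebra (R : realType) (d f p s h p' h' k k' c C : R) : 0 <= d -> 0 <= C ->
  0 <= f <= 1 -> 0 <= p <= 1 -> 0 <= h <= 1 ->
  `|h' - h - d * (s - h)| <= 2 * d ^+ 2 -> `|p' - p - d * (p - f)| <= c * d ^+ 2 ->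
  `|h' - h| <= d -> `|p' - p| <= d ->
  `|k' - k - (h' - h) * (f - h)| <= C * (h' - h) ^+ 2 ->
  `|(p' - h') ^+ 2 / 2 + k' - ((p - h) ^+ 2 / 2 + k) - d * ((p - f) * (p - s))|
     <= (c + C + 6) * d ^+ 2.
Proof.
move=> d0 C0 f01 p01 h01 Hh Hp dh dp Hk.
have ph := unit_dist p01 h01; have fh := unit_dist f01 h01.
set eta := h' - h - _ in Hh; set zeta := p' - p - _ in Hp; set kk := k' - k - _ in Hk.
have -> : (p' - h') ^+ 2 / 2 + k' - ((p - h) ^+ 2 / 2 + k) - d * ((p - f) * (p - s)) =
  (p - h) * zeta - (p - h) * eta + (p' - p - (h' - h)) ^+ 2 / 2 + eta * (f - h) + kk.
  by rewrite /eta /zeta /kk; field.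
have b1 : `|(p - h) * zeta| <= c * d ^+ 2.
  by rewrite normrM -[leRHS]mul1r ler_pM.
have b2 : `|(p - h) * eta| <= 2 * d ^+ 2.
  by rewrite normrM -[leRHS]mul1r ler_pM.
have b3 : `|eta * (f - h)| <= 2 * d ^+ 2.
  by rewrite normrM -[leRHS]mulr1 ler_pM.
have b4 : `|kk| <= C * d ^+ 2.
  apply: (le_trans Hk); rewrite ler_wpM2l// -[leLHS]real_normK ?num_real//.
  by rewrite lerXn2r ?nnegrE.
have b5 : `|(p' - p - (h' - h)) ^+ 2 / 2| <= 2 * d ^+ 2.
  have : `|p' - p - (h' - h)| <= 2 * d.
    by apply: (le_trans (ler_normB _ _)); move: dh dp; lra.
  rewrite normrM normrX (@ger0_norm _ (2^-1 : R)) ?invr_ge0// => le2.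
  have : `|p' - p - (h' - h)| ^+ 2 <= (2 * d) ^+ 2 by rewrite lerXn2r ?nnegrE// mulr_ge0.
  by rewrite exprMn; move: (_ ^+ 2) => t; lra.
apply: (le_trans (ler_normD _ _)); apply: le_trans (lerD (ler_normD _ _) b4) _.
apply: le_trans (lerD (lerD (ler_normD _ _) b3) (lexx _)) _.
apply: le_trans (lerD (lerD (lerD (ler_normB _ _) b5) (lexx _)) (lexx _)) _.
apply: le_trans (lerD (lerD (lerD (lerD b1 b2) (lexx _)) (lexx _)) (lexx _)) _.
by rewrite le_eqVlt; apply/orP; left; apply/eqP; ring.
Qed.

Definition vanishing (R : realType) (f : R -> R) := forall e, 0 < e ->
  exists2 B, 0 <= B & forall x, B <= x -> f x <= e.

Section Flow.
Variables (R : realType) (g K : R -> R) (m C kap : R).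
Hypothesis m0 : 0 <= m.
Hypothesis C0 : 0 <= C.
Hypothesis kap0 : 0 < kap.
Hypothesis g_ge0 : forall x : R, 0 <= x <= 1 -> 0 <= g x.
Hypothesis g_le : forall x : R, 0 <= x <= 1 -> g x <= x - kap * (x * (1 - x)).
Hypothesis g_lip : forall x y : R, 0 <= x <= 1 -> 0 <= y <= 1 -> `|g y - g x| <= m * `|y - x|.
Hypothesis K_quad : forall x y : R, 0 <= x <= 1 -> 0 <= y <= 1 ->
  `|K y - K x - (y - x) * (g x - x)| <= C * (y - x) ^+ 2.

Variables f ph ps h : R -> R.
Hypotheses (f01 : unit_valued f) (ph01 : unit_valued ph) (ps01 : unit_valued ps)
  (h01 : unit_valued h).
Hypothesis fgh : forall x, 0 <= x -> f x = g (h x).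
Hypothesis ph_ahead : avg_ahead f ph.
Hypothesis h_behind : avg_behind ps h.
Hypothesis ps_lip : forall x d : R, 0 <= x -> 0 <= d -> `|ps (x + d) - ps x| <= d.

(* The equations behind [ph_ahead] and [h_behind] are ph' = ph - f and
   h' = ps - h; with [f = g h] the energy has derivative (ph - f) * (ph - ps). *)
Definition energy (x : R) := (ph x - h x) ^+ 2 / 2 + K (h x).

Lemma flow_f_lip x d : 0 <= x -> 0 <= d -> `|f (x + d) - f x| <= m * d.
Proof.
move=> x0 d0; rewrite !fgh ?addr_ge0//.
apply: (le_trans (g_lip (h01 _) (h01 _))) => //; first exact: addr_ge0.
by rewrite ler_wpM2l//; exact: avg_behind_lip ps01 h01 h_behind _ _ _ _.
Qed.

Lemma flow_h_step b d : 0 <= b -> 0 <= d ->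
  `|h (b + d) - h b - d * (ps b - h b)| <= 2 * d ^+ 2.
Proof.
move=> b0 d0; have [e0 e1 _] := expR_quad d0.
have win r : 0 <= r <= d -> ps b - d <= ps (b + r) <= ps b + d.
  move=> /andP[r0 rd]; have := ps_lip b0 r0; rewrite ler_norml => /andP[? ?].
  by apply/andP; split; lra.
have /andP[] := h_behind b0 d0 win.
have := expR_window_mul d0 (unit_dist (ps01 b0) (h01 b0)).
rewrite !ler_norml => /andP[h1 h2] h3 h4.
have : (1 - expR (- d)) * d <= d ^+ 2 by rewrite expr2 ler_wpM2r.
by move: h1 h2 h3 h4 => *; apply/andP; split; lra.
Qed.

Lemma flow_ph_step x d : 0 <= x -> 0 <= d ->
  `|ph (x + d) - ph x - d * (ph x - f x)| <= (2 + m) * d ^+ 2.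
Proof.
move=> x0 d0; have [e0 e1 _] := expR_quad d0.
have md : 0 <= m * d by rewrite mulr_ge0.
have win r : 0 <= r <= d -> f x - m * d <= f (x + r) <= f x + m * d.
  move=> /andP[r0 rd]; have := flow_f_lip x0 r0.
  have : m * r <= m * d by rewrite ler_wpM2l.
  by rewrite ler_norml => ? /andP[? ?]; apply/andP; split; lra.
have /andP[] := ph_ahead x0 d0 win.
have := expR_window_mul d0 (unit_dist (ph01 x0) (f01 x0)).
have : `|ph (x + d) - ph x| <= d := avg_ahead_lip f01 ph01 ph_ahead x0 d0.
rewrite !ler_norml => /andP[l1 l2] /andP[h1 h2] h3 h4.
have e2 : (1 - expR (- d)) * (m * d) <= m * d ^+ 2.
  by rewrite expr2 [leRHS]mulrCA ler_wpM2r.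
have e3 : (1 - expR (- d)) * (ph (x + d) - ph x) <= d ^+ 2.
  apply: (@le_trans _ _ ((1 - expR (- d)) * d)); first by rewrite ler_wpM2l.
  by rewrite expr2 ler_wpM2r.
have e4 : - d ^+ 2 <= (1 - expR (- d)) * (ph (x + d) - ph x).
  apply: (@le_trans _ _ ((1 - expR (- d)) * - d)); last by rewrite ler_wpM2l.
  by rewrite mulrN lerN2 expr2 ler_wpM2r.
by move: h1 h2 h3 h4 e2 e3 e4 => *; apply/andP; split; lra.
Qed.

Lemma energy_step b d : 0 <= b -> 0 <= d ->
  `|energy (b + d) - energy b - d * ((ph b - f b) * (ph b - ps b))|
    <= (2 + m + C + 6) * d ^+ 2.
Proof.
move=> b0 d0; apply: energy_algebra => //; [exact: f01|exact: ph01|exact: h01|..].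
- exact: flow_h_step.
- exact: flow_ph_step.
- exact: avg_behind_lip ps01 h01 h_behind _ _ b0 d0.
- exact: avg_ahead_lip f01 ph01 ph_ahead _ _ b0 d0.
- by rewrite fgh//; apply: K_quad; apply: h01 => //; exact: addr_ge0.
Qed.

Lemma energy_nincr b : (forall x, 0 <= x -> ph x <= f x /\ ps x <= ph x) ->
  0 <= b -> energy b <= energy 0.
Proof.
move=> H b0; apply: (@quadratic_nonincreasing _ energy 0 b (2 + m + C + 6)) => // x y x0 xy _.
have d0 : 0 <= y - x by rewrite subr_ge0.
have := energy_step x0 d0; rewrite subrKC ler_norml => /andP[_].
have [l1 l2] := H x x0.
have : (y - x) * ((ph x - f x) * (ph x - ps x)) <= 0.
  by rewrite mulr_ge0_le0// mulr_le0_ge0 ?subr_le0 ?subr_ge0.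
by lra.
Qed.

Lemma energy_cst b : (forall x, 0 <= x -> ps x = ph x) -> 0 <= b -> energy b = energy 0.
Proof.
move=> H b0.
have step x y : 0 <= x -> x <= y -> y <= b ->
    `|energy y - energy x| <= (2 + m + C + 6) * (y - x) ^+ 2.
  move=> x0 xy _; have d0 : 0 <= y - x by rewrite subr_ge0.
  by have := energy_step x0 d0; rewrite subrKC H// subrr !mulr0 subr0.
apply/eqP; rewrite eq_le; apply/andP; split.
  apply: (@quadratic_nonincreasing _ energy 0 b (2 + m + C + 6)) => // x y x0 xy yb.
  by have := step x y x0 xy yb; rewrite ler_norml => /andP[_]; lra.
rewrite -lerN2.
apply: (@quadratic_nonincreasing _ (fun x => - energy x) 0 b (2 + m + C + 6)) => // x y x0 xy yb.
by have := step x y x0 xy yb; rewrite ler_norml => /andP[+ _]; lra.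
Qed.

Hypothesis ph_sup : forall (x c : R), 0 <= x -> (forall r, 0 <= r -> f (x + r) <= c) -> ph x <= c.

Lemma vanishing_ph : vanishing f -> vanishing ph.
Proof.
move=> vf e e0; have [B B0 HB] := vf e e0; exists B => // x Bx.
apply: ph_sup; first exact: le_trans Bx.
by move=> r r0; apply: HB; apply: (le_trans Bx); rewrite lerDl.
Qed.

Lemma expRN_small (e : R) : 0 < e -> exists2 d, 0 <= d & expR (- d) <= e.
Proof.
move=> e0; exists e^-1; first by rewrite invr_ge0 ltW.
rewrite expRN -[leRHS]invrK lef_pV2 ?posrE ?expR_gt0 ?invr_gt0//.
by apply: le_trans (expR_ge1Dx _); lra.
Qed.

(** [h] relaxes towards [ps] at rate one: after a further time [d] with [expR (- d)] small, its
    value at [B] is forgotten. *)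
Lemma eventually_h L : 0 <= L -> (forall e, 0 < e -> exists2 B, 0 <= B & forall x, B <= x -> ps x <= L + e) ->
  forall e, 0 < e -> exists2 B, 0 <= B & forall x, B <= x -> h x <= L + e.
Proof.
move=> L0 vps e e0; have e2 : 0 < e / 2 by rewrite divr_gt0.
have [B B0 HB] := vps _ e2; have [d d0 de] := expRN_small e2.
exists (B + d); first exact: addr_ge0.
move=> x Bx; have dx : 0 <= x - B by lra.
have win r : 0 <= r <= x - B -> 0 <= ps (B + r) <= L + e / 2.
  move=> /andP[r0 rx]; have /andP[p0 p1] := ps01 (addr_ge0 B0 r0); rewrite p0 /=.
  by apply: HB; rewrite lerDl.
have /andP[_] := h_behind B0 dx win; rewrite subrKC => h1.
have [_ [e1 e3]] : 0 <= 0 :> R /\ 0 <= expR (- (x - B)) <= 1 /\ expR (- (x - B)) <= expR (- d).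
  by split=> //; split; [exact: expRN01|rewrite ler_expR; lra].
have /andP[hB0 hB1] := h01 B0; move: e1 => /andP[e1 e1'].
have : expR (- (x - B)) * h B <= expR (- (x - B)) by rewrite ler_piMr.
have : 0 <= expR (- (x - B)) * (L + e / 2) by rewrite mulr_ge0// addr_ge0// ltW.
by lra.
Qed.

Lemma vanishing_h : vanishing ps -> vanishing h.
Proof.
move=> vps e e0; have [|B B0 HB] := @eventually_h 0 (lexx _) _ e e0.
  by move=> e' e'0; have [B B0 HB] := vps _ e'0; exists B => // x /HB; rewrite add0r.
by exists B => // x /HB; rewrite add0r.
Qed.

Lemma vanishing_f : vanishing h -> vanishing f.
Proof.
move=> vh e e0; have [B B0 HB] := vh _ e0; exists B => // x Bx.
have x0 : 0 <= x := le_trans B0 Bx.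
apply: le_trans (HB _ Bx); rewrite fgh//; apply: (le_trans (g_le (h01 x0))).
have /andP[h0 h1] := h01 x0.
have : 0 <= kap * (h x * (1 - h x)).
  by apply: mulr_ge0; [exact: ltW|rewrite mulr_ge0// subr_ge0].
by lra.
Qed.

Lemma energy_limit : vanishing f -> vanishing h ->
  forall e, 0 < e -> exists2 b, 0 <= b & `|energy b - K 0| <= e.
Proof.
(* The kinetic term costs at most e' (using e' <= 1), the potential at most (1 + C) e'. *)
move=> vf vh e e0; pose e' := Num.min 1 (e / (3 + C)).
have C3 : 0 < 3 + C by move: C0; lra.
have e'0 : 0 < e' by rewrite lt_min ltr01 divr_gt0.
have [B1 B10 H1] := vanishing_ph vf e'0; have [B2 B20 H2] := vh _ e'0.
exists (B1 + B2); first exact: addr_ge0.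
have b0 : 0 <= B1 + B2 by exact: addr_ge0.
have hp := H1 (B1 + B2) ltac:(lra); have hh := H2 (B1 + B2) ltac:(lra).
have /andP[p0 p1] := ph01 b0; have /andP[h0 h1] := h01 b0.
have := K_lip0 C0 g_ge0 g_le K_quad (h01 b0).
rewrite /energy; set p := ph _ in hp p0 p1 *; set q := h _ in hh h0 h1 *.
have : `|(p - q) ^+ 2 / 2| <= e'.
  have e'1 : e' <= 1 by rewrite ge_min lexx.
  have pq : `|p - q| <= e' by rewrite ler_norml; apply/andP; split; lra.
  rewrite normrM normrX (@ger0_norm _ (2^-1 : R)) ?invr_ge0//.
  have : `|p - q| ^+ 2 <= e' ^+ 2 by rewrite lerXn2r ?nnegrE// ltW.
  have : e' ^+ 2 <= e' by rewrite expr2 ler_piMl// ltW.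
  by move: (_ ^+ 2) (_ ^+ 2) => s t; lra.
have : (1 + C) * q <= (1 + C) * e'.
  by rewrite ler_wpM2l// addr_ge0.
have : (3 + C) * e' <= e.
  by rewrite mulrC -ler_pdivlMr// ge_min lexx orbT.
move=> h2 h3 h4 h5; rewrite -addrA.
apply: (le_trans (ler_normD _ _)).
by move: h2 h3 h4 h5 e'0; lra.
Qed.

Lemma flow_energy_ge : vanishing ps -> (forall x, 0 <= x -> ph x <= f x /\ ps x <= ph x) ->
  K 0 <= energy 0.
Proof.
move=> vps H; have vh := vanishing_h vps; apply/ler_addgt0Pr => e e0.
have [b b0] := energy_limit (vanishing_f vh) vh e0.
by rewrite ler_norml => /andP[+ _]; have := energy_nincr H b0; lra.
Qed.

Lemma flow_energy_eq : (forall x, 0 <= x -> ps x = ph x) -> vanishing f -> energy 0 = K 0.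
Proof.
move=> H vf.
have vps : vanishing ps.
  by move=> e e0; have [B B0 HB] := vanishing_ph vf e0; exists B => // x Bx;
     rewrite H ?(le_trans B0)//; exact: HB.
have vh := vanishing_h vps.
apply/eqP; rewrite -subr_eq0 -normr_le0; apply/ler_addgt0Pr => e e0; rewrite add0r.
by have [b b0] := energy_limit vf vh e0; rewrite (energy_cst H b0).
Qed.

(** [f] decreases to a limit L, and averaging gives [h <= L + e] far out. For 0 < L < 1, f = g(h)
    would then fall below L because g is strictly below the identity. L = 1 would make [f]
    identically 1 and contradict [ph 0 < 1]. *)
Lemma flow_vanishing : (forall x, 0 <= x -> ps x = ph x) ->
  (forall x y, 0 <= x -> x <= y -> f y <= f x) -> ph 0 < 1 -> vanishing f.
Proof.
move=> H anti ph0; pose A := [set f x | x in [set x | 0 <= x]].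
have A0 : A !=set0 by exists (f 0); exists 0 => //=; exact: lexx.
have Alb : has_lbound A.
  by exists 0 => _ [x /= x0 <-]; case/andP: (f01 x0).
have Ainf : has_inf A by [].
pose L := inf A.
have Lf x : 0 <= x -> L <= f x by move=> x0; apply: ge_inf => //; exists x.
have L0 : 0 <= L.
  by apply: lb_le_inf => // _ [x /= x0 <-]; case/andP: (f01 x0).
have fL e : 0 < e -> exists2 B, 0 <= B & forall x, B <= x -> f x <= L + e.
  move=> e0; have [_ [B /= B0 <-] HB] := inf_adherent e0 Ainf.
  exists B => // x Bx; apply/ltW/(le_lt_trans _ HB); exact: anti.
have phL e : 0 < e -> exists2 B, 0 <= B & forall x, B <= x -> ps x <= L + e.
  move=> /fL[B B0 HB]; exists B => // x Bx; have x0 := le_trans B0 Bx.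
  by rewrite H//; apply: ph_sup => // r r0; apply: HB; apply: (le_trans Bx); rewrite lerDl.
have hL := eventually_h L0 phL.
suff Lz : L = 0.
  by move=> e /fL[B B0 HB]; exists B => // x /HB; rewrite Lz add0r.
apply/eqP; rewrite eq_le L0 andbT leNgt; apply/negP => Lpos.
have L1 : L < 1.
  rewrite ltNge; apply/negP => L1.
  have e0 : 0 < (1 - ph 0) / 2 by rewrite divr_gt0// subr_gt0.
  have [d d0 de] := expRN_small e0.
  have win r : 0 <= r <= d -> 1 <= f (0 + r) <= 1.
    move=> /andP[r0 _]; rewrite add0r; have /andP[_ ->] := f01 r0.
    by rewrite (le_trans L1)// Lf.
  have /andP[h1 _] := ph_ahead (lexx 0) d0 win.
  have /andP[p0 _] := ph01 (addr_ge0 (lexx 0) d0).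
  have : 0 <= expR (- d) * ph (0 + d) by rewrite mulr_ge0// expR_ge0.
  by move: h1 de; lra.
(* The first bound keeps 1 - t at least (1 - L)/2, so g(t) lies below t by at least twice the second
   bound, which takes it below L. *)
pose e := Num.min ((1 - L) / 2) (kap * (L * (1 - L)) / 4).
have kL : 0 < kap * (L * (1 - L)) by rewrite !mulr_gt0// subr_gt0.
have e0 : 0 < e by rewrite lt_min; apply/andP; split; lra.
have e1 : e <= (1 - L) / 2 by rewrite ge_min lexx.
have e2 : e <= kap * (L * (1 - L)) / 4 by rewrite ge_min lexx orbT.
have [B B0 HB] := hL _ e0.
have hB := HB _ (lexx B); have LB := Lf _ B0; rewrite fgh// in LB.
have gl := g_le (h01 B0).
set t := h B in hB LB gl *.
have /andP[t0 t1] : 0 <= t <= 1 := h01 B0.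
have k0 : 0 <= kap * (t * (1 - t)) by apply: mulr_ge0; [exact: ltW|rewrite mulr_ge0// subr_ge0].
have Lt : L <= t by lra.
have : kap * (L * ((1 - L) / 2)) <= kap * (t * (1 - t)).
  rewrite ler_pM2l//; apply: ler_pM; lra.
by lra.
Qed.

End Flow.

(** * The offspring generating function and its potential *)

Section GeneratingFunction.
Variables (R : realType) (p : nat -> R).
Hypothesis lawp : offspring_law p.

Definition genf (x : R) : R := limn (series (fun k => p k * x ^+ k)).
(** The primitive of g(x) - x vanishing at 0, with g integrated term by term. *)
Definition potential (x : R) : R :=
  limn (series (fun k => p k * (x ^+ k.+1 / k.+1%:R))) - x ^+ 2 / 2.
Definition mean : R := fine (\sum_(k <oo) (k%:R * p k)%:E).

Let p_ge0 k : 0 <= p k. Proof. by case: lawp. Qed.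
Let p0 : p 0%N = 0. Proof. by case: lawp => _ [_ []]. Qed.

Let sum_p_le1 n : \sum_(0 <= k < n) p k <= 1.
Proof.
case: lawp => _ [s1 _]; rewrite -lee_fin -sumEFin -s1.
by apply: nneseries_lim_ge => k _; rewrite lee_fin.
Qed.

Let mean_fin : (\sum_(k <oo) (k%:R * p k)%:E = mean%:E)%E.
Proof.
case: lawp => _ [_ [/andP[h1 h2] _]]; rewrite /mean fineK// ge0_fin_numE//.
exact: le_trans (ltW h1).
Qed.

Let mean_gt1 : 1 < mean.
Proof. by case: lawp => _ [_ [/andP[+ _] _]]; rewrite mean_fin lte_fin. Qed.

Let sum_mean n : \sum_(0 <= k < n) k%:R * p k <= mean.
Proof.
rewrite -lee_fin -sumEFin -mean_fin.
by apply: nneseries_lim_ge => k _; rewrite lee_fin mulr_ge0.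
Qed.

Lemma mean_ge0 : 0 <= mean.
Proof. by apply: ltW; apply: lt_trans mean_gt1. Qed.

(** Otherwise each vertex has exactly one child and the mean is 1. This makes the constant
    [kap = 1 - p 1] positive. *)
Lemma p1_lt1 : p 1%N < 1.
Proof.
rewrite ltNge; apply/negP => p1.
have pk k : (1 < k)%N -> p k = 0.
  move=> k1; apply/eqP; rewrite eq_le p_ge0 andbT.
  have : \sum_(0 <= i < k.+1) p i <= 1 by exact: sum_p_le1.
  rewrite big_nat_recr//= (@big_cat_nat _ _ _ 2)//= !big_nat_recr//= big_geq// p0 !add0r.
  have : 0 <= \sum_(2 <= i < k) p i by apply: sumr_ge0.
  by lra.
have mz : (\sum_(k <oo) (k%:R * p k)%:E <= 1)%E.
  apply: lime_le; first by apply: is_cvg_nneseries => k _ _; rewrite lee_fin mulr_ge0.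
  apply: nearW => n; rewrite sumEFin lee_fin.
  apply: le_trans (sum_p_le1 n); apply: ler_sum => -[|[|k]] _.
  - by rewrite mul0r.
  - by rewrite mul1r.
  - by rewrite pk// mulr0.
by move: mz; rewrite mean_fin lee_fin leNgt mean_gt1.
Qed.

Let term_le1 (x : R) k : 0 <= x <= 1 -> 0 <= x ^+ k <= 1.
Proof. by move=> /andP[x0 x1]; rewrite exprn_ge0//= exprn_ile1. Qed.

Let bounded_cvg (c : nat -> R) : (forall k, 0 <= c k <= 1) ->
  cvgn (series (fun k => p k * c k)).
Proof.
move=> c01; apply: nondecreasing_is_cvgn.
  apply/nondecreasing_seqP => n; rewrite /series/= big_nat_recr//= lerDl mulr_ge0//.
  by case/andP: (c01 n).
exists 1 => _ [n _ <-]; apply: le_trans (sum_p_le1 n).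
rewrite /series/=; apply: ler_sum => k _; rewrite ler_piMr//.
by case/andP: (c01 k).
Qed.

Lemma genf_cvg (x : R) : 0 <= x <= 1 -> series (fun k => p k * x ^+ k) @ \oo --> genf x.
Proof. by move=> x01; apply: bounded_cvg => k; exact: term_le1. Qed.

Let potential_cvg (x : R) : 0 <= x <= 1 ->
  series (fun k => p k * (x ^+ k.+1 / k.+1%:R)) @ \oo --> potential x + x ^+ 2 / 2.
Proof.
move=> x01; rewrite /potential subrK; apply: bounded_cvg => k.
have /andP[h1 h2] := term_le1 k.+1 x01.
rewrite divr_ge0//= ler_pdivrMr ?ltr0n// mul1r (le_trans h2)// ler1n //.
Qed.

Lemma genf_ge0 (x : R) : 0 <= x <= 1 -> 0 <= genf x.
Proof.
move=> x01; apply: (ler_cvg_to (cvg_cst 0) (genf_cvg x01)).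
apply: nearW => n; apply: sumr_ge0 => k _; rewrite mulr_ge0//.
by case/andP: (term_le1 k x01).
Qed.

Lemma genf_esum (x : R) : 0 <= x <= 1 ->
  (\sum_(k <oo) (p k * x ^+ k)%:E = (genf x)%:E)%E.
Proof.
move=> x01; apply/cvg_lim => //.
apply/fine_cvgP; split; first by apply: nearW => n; rewrite sumEFin.
rewrite (_ : fine \o _ = series (fun k => p k * x ^+ k)); first exact: genf_cvg.
by apply/funext => n /=; rewrite sumEFin.
Qed.

(** Bounding x^k by x^2 for k >= 2 and using [p 0 = 0] gives g(x) <= p_1 x + (1 - p_1) x^2. *)
Lemma genf_le (x : R) : 0 <= x <= 1 -> genf x <= x - (1 - p 1%N) * (x * (1 - x)).
Proof.
move=> x01; have /andP[x0 x1] := x01.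
apply: (ler_cvg_to (genf_cvg x01) (cvg_cst _)).
apply: nearW => n; rewrite /series/=.
have xx : 0 <= x - x ^+ 2 by rewrite subr_ge0 expr2 ler_piMl.
apply: (@le_trans _ _ (\sum_(0 <= k < n) (p k * x ^+ 2 + (k == 1%N)%:R * (p 1%N * (x - x ^+ 2))))).
  apply: ler_sum => -[|[|k]] _.
  - by rewrite p0 !mul0r addr0.
  - by rewrite expr1 mul1r -mulrDr addrC subrK.
  rewrite mul0r addr0 ler_wpM2l// -addn2 exprD ler_piMl ?exprn_ge0//.
  exact: exprn_ile1.
rewrite big_split/= -!mulr_suml.
have h1 : (\sum_(0 <= i < n) (i == 1%N)%:R : R) <= 1.
  rewrite -natr_sum lern1; case: n => [|[|n]]; first by rewrite big_geq.
    by rewrite big_nat1.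
  rewrite 2?big_nat_recl//= add0n big1 ?addn0//.
have : (\sum_(0 <= i < n) (i == 1%N)%:R : R) * (p 1%N * (x - x ^+ 2)) <= p 1%N * (x - x ^+ 2).
  by rewrite ler_piMl// mulr_ge0.
have : (\sum_(0 <= k < n) p k) * x ^+ 2 <= x ^+ 2 by rewrite ler_piMl// exprn_ge0.
by move: (sum_p_le1 n); lra.
Qed.

Let expr_lip (x y : R) k : 0 <= x <= 1 -> 0 <= y <= 1 ->
  `|y ^+ k - x ^+ k| <= k%:R * `|y - x|.
Proof.
move=> x01 y01; elim: k => [|k IH]; first by rewrite !expr0 subrr normr0 mul0r.
have -> : y ^+ k.+1 - x ^+ k.+1 = y * (y ^+ k - x ^+ k) + x ^+ k * (y - x).
  by rewrite !exprS; ring.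
rewrite -natr1 mulrDl mul1r; apply: (le_trans (ler_normD _ _)); apply: lerD.
  rewrite normrM; apply: le_trans IH; rewrite ler_piMl//.
  by have /andP[? ?] := y01; rewrite ger0_norm.
rewrite normrM ler_piMl//; have /andP[? ?] := term_le1 k x01.
by rewrite ger0_norm.
Qed.

Let expr_quad (x y : R) k : 0 <= x <= 1 -> 0 <= y <= 1 ->
  `|y ^+ k.+1 - x ^+ k.+1 - k.+1%:R * x ^+ k * (y - x)| <= (k.+1 * k)%:R * (y - x) ^+ 2.
Proof.
move=> x01 y01; elim: k => [|k IH]; first by rewrite !expr1 expr0 !mul1r subrr normr0 mul0r.
have -> : y ^+ k.+2 - x ^+ k.+2 - k.+2%:R * x ^+ k.+1 * (y - x) =
    y * (y ^+ k.+1 - x ^+ k.+1 - k.+1%:R * x ^+ k * (y - x))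
    + k.+1%:R * x ^+ k * (y - x) ^+ 2.
  by rewrite -[k.+2%:R]natr1 !(exprS _ k.+1) !(exprS _ k); ring.
apply: (le_trans (ler_normD _ _)).
have b1 : `|y * (y ^+ k.+1 - x ^+ k.+1 - k.+1%:R * x ^+ k * (y - x))| <= (k.+1 * k)%:R * (y - x) ^+ 2.
  rewrite normrM; apply: le_trans IH; rewrite ler_piMl//.
  by have /andP[? ?] := y01; rewrite ger0_norm.
have b2 : `|k.+1%:R * x ^+ k * (y - x) ^+ 2| <= k.+1%:R * (y - x) ^+ 2.
  have /andP[? ?] := term_le1 k x01.
  rewrite normrM (ger0_norm (sqr_ge0 _)) ler_wpM2r ?sqr_ge0// normrM normr_nat.
  by rewrite ler_piMr// ger0_norm.
apply: (le_trans (lerD b1 b2)); rewrite -mulrDl ler_wpM2r ?sqr_ge0// -natrD ler_nat.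
by rewrite -mulnSr leq_mul.
Qed.

Let norm_cvg_le (u : nat -> R) (l c : R) : u @ \oo --> l -> (forall n, `|u n| <= c) -> `|l| <= c.
Proof.
move=> ul uc; apply: (ler_cvg_to (cvg_norm ul) (cvg_cst c)).
by apply: nearW => n; exact: uc.
Qed.

Lemma genf_lip (x y : R) : 0 <= x <= 1 -> 0 <= y <= 1 ->
  `|genf y - genf x| <= mean * `|y - x|.
Proof.
move=> x01 y01; apply: (norm_cvg_le (cvgB (genf_cvg y01) (genf_cvg x01))) => n.
rewrite /series/= !fctE -sumrB; apply: (le_trans (ler_norm_sum _ _ _)).
apply: le_trans (_ : (\sum_(0 <= k < n) k%:R * p k) * `|y - x| <= _); last by rewrite ler_wpM2r.
rewrite mulr_suml; apply: ler_sum => k _.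
rewrite -mulrBr normrM ger0_norm// [_ * p k]mulrC -mulrA ler_wpM2l//.
exact: expr_lip.
Qed.

(** The second-order remainder of x^(k+1) is at most (k+1) k (y - x)^2; the division by k+1 cancels
    one factor, so a first moment is enough and no variance enters. *)
Lemma potential_quad (x y : R) : 0 <= x <= 1 -> 0 <= y <= 1 ->
  `|potential y - potential x - (y - x) * (genf x - x)| <= (mean + 1) * (y - x) ^+ 2.
Proof.
move=> x01 y01.
have cv := cvgB (cvgB (potential_cvg y01) (potential_cvg x01)) (cvgM (cvg_cst (y - x)) (genf_cvg x01)).
have -> : potential y - potential x - (y - x) * (genf x - x) =
    (potential y + y ^+ 2 / 2 - (potential x + x ^+ 2 / 2) - (y - x) * genf x) - (y - x) ^+ 2 / 2.
  by field.
rewrite [leRHS]mulrDl mul1r; apply: (le_trans (ler_normB _ _)); apply: lerD; last first.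
  rewrite ger0_norm ?divr_ge0 ?sqr_ge0//.
  by have := sqr_ge0 (y - x); move: (_ ^+ 2) => t; lra.
apply: (norm_cvg_le (cv _ _ _ _)) => n.
rewrite /series/= !fctE /= -sumrB mulr_sumr -sumrB.
apply: (le_trans (ler_norm_sum _ _ _)).
apply: le_trans (_ : (\sum_(0 <= k < n) k%:R * p k) * (y - x) ^+ 2 <= _); last first.
  by rewrite ler_wpM2r ?sqr_ge0.
rewrite mulr_suml; apply: ler_sum => k _.
have -> : p k * (y ^+ k.+1 / k.+1%:R) - p k * (x ^+ k.+1 / k.+1%:R) - (y - x) * (p k * x ^+ k) =
   p k * ((y ^+ k.+1 - x ^+ k.+1 - k.+1%:R * x ^+ k * (y - x)) / k.+1%:R).
  have : k.+1%:R != 0 :> R by rewrite pnatr_eq0.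
  by move: (k.+1%:R : R) => c c0; field.
rewrite [leRHS](_ : _ = p k * (k%:R * (y - x) ^+ 2)); last by ring.
rewrite normrM (ger0_norm (p_ge0 k)) ler_wpM2l//.
rewrite normrM (ger0_norm (_ : 0 <= k.+1%:R^-1)) ?invr_ge0// ler_pdivrMr ?ltr0n//.
apply: (le_trans (expr_quad k x01 y01)).
by rewrite le_eqVlt natrM; apply/orP; left; apply/eqP; ring.
Qed.

End GeneratingFunction.

Lemma measurable_preimage d1 d2 (T1 : measurableType d1) (T2 : measurableType d2)
  (f : T1 -> T2) (A : set T2) : measurable_fun setT f -> measurable A ->
  measurable (f @^-1` A).
Proof. by move=> mf mA; rewrite -[X in measurable X]setTI; exact: mf. Qed.

Lemma pushforward_unique d1 d2 (T1 : measurableType d1) (T2 : measurableType d2)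
  (R : realType) (m1 : {measure set T1 -> \bar R}) (m2 : {measure set T2 -> \bar R})
  (f : T1 -> T2) (G : set (set T2)) (g : (set T2)^nat) :
  measurable_fun setT f -> measurable = <<s G >> -> setI_closed G ->
  (forall i, G (g i)) -> \bigcup_k g k = setT -> (m1 setT < +oo)%E ->
  (forall A, G A -> m1 (f @^-1` A) = m2 A) ->
  forall A, measurable A -> m1 (f @^-1` A) = m2 A.
Proof.
move=> mf mG setIG Gg gT fin eqG A mA.
suff : pushforward m1 f A = m2 A by [].
apply: (measure_unique G g) => //.
move=> k; apply: (@le_lt_trans _ _ (m1 setT)) fin.
have := @le_measure _ _ _ m1 (f @^-1` g k) setT; rewrite !inE; apply=> //.
by apply: measurable_preimage => //; rewrite mG; apply: sub_sigma_algebra; exact: Gg.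
Qed.

(** * The law of a configuration *)

Section Conf.
Variable R : realType.

Definition conf : Type := ((label -> nat) * (label -> bool -> R))%type.

Definition cyl (us : seq (label * nat)) (es : seq ((label * bool) * R)) : set conf :=
  [set xi | all (fun uk => xi.1 uk.1 == uk.2) us &&
            all (fun et => xi.2 et.1.1 et.1.2 <= et.2) es].

Definition proper_keys (us : seq (label * nat)) (es : seq ((label * bool) * R)) :=
  [&& uniq (map fst us), uniq (map fst es) & all (fun e => e.1.1 != [::]) es].

(** The empty set makes the family stable under intersection: two cylinders may prescribe different
    values of the same [Z u]. *)
Definition cylinders : set (set conf) :=
  [set A | A = set0 \/ exists us es, proper_keys us es /\ A = cyl us es].

Definition confT := g_sigma_algebraType cylinders.

Lemma cylinders_capZ A u k : cylinders A -> cylinders (A `&` [set xi | xi.1 u = k]).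
Proof.
case=> [->|[us [es [/and3P[uus ues nes] ->]]]]; first by left; rewrite set0I.
have [/mapP[[u' k'] uk' /= ->]|unew] := boolP (u \in map fst us).
  have [->|kk'] := eqVneq k k'.
    right; exists us, es; split; first exact/and3P.
    apply/seteqP; split=> xi [] // /andP[] aus aes; split; first exact/andP.
    by move/allP: aus => /(_ _ uk') /eqP.
  left; apply/seteqP; split=> xi //= [/andP[aus aes] xk].
  by move/allP: aus => /(_ _ uk') /=; rewrite xk (negbTE kk').
right; exists ((u, k) :: us), es; split; first by apply/and3P; rewrite /= unew.
apply/seteqP; split=> xi; rewrite /cyl /=.
  by move=> [/andP[h1 h2] h0]; rewrite h0 eqxx h1 h2.
by rewrite -andbA => /and3P[/eqP h0 h1 h2]; split=> //; exact/andP.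
Qed.

Lemma cylinders_capW A c b t : c != [::] -> cylinders A ->
  cylinders (A `&` [set xi | xi.2 c b <= t]).
Proof.
move=> c0; case=> [->|[us [es [/and3P[uus ues nes] ->]]]]; first by left; rewrite set0I.
right; have [ein|enew] := boolP ((c, b) \in map fst es); last first.
  exists us, (((c, b), t) :: es); split; first by apply/and3P; rewrite /= enew c0.
  apply/seteqP; split=> xi; rewrite /cyl /=.
    by move=> [/andP[h1 h2] h0]; rewrite h0 h1 h2.
  by move=> /and3P[h0 h1 h2]; split=> //; exact/andP.
(* Keys must stay distinct, so a second bound on the same weight is merged into the first. *)
pose f (e : (label * bool) * R) := if e.1 == (c, b) then (e.1, Num.min e.2 t) else e.
have f1 : map fst (map f es) = map fst es.
  by rewrite -map_comp; apply: eq_map => e; rewrite /f /=; case: ifP.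
exists us, (map f es); split.
  apply/and3P; rewrite f1; split=> //.
  apply/allP => _ /mapP[e ees ->]; move/allP: nes => /(_ _ ees).
  by rewrite /f; case: ifP.
apply/seteqP; split=> xi.
  move=> [/andP[aus aes] xt]; apply/andP; split=> //.
  apply/allP => _ /mapP[e ees ->]; move/allP: aes => /(_ _ ees).
  by rewrite /f; case: eqP => //= -> /= h; rewrite le_min h.
move=> /andP[aus aes]; split; last first.
  case/mapP: ein => e ees ecb; move/allP: aes => /(_ (f e) (map_f f ees)).
  by rewrite /f -ecb eqxx /= le_min => /andP[].
apply/andP; split=> //; apply/allP => e ees.
move/allP: aes => /(_ (f e) (map_f f ees)).
by rewrite /f; case: eqP => //= _; rewrite le_min => /andP[].
Qed.

Lemma setI_cylinders : setI_closed cylinders.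
Proof.
move=> A B cA [->|[us [es [/and3P[_ _ nes] ->]]]]; first by left; rewrite setI0.
elim: us => [|[u k] us IH].
  elim: es nes => [_|[[c b] t] es IH /= /andP[c0 /IH {}IH]].
    rewrite (_ : cyl _ _ = setT) ?setIT//.
    by apply/seteqP; split.
  rewrite (_ : cyl _ _ = cyl [::] es `&` [set xi | xi.2 c b <= t]); last first.
    apply/seteqP; split=> xi; rewrite /cyl /=; first by move=> /andP[-> ->].
    by move=> [-> ->].
  by rewrite setIA; exact: cylinders_capW.
rewrite (_ : cyl _ _ = cyl us es `&` [set xi | xi.1 u = k]); last first.
  apply/seteqP; split=> xi; rewrite /cyl /=.
    by move=> /andP[/andP[/eqP -> ->] ->].
  by move=> [/andP[-> ->] ->]; rewrite eqxx.
by rewrite setIA; exact: cylinders_capZ.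
Qed.

Lemma cylindersT : cylinders setT.
Proof. by right; exists [::], [::]; split=> //; apply/seteqP; split. Qed.

Lemma measurable_Z u k : measurable [set xi : confT | xi.1 u = k].
Proof.
by apply: sub_sigma_algebra; rewrite -(setTI [set _ | _]); apply: cylinders_capZ cylindersT.
Qed.

Lemma measurable_Wle c b t : c != [::] -> measurable [set xi : confT | xi.2 c b <= t].
Proof.
move=> c0; apply: sub_sigma_algebra; rewrite -(setTI [set _ | _]).
exact: cylinders_capW cylindersT.
Qed.

Lemma measurable_funZ u : measurable_fun [set: confT] (fun xi : confT => xi.1 u).
Proof.
move=> _ A _; rewrite setTI (_ : _ @^-1` A = \bigcup_(k in A) [set xi : confT | xi.1 u = k]).
  by apply: bigcup_measurable => k _; exact: measurable_Z.
by apply/seteqP; split=> xi /=; [move=> Ax; exists (xi.1 u)|move=> [k Ak ->]].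
Qed.

Lemma measurable_funW c b : c != [::] ->
  measurable_fun [set: confT] (fun xi : confT => xi.2 c b).
Proof.
move=> c0; apply: (measurability (@RGenOInfty.G R)).
  exact: RGenOInfty.measurableE.
move=> _ [_ [t ->] <-]; rewrite setTI (_ : _ @^-1` _ = ~` [set xi : confT | xi.2 c b <= t]).
  by apply: measurableC; exact: measurable_Wle.
by apply/seteqP; split=> xi /=; rewrite in_itv/= andbT ltNge => /negP.
Qed.

Lemma measurable_to_conf d (T : measurableType d) (f : T -> confT) :
  (forall u k, measurable [set x | (f x).1 u = k]) ->
  (forall c b t, c != [::] -> measurable [set x | (f x).2 c b <= t]) ->
  measurable_fun setT f.
Proof.
move=> fZ fW; apply: (measurability (cylinders : set (set confT))) => // _ [_ [->|[us [es [/and3P[_ _ nes] ->]]]] <-].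
  by rewrite preimage_set0 setI0.
rewrite setTI; elim: us => [|[u k] us IH].
  elim: es nes => [_|[[c b] t] es IH /= /andP[c0 /IH {}IH]].
    rewrite (_ : _ @^-1` _ = setT)//.
    by apply/seteqP; split.
  rewrite (_ : _ @^-1` _ = f @^-1` cyl [::] es `&` [set x | (f x).2 c b <= t]).
    by apply: measurableI => //; exact: fW.
  apply/seteqP; split=> xi; rewrite /cyl /=; first by move=> /andP[-> ->].
  by move=> [-> ->].
rewrite (_ : _ @^-1` _ = f @^-1` cyl us es `&` [set x | (f x).1 u = k]).
  by apply: measurableI => //; exact: fZ.
apply/seteqP; split=> xi; rewrite /cyl /=.
  by move=> /andP[/andP[/eqP -> ->] ->].
by move=> [/andP[-> ->] ->]; rewrite eqxx.
Qed.

(* The weights of the root play no role, and are erased so that the shifted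
   configuration only depends on what lies strictly below [c]. *)
Definition shift (c : label) (xi : confT) : confT :=
  (fun u => xi.1 (c ++ u), fun u b => if u == [::] then 0 else xi.2 (c ++ u) b).

Lemma measurable_shift c : measurable_fun setT (shift c).
Proof.
apply: measurable_to_conf => [u k|u b t u0]; first exact: measurable_Z.
rewrite /shift /= (negbTE u0).
by apply: measurable_Wle; apply: contra u0; case: c.
Qed.

(** Independence is used in this form: gluing two independent configurations along any partition of
    the coordinates gives the same law ([mix_law]), so chosen coordinates can be frozen and the
    others integrated out. *)
Definition mix (sz : pred label) (sw : label -> bool -> bool) (x : confT * confT) : confT :=
  (fun u => if sz u then x.1.1 u else x.2.1 u,
   fun c b => if sw c b then x.1.2 c b else x.2.2 c b).

Lemma measurable_mix sz sw : measurable_fun setT (mix sz sw).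
Proof.
apply: measurable_to_conf => [u k|c b t c0] /=.
  case: (sz u).
    exact: (measurable_preimage measurable_fst (measurable_Z u k)).
  exact: (measurable_preimage measurable_snd (measurable_Z u k)).
case: (sw c b).
  exact: (measurable_preimage measurable_fst (measurable_Wle b t c0)).
exact: (measurable_preimage measurable_snd (measurable_Wle b t c0)).
Qed.

End Conf.

Section Law.
Variables (R : realType) (p : nat -> R) (mu : probability (confT R) R).
Hypothesis mu_cyl : forall us es, proper_keys us es ->
  mu (cyl us es : set (confT R)) = ((\prod_(uk <- us) p uk.2) * (\prod_(et <- es) exp1_cdf et.2))%:E.

Lemma shift_law c A : measurable A -> mu (shift c @^-1` A) = mu A.
Proof.
apply: (@pushforward_unique _ _ _ _ R mu mu (shift c) (@cylinders R) (fun=> setT)) => //.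
- exact: measurable_shift.
- exact: setI_cylinders.
- by move=> _; exact: cylindersT.
- by apply: bigcup_const; exists 0%N.
- by have := probability_setT mu => /= ->; rewrite ltry.
move=> _ [->|[us [es [/and3P[uus ues nes] ->]]]].
  by rewrite preimage_set0 !measure0.
pose us' := [seq (c ++ e.1, e.2) | e <- us].
pose es' := [seq ((c ++ e.1.1, e.1.2), e.2) | e <- es].
have ccinj : injective (fun u : label => c ++ u).
  by move=> u v /eqP; rewrite eqseq_cat// eqxx /= => /eqP.
have -> : shift c @^-1` cyl us es = cyl us' es'.
  apply/seteqP; split=> xi; rewrite /cyl /= !all_map => /andP[h1 h2]; apply/andP; split=> //.
    apply/allP => e ees; move/allP: h2 => /(_ _ ees) /=.
    by rewrite (negbTE (allP nes _ ees)).
  apply/allP => e ees; move/allP: h2 => /(_ _ ees) /=.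
  by rewrite (negbTE (allP nes _ ees)).
have pk : proper_keys us es by apply/and3P.
have pk' : proper_keys us' es'.
  apply/and3P; split.
  - by rewrite -map_comp (map_comp (fun u => c ++ u) fst) map_inj_uniq.
  - rewrite -map_comp (map_comp (fun u => (c ++ u.1, u.2)) fst) map_inj_uniq//.
    by move=> [u b] [v b'] [] /ccinj -> ->.
  - rewrite all_map; apply: sub_all nes => e /=; apply: contra.
    by case: c {us' es' ccinj}.
apply: (etrans (mu_cyl pk')); apply/esym; apply: (etrans (mu_cyl pk)).
by rewrite !big_map.
Qed.

Lemma mix_law sz sw A : measurable A -> (mu \x mu)%E (mix sz sw @^-1` A) = mu A.
Proof.
apply: (@pushforward_unique _ _ _ _ R (mu \x mu)%E mu (mix sz sw) (@cylinders R) (fun=> setT)) => //.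
- exact: measurable_mix.
- exact: setI_cylinders.
- by move=> _; exact: cylindersT.
- by apply: bigcup_const; exists 0%N.
- have h : (mu \x mu)%E (setT `*` setT) = 1%E.
    have e : mu setT = 1%E := probability_setT mu.
    by rewrite product_measure1E// [X in (X * _)%E]e [X in (_ * X)%E]e mule1.
  by rewrite -setXTT [X in (X < _)%E]h ltry.
move=> _ [->|[us [es [/and3P[uus ues nes] ->]]]].
  by rewrite preimage_set0 !measure0.
pose a (u : label * nat) := sz u.1; pose b (e : (label * bool) * R) := sw e.1.1 e.1.2.
have msub q q' : proper_keys us es ->
    proper_keys [seq x <- us | q x] [seq x <- es | q' x].
  move=> /and3P[h1 h2 h3]; apply/and3P; split.
  - exact: subseq_uniq (map_subseq _ (filter_subseq _ _)) h1.
  - exact: subseq_uniq (map_subseq _ (filter_subseq _ _)) h2.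
  - by apply/allP => e; rewrite mem_filter => /andP[_] /(allP h3).
have pk : proper_keys us es by apply/and3P.
have allID (T : eqType) (q r : pred T) (s : seq T) : all r s =
    all r [seq x <- s | q x] && all r [seq x <- s | ~~ q x].
  by elim: s => //= x s ->; case: (q x) => /=; [rewrite andbA|rewrite andbCA].
have -> : mix sz sw @^-1` cyl us es =
   cyl [seq x <- us | a x] [seq x <- es | b x] `*`
   cyl [seq x <- us | ~~ a x] [seq x <- es | ~~ b x].
  have eqa x : all (fun uk => (mix sz sw x).1 uk.1 == uk.2) us =
     all (fun uk => x.1.1 uk.1 == uk.2) [seq x <- us | a x] &&
     all (fun uk => x.2.1 uk.1 == uk.2) [seq x <- us | ~~ a x].
    by rewrite (allID _ a); congr (_ && _); apply: eq_in_all => u; rewrite mem_filter /= /a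
      => /andP[]; case: (sz u.1).
  have eqb x : all (fun et => (mix sz sw x).2 et.1.1 et.1.2 <= et.2) es =
     all (fun et => x.1.2 et.1.1 et.1.2 <= et.2) [seq x <- es | b x] &&
     all (fun et => x.2.2 et.1.1 et.1.2 <= et.2) [seq x <- es | ~~ b x].
    by rewrite (allID _ b); congr (_ && _); apply: eq_in_all => u; rewrite mem_filter /= /b
      => /andP[]; case: (sw u.1.1 u.1.2).
  apply/seteqP; split=> x; rewrite /cyl /= ?eqa ?eqb.
    by move=> /andP[/andP[-> ->] /andP[-> ->]].
  by move=> [/andP[-> ->] /andP[-> ->]].
have mc us' es' : proper_keys us' es' -> measurable (cyl us' es' : set (confT R)).
  by move=> pk'; apply: sub_sigma_algebra; right; exists us', es'.
apply: (etrans (product_measure1E mu mu (mc _ _ (msub a b pk))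
  (mc _ _ (msub (predC a) (predC b) pk)))).
apply/esym; apply: (etrans (mu_cyl pk)); apply/esym.
rewrite [X in (X * _)%E = _](mu_cyl (msub a b pk)).
rewrite [X in (_ * X)%E = _](mu_cyl (msub (predC a) (predC b) pk)).
rewrite -EFinM; congr (_%:E).
rewrite [X in _ = X * _](bigID a) [X in _ = _ * X](bigID b) /= !big_filter.
by rewrite -!mulrA; congr (_ * _); rewrite mulrCA.
Qed.

Lemma mix_integral sz sw A : measurable A ->
  mu A = (\int[mu]_x mu [set y | A (mix sz sw (x, y))])%E.
Proof.
move=> mA; rewrite -(mix_law sz sw mA); apply: eq_integral => x _.
by congr (mu _); apply/seteqP; split=> y /=; rewrite /xsection /= inE.
Qed.

Definition edge_weight (xi : confT R) : R := xi.2 [:: 0%N] false.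

Lemma measurable_edge_weight : measurable_fun setT edge_weight.
Proof. exact: measurable_funW. Qed.

HB.instance Definition _ := isMeasurableFun.Build _ _ _ _ edge_weight measurable_edge_weight.

(** The Exponential(1) law, taken from one fixed weight; [weight_law] transfers it to all the
    others. *)
Definition lam : probability R R := distribution mu edge_weight.

Let muW c b t : c != [::] -> mu [set xi : confT R | xi.2 c b <= t] = (exp1_cdf t)%:E.
Proof.
move=> c0; have := mu_cyl (us := [::]) (es := [:: ((c, b), t)]).
rewrite big_nil mul1r big_seq1 /= => <-; last by rewrite /proper_keys /= c0.
by congr (mu _); apply/seteqP; split=> xi; rewrite /cyl /= andbT.
Qed.

Lemma lam_gt t : lam `]t, +oo[%classic = (1 - exp1_cdf t)%:E.
Proof.
rewrite -setCitvl probability_setC// EFinB; congr (_ - _)%E.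
rewrite /lam /distribution /pushforward /= -(muW false t (c := [:: 0%N]))//.
Qed.

Lemma cover_gt : \bigcup_k `](- k%:R : R), +oo[%classic = [set: R].
Proof.
apply/seteqP; split=> // x _; exists (Num.truncn `|x|).+1 => //=.
rewrite in_itv/= andbT ltrNl; apply: le_lt_trans (truncnS_gt _).
by rewrite -normrN ler_norm.
Qed.

Lemma gt_setI_closed : setI_closed (@RGenOInfty.G R).
Proof.
move=> _ _ [x ->] [y ->]; exists (Num.max x y).
by apply/seteqP; split=> z /=; rewrite !in_itv/= !andbT gt_max;
  [by move=> [-> ->]|by move=> /andP[]].
Qed.

Lemma weight_law c b A : c != [::] -> measurable A ->
  mu [set xi : confT R | A (xi.2 c b)] = lam A.
Proof.
move=> c0; apply: (@pushforward_unique _ _ _ _ R mu lam (fun xi : confT R => xi.2 c b)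
  (@RGenOInfty.G R) (fun k => `]- k%:R, +oo[%classic)).
- exact: measurable_funW.
- exact: RGenOInfty.measurableE.
- exact: gt_setI_closed.
- by move=> k; exists (- k%:R).
- exact: cover_gt.
- by have := probability_setT mu => /= ->; rewrite ltry.
move=> _ [t ->]; apply/esym; apply: (etrans (lam_gt t)); apply/esym.
rewrite (_ : _ @^-1` _ = ~` [set xi : confT R | xi.2 c b <= t]).
  apply: (etrans (probability_setC mu (measurable_Wle b t c0))).
  by rewrite EFinB; congr (_ - _)%E; exact: muW.
by apply/seteqP; split=> xi /=; rewrite in_itv/= andbT ltNge => /negP.
Qed.

Lemma weight_integral c b (F : R -> \bar R) : c != [::] -> measurable_fun setT F ->
  (forall r, (0 <= F r)%E) ->
  (\int[mu]_xi F (xi.2 c b) = \int[lam]_r F r)%E.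
Proof.
move=> c0 mF F0.
have := @ge0_integral_pushforward _ _ _ _ _ _ (measurable_funW b c0) mu setT F
  measurableT mF (fun y _ => F0 y).
rewrite preimage_setT => <-.
apply: eq_measure_integral; first exact: measurable_funW.
by move=> mf A mA _; exact: weight_law.
Qed.

Lemma expRN_max (t s : R) : 0 <= s -> 
  expR (- s) * (1 - exp1_cdf (t - s)) = 1 - exp1_cdf (Num.max t s).
Proof.
move=> s0; have ms : 0 <= Num.max t s by rewrite le_max s0 orbT.
have -> : exp1_cdf (Num.max t s) = 1 - expR (- Num.max t s) by rewrite /exp1_cdf ltNge ms.
rewrite subKr /exp1_cdf subr_lt0; case: ltP => ts; first by rewrite subr0 mulr1.
by rewrite subKr -expRD; congr expR; ring.
Qed.

(** Memorylessness. Both sides are finite measures in [A], so it suffices to compare them on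
    half-lines. *)
Lemma lam_memoryless (s : R) (A : set R) : 0 <= s -> measurable A ->
  lam (A `&` `]s, +oo[%classic) = ((expR (- s))%:E * lam [set r | A (r + s)%R])%E.
Proof.
move=> s0 mA.
have mf : measurable_fun setT (fun r : R => r + s).
  by apply: measurable_funD => //; exact: measurable_cst.
have es0 : 0 <= expR (- s) by exact: expR_ge0.
have := @pushforward_unique _ _ _ _ R (mscale (NngNum es0) lam) (mrestr lam (measurable_itv `]s, +oo[))
  (fun r : R => r + s) (@RGenOInfty.G R) (fun k => `]- k%:R, +oo[%classic) mf
  (RGenOInfty.measurableE _) gt_setI_closed (fun k => ex_intro _ (- k%:R) erefl) cover_gt.
rewrite /mscale /mrestr /= => H; apply/esym; apply: H => //.
  by rewrite lte_mul_pinfty// ?lee_fin// -ge0_fin_numE// fin_num_measure.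
move=> _ [t ->].
transitivity ((expR (- s))%:E * lam `](t - s)%R, +oo[%classic)%E.
  congr (_ * lam _)%E.
  by apply/seteqP; split=> z /=; rewrite !in_itv/= !andbT ltrBlDr.
rewrite lam_gt -EFinM expRN_max// -lam_gt; congr (lam _).
apply/seteqP; split=> z /=; rewrite !in_itv/= !andbT gt_max.
  by move=> /andP[].
by move=> [-> ->].
Qed.

End Law.

(** * Averages against the exponential law *)

Definition translate (R : realType) (s r : R) : R := r + s.

Lemma measurable_translate (R : realType) (s : R) : measurable_fun setT (translate s).
Proof. by apply: measurable_funD => //; exact: measurable_cst. Qed.

HB.instance Definition _ (R : realType) (s : R) :=
  isMeasurableFun.Build _ _ _ _ (translate s) (measurable_translate s).

Section ExpAverage.
Variables (R : realType) (p : nat -> R) (mu : probability (confT R) R).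
Hypothesis mu_cyl : forall us es, proper_keys us es ->
  mu (cyl us es : set (confT R)) = ((\prod_(uk <- us) p uk.2) * (\prod_(et <- es) exp1_cdf et.2))%:E.
Local Notation lam := (lam mu).

Lemma lam_gt_ge0 (s : R) : 0 <= s -> lam `]s, +oo[%classic = (expR (- s))%:E.
Proof. by move=> s0; rewrite (lam_gt mu_cyl) /exp1_cdf ltNge s0 subKr. Qed.

Lemma itv_pos_split (d : R) : 0 <= d ->
  `]0, +oo[%classic = `]0, d]%classic `|` `]d, +oo[%classic.
Proof.
move=> d0; apply/seteqP; split=> x /=; rewrite !in_itv/= ?andbT.
  by move=> ->; case: (leP x d) => _; [left|right].
by case=> [/andP[]//|]; exact: le_lt_trans.
Qed.

Lemma lam_window (d : R) : 0 <= d -> lam `]0, d]%classic = (1 - expR (- d))%:E.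
Proof.
move=> d0.
have : (lam (`]0%R, d]%classic `|` `]d, +oo[%classic) = lam `]0%R, d]%classic + lam `]d, +oo[%classic)%E.
  rewrite measureU//; apply/seteqP; split=> // x /=; rewrite !in_itv/= andbT.
  by move=> [/andP[_ xd]]; rewrite ltNge xd.
rewrite -itv_pos_split//.
rewrite !lam_gt_ge0// oppr0 expR0.
have fin : lam `]0, d]%classic \is a fin_num by exact: fin_num_measure.
by rewrite -(fineK fin) -EFinD => -[->]; rewrite addrK.
Qed.

Lemma lam_integral_gt (s : R) (F : R -> \bar R) : 0 <= s -> measurable_fun setT F ->
  (forall r, (0 <= F r)%E) ->
  (\int[lam]_(r in `]s, +oo[) F r =
   (expR (- s))%:E * \int[lam]_(r in `]0%R, +oo[) F (r + s)%R)%E.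
Proof.
move=> s0 mF F0.
have es0 : 0 <= expR (- s) by exact: expR_ge0.
transitivity (\int[mscale (NngNum es0) (distribution lam (translate s))]_(r in `]s, +oo[) F r)%E.
  apply: eq_measure_integral => A mA As.
  by rewrite -[in LHS](setIidl As); exact: (lam_memoryless mu_cyl s0 mA).
rewrite ge0_integral_mscale//; last exact: measurable_funTS.
congr (_ * _)%E; rewrite (ge0_integral_pushforward (measurable_translate s))//; last exact: measurable_funTS.
congr (integral _ _ _); apply/seteqP; split=> r /=; rewrite !in_itv/= !andbT /translate => ?; lra.
Qed.

Lemma lam_integral_pos (F : R -> \bar R) : measurable_fun setT F -> (forall r, (0 <= F r)%E) ->
  (\int[lam]_r F r = \int[lam]_(r in `]0%R, +oo[) F r)%E.
Proof.
move=> mF F0.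
have e : lam (~` `]0, +oo[%classic) = 0%E.
  by rewrite probability_setC// lam_gt_ge0// oppr0 expR0 subee.
rewrite (@ge0_negligible_integral _ _ _ lam setT (~` `]0, +oo[) F)//.
- by rewrite setTD setCK.
- exact: measurableC.
Qed.

Definition Eexp (F : R -> R) : R := fine (\int[lam]_(r in `]0%R, +oo[) (F r)%:E).

Definition unit_meas (F : R -> R) := measurable_fun setT F /\ forall r, 0 <= F r <= 1.

Lemma Eexp_fin F : unit_meas F ->
  (\int[lam]_(r in `]0%R, +oo[) (F r)%:E = (Eexp F)%:E)%E /\ 0 <= Eexp F <= 1.
Proof.
move=> [mF F01].
have mEF : measurable_fun setT (EFin \o F) by apply/measurable_EFinP.
have I0 : (0 <= \int[lam]_(r in `]0%R, +oo[) (F r)%:E)%E.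
  by apply: integral_ge0 => r _; rewrite lee_fin; case/andP: (F01 r).
have I1 : (\int[lam]_(r in `]0%R, +oo[) (F r)%:E <= 1)%E.
  apply: (@le_trans _ _ (\int[lam]_(r in `]0%R, +oo[) (cst 1 r))%E).
    apply: ge0_le_integral => //.
    - by move=> r _; rewrite lee_fin; case/andP: (F01 r).
    - exact: measurable_funTS.
    - by move=> r _; rewrite lee_fin; case/andP: (F01 r).
  by rewrite integral_cst// mul1e; exact: probability_le1.
have fin : (\int[lam]_(r in `]0%R, +oo[) (F r)%:E)%E \is a fin_num.
  by rewrite ge0_fin_numE//; apply: le_lt_trans I1 _; exact: ltry.
split; first by rewrite /Eexp fineK.
by rewrite /Eexp; move: fin I0 I1; case: (integral _ _ _) => // r _; rewrite /= !lee_fin => -> ->.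
Qed.

(** By memorylessness the part of the average beyond [d] is [expR (- d)] times the average of the
    translate; what remains lives on the window, of mass [1 - expR (- d)]. This is the source of
    [avg_ahead] and [avg_behind]. *)
Lemma Eexp_window F (d lo hi : R) : unit_meas F -> 0 <= d ->
  (forall r, 0 <= r <= d -> lo <= F r <= hi) ->
  (1 - expR (- d)) * lo <= Eexp F - expR (- d) * Eexp (fun r => F (r + d)) <=
  (1 - expR (- d)) * hi.
Proof.
move=> uF d0 win; have [mF F01] := uF.
have mf : measurable_fun setT (fun r : R => r + d).
  by apply: measurable_funD => //; exact: measurable_cst.
have uFd : unit_meas (fun r => F (r + d)).
  by split=> //; exact: measurableT_comp.
have [e1 _] := Eexp_fin uF; have [e2 _] := Eexp_fin uFd.
have mEF : measurable_fun setT (EFin \o F) by apply/measurable_EFinP.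
have F0 r : (0 <= (F r)%:E)%E by rewrite lee_fin; case/andP: (F01 r).
have := e1; rewrite (itv_pos_split d0).
rewrite ge0_integral_setU//; last 2 first.
- exact: measurable_funTS.
- apply/disj_setPS => x /=; rewrite !in_itv/= andbT => -[/andP[_ xd]].
  by rewrite ltNge xd.
rewrite (lam_integral_gt d0 mEF F0) e2 => H.
have w0 := expRN01 d0.
(* The integrals compared must be of nonnegative functions, and [lo] may be negative. *)
have l1 : (((1 - expR (- d)) * Num.max lo 0)%:E <= \int[lam]_(r in `]0%R, d]) (F r)%:E)%E.
  rewrite mulrC EFinM -(lam_window d0) -integral_cst//.
  apply: ge0_le_integral => //.
  - by move=> r _; rewrite lee_fin le_max lexx orbT.
  - exact: measurable_funTS.
  - move=> r /=; rewrite in_itv/= => /andP[r0 rd]; rewrite lee_fin ge_max.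
    have /andP[-> _] : lo <= F r <= hi by apply: win; rewrite (ltW r0).
    by case/andP: (F01 r).
have l2 : (\int[lam]_(r in `]0%R, d]) (F r)%:E <= ((1 - expR (- d)) * hi)%:E)%E.
  rewrite mulrC EFinM -(lam_window d0) -integral_cst//.
  have hi0 : 0 <= hi.
    have /andP[_] : lo <= F 0 <= hi by apply: win; rewrite lexx.
    by apply: le_trans; case/andP: (F01 0).
  apply: ge0_le_integral => //.
  - exact: measurable_funTS.
  - by move=> r /=; rewrite in_itv/= => /andP[r0 rd]; rewrite lee_fin;
      have /andP[_ ->] : lo <= F r <= hi by apply: win; rewrite (ltW r0).
have l3 : (1 - expR (- d)) * lo <= (1 - expR (- d)) * Num.max lo 0.
  rewrite ler_wpM2l ?le_max ?lexx// subr_ge0; by case/andP: (expRN01 d0).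
move: H l1 l2; case: (integral _ _ _) => // y.
rewrite -EFinM -EFinD !lee_fin => -[<-] l1 l2.
by rewrite addrK l2 (le_trans l3).
Qed.

Lemma Eexp_le F c : unit_meas F -> (forall r, 0 <= r -> F r <= c) -> Eexp F <= c.
Proof.
move=> uF Fc; have [mF F01] := uF.
have c0 : 0 <= c by apply: le_trans (Fc 0 (lexx _)); case/andP: (F01 0).
apply/ler_addgt0Pr => e e0; have [d d0 de] := expRN_small e0.
have uFd : unit_meas (fun r => F (r + d)).
  split=> //; apply: measurableT_comp => //.
  by apply: measurable_funD => //; exact: measurable_cst.
have [_ /andP[h1 h2]] := Eexp_fin uFd.
have := @Eexp_window F d 0 c uF d0 _ => /(_ _)/andP[|_].
  by move=> r /andP[r0 _]; rewrite Fc// andbT; case/andP: (F01 r).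
have /andP[x0 x1] := expRN01 d0.
have : expR (- d) * Eexp (fun r => F (r + d)) <= expR (- d) by rewrite ler_piMr.
have : 0 <= expR (- d) * c by rewrite mulr_ge0.
by lra.
Qed.

Lemma Eexp_eq F G : (forall r, 0 < r -> F r = G r) -> Eexp F = Eexp G.
Proof.
move=> FG; congr fine; apply: eq_integral => r; rewrite inE/= in_itv/= andbT => r0.
by rewrite FG.
Qed.

Lemma Eexp_cst c : Eexp (fun=> c) = c.
Proof.
rewrite /Eexp integral_cst//.
have e : lam `]0, +oo[%classic = 1%E by rewrite lam_gt_ge0// oppr0 expR0.
by rewrite [X in (_ * X)%E]e mule1.
Qed.

Lemma Eexp_mono F G : unit_meas F -> unit_meas G -> (forall r, 0 <= r -> F r <= G r) ->
  Eexp F <= Eexp G.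
Proof.
move=> uF uG FG; have [eF _] := Eexp_fin uF; have [eG _] := Eexp_fin uG.
have mF : measurable_fun setT (EFin \o F) by apply/measurable_EFinP; exact: uF.1.
have mG : measurable_fun setT (EFin \o G) by apply/measurable_EFinP; exact: uG.1.
rewrite -lee_fin -eF -eG; apply: ge0_le_integral => //.
- by move=> r _; rewrite lee_fin; case/andP: (uF.2 r).
- exact: measurable_funTS.
- exact: measurable_funTS.
- by move=> r /=; rewrite in_itv/= andbT => r0; rewrite lee_fin FG// ltW.
Qed.

End ExpAverage.

(** * Extinction probabilities *)

Section Branching.
Variables (R : realType) (p : nat -> R) (mu : probability (confT R) R).
Hypothesis lawp : offspring_law p.
Hypothesis mu_cyl : forall us es, proper_keys us es ->
  mu (cyl us es : set (confT R)) = ((\prod_(uk <- us) p uk.2) * (\prod_(et <- es) exp1_cdf et.2))%:E.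
Local Notation budgets := (R * confT R)%type.
Implicit Types (B : set budgets) (xi : confT R).

Definition down_w (i : nat) xi : R := xi.2 [:: i] false.
Definition up_w (i : nat) xi : R := xi.2 [:: i] true.
Definition subtree (i : nat) xi : confT R := shift [:: i] xi.

(* A child that can be paid for is entered with the remaining budget and must
   lie in [B1]; the other children start afresh and must lie in [B2]. *)
Definition child_ok (B1 B2 : set budgets) (i : nat) : set budgets :=
  [set x | if down_w i x.2 <= x.1
           then B1 (x.1 - down_w i x.2 + up_w i x.2, subtree i x.2)
           else B2 (up_w i x.2, subtree i x.2)].

Definition children_ok (B1 B2 : set budgets) : set budgets :=
  [set x | forall i, (i < x.2.1 [::])%N -> child_ok B1 B2 i x].

Lemma measurable_down_w i : measurable_fun setT (down_w i).
Proof. exact: measurable_funW. Qed.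

Lemma measurable_up_w i : measurable_fun setT (up_w i).
Proof. exact: measurable_funW. Qed.

Lemma measurable_subtree i : measurable_fun setT (subtree i).
Proof. exact: measurable_shift. Qed.

Lemma measurable_fresh B i : measurable B ->
  measurable [set x : budgets | B (x.1 + up_w i x.2, subtree i x.2)].
Proof.
apply: (@measurable_preimage _ _ budgets budgets
  (fun x => (x.1 + up_w i x.2, subtree i x.2))).
apply: measurable_fun_pair.
  apply: measurable_funD; first exact: measurable_fst.
  exact: (measurableT_comp (measurable_up_w i) measurable_snd).
exact: (measurableT_comp (measurable_subtree i) measurable_snd).
Qed.

Lemma measurable_child_ok B1 B2 i : measurable B1 -> measurable B2 ->
  measurable (child_ok B1 B2 i).
Proof.
move=> mB1 mB2.
have md : measurable_fun setT (fun x : budgets => down_w i x.2).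
  exact: (measurableT_comp (measurable_down_w i) measurable_snd).
have mu_ : measurable_fun setT (fun x : budgets => up_w i x.2).
  exact: (measurableT_comp (measurable_up_w i) measurable_snd).
have mt : measurable_fun setT (fun x : budgets => subtree i x.2).
  exact: (measurableT_comp (measurable_subtree i) measurable_snd).
have mle : measurable [set x : budgets | down_w i x.2 <= x.1].
  have := measurable_fun_ler md (measurable_fst : measurable_fun setT (fst : budgets -> R)).
  by move=> /(_ measurableT [set true])/(_ _); rewrite setTI; apply.
rewrite (_ : child_ok B1 B2 i =
  ([set x : budgets | down_w i x.2 <= x.1] `&`
     (fun x : budgets => (x.1 - down_w i x.2 + up_w i x.2, subtree i x.2)) @^-1` B1) `|`
  (~` [set x : budgets | down_w i x.2 <= x.1] `&`
     (fun x : budgets => (up_w i x.2, subtree i x.2)) @^-1` B2)).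
  apply: measurableU; apply: measurableI => //.
  - apply: measurable_preimage => //; apply: measurable_fun_pair => //.
    apply: measurable_funD => //; apply: measurable_funB => //; exact: measurable_fst.
  - exact: measurableC.
  - by apply: measurable_preimage => //; exact: measurable_fun_pair.
apply/seteqP; split=> x /=; rewrite /child_ok /=.
  by case: ifP => h; [left|right; split=> //; rewrite h].
by case=> -[]; [move=> -> | move=> /negP/negbTE ->].
Qed.

Lemma measurable_children_ok B1 B2 : measurable B1 -> measurable B2 ->
  measurable (children_ok B1 B2).
Proof.
move=> mB1 mB2.
rewrite (_ : children_ok B1 B2 = \bigcap_i
  (~` (snd @^-1` [set xi : confT R | (i < xi.1 [::])%N]) `|` child_ok B1 B2 i)).
  apply: bigcapT_measurable => i; apply: measurableU; last exact: measurable_child_ok.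
  apply: measurableC; apply: (measurable_preimage measurable_snd).
  rewrite (_ : [set _ | _] = (fun xi : confT R => xi.1 [::]) @^-1` [set k | (i < k)%N]) //.
  by apply: measurable_preimage => //; exact: measurable_funZ.
apply/seteqP; split=> x.
  by move=> h i _; case: (ltnP i (x.2.1 [::])) => hi; [right; exact: h|left => /=; rewrite ltnNge hi].
by move=> h i hi; case: (h i I) => //= /negP; rewrite hi.
Qed.

Definition prb B (x : R) : R := fine (mu [set xi | B (x, xi)]).

Lemma measurable_section B x : measurable B -> measurable [set xi | B (x, xi)].
Proof.
move=> mB; have := measurable_xsection x mB.
by congr measurable; apply/seteqP; split=> y /=; rewrite /xsection /= inE.
Qed.

Lemma prbE B x : measurable B -> mu [set xi | B (x, xi)] = (prb B x)%:E.
Proof. by move=> mB; rewrite /prb fineK// fin_num_measure//; exact: measurable_section. Qed.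

Lemma prb01 B x : measurable B -> 0 <= prb B x <= 1.
Proof.
move=> mB; have mS := measurable_section x mB.
by rewrite -!lee_fin -prbE// measure_ge0 probability_le1.
Qed.

Lemma unit_meas_prb B : measurable B -> unit_meas (prb B).
Proof.
move=> mB; split=> [|x]; last exact: prb01.
rewrite (_ : prb B = fine \o (mu \o xsection B)).
  by apply: measurableT_comp => //; exact: measurable_fun_xsection.
apply/funext => x; rewrite /prb /=; congr (fine (mu _)).
by apply/seteqP; split=> y /=; rewrite /xsection /= inE.
Qed.

(** The refund for the upward edge adds an independent exponential to the budget. For [B = dies],
    [prb] is f, [fresh_prb] is phi and [child_prb] is h. *)
Definition fresh_prb B (x : R) : R := Eexp mu (fun r => prb B (x + r)).

Lemma unit_meas_shift (F : R -> R) x : unit_meas F -> unit_meas (fun r => F (x + r)).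
Proof.
move=> [mF F01]; split=> //; apply: measurableT_comp => //.
by apply: measurable_funD => //; exact: measurable_cst.
Qed.

Lemma fresh_law B x i : measurable B ->
  mu [set xi | B (x + up_w i xi, subtree i xi)] = (fresh_prb B x)%:E.
Proof.
move=> mB.
(* Freezes the upward weight of child [i] alone. The subtree does not see it, since [shift] erases
   the weights at its root. *)
pose sw (c : label) (b : bool) := (c == [:: i]) && b.
rewrite (@mix_integral _ _ _ mu_cyl pred0 sw); last first.
  exact: (measurable_section x (measurable_fresh i mB)).
have uF := unit_meas_shift x (unit_meas_prb mB).
have mEF : measurable_fun setT (fun r : R => (prb B (x + r))%:E).
  by apply/measurable_EFinP; exact: uF.1.
have F0 r : (0 <= (prb B (x + r))%:E)%E by rewrite lee_fin; case/andP: (uF.2 r).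
have [<- _] := Eexp_fin mu uF.
rewrite -(lam_integral_pos mu_cyl mEF F0).
rewrite -(weight_integral mu_cyl true (isT : [:: i] != [::]) mEF F0).
apply: eq_integral => xi _; rewrite -prbE//.
rewrite -(shift_law mu_cyl [:: i] (measurable_section _ mB)).
congr (mu _); apply/seteqP; split=> y /=; rewrite /up_w /subtree /mix /= /sw eqxx /=.
  congr (B (_, _)); rewrite /shift /=; congr pair; apply/funext => u; apply/funext => b.
  by case: u => [|j u] //=; rewrite /sw ?eqseq_cons ?andbF.
congr (B (_, _)); rewrite /shift /=; congr pair; apply/funext => u; apply/funext => b.
by case: u => [|j u] //=; rewrite ?eqseq_cons ?andbF.
Qed.

Lemma fresh_prbE B : measurable B ->
  fresh_prb B = prb [set x | B (x.1 + up_w 0 x.2, subtree 0 x.2)].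
Proof. by move=> mB; apply/funext => x; rewrite /prb /= fresh_law. Qed.

Lemma unit_meas_fresh B : measurable B -> unit_meas (fresh_prb B).
Proof.
by move=> mB; rewrite fresh_prbE//; apply: unit_meas_prb; exact: measurable_fresh.
Qed.

(** [r] is the downward weight. If it exceeds the budget, the child restarts on its upward weight
    alone, that is from 0 plus a fresh exponential. *)
Definition child_integrand B1 B2 (b r : R) : R :=
  if r <= b then fresh_prb B1 (b - r) else fresh_prb B2 0.

Definition child_prb B1 B2 (b : R) : R := Eexp mu (child_integrand B1 B2 b).

Lemma unit_meas_child B1 B2 b : measurable B1 -> measurable B2 ->
  unit_meas (child_integrand B1 B2 b).
Proof.
move=> mB1 mB2; have [m1 u1] := unit_meas_fresh mB1; have [m2 u2] := unit_meas_fresh mB2.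
split=> [|r]; last by rewrite /child_integrand; case: ifP.
apply: measurable_fun_ifT.
- by apply: measurable_fun_ler => //; exact: measurable_cst.
- apply: measurableT_comp => //; apply: measurable_funB => //; exact: measurable_cst.
- exact: measurable_cst.
Qed.

Lemma child_law B1 B2 b i : measurable B1 -> measurable B2 ->
  mu [set xi | child_ok B1 B2 i (b, xi)] = (child_prb B1 B2 b)%:E.
Proof.
move=> mB1 mB2.
pose sw (c : label) (b : bool) := (c == [:: i]) && ~~ b.
rewrite (@mix_integral _ _ _ mu_cyl pred0 sw); last first.
  exact: (measurable_section b (measurable_child_ok i mB1 mB2)).
have uF := unit_meas_child b mB1 mB2.
have mEF : measurable_fun setT (fun r : R => (child_integrand B1 B2 b r)%:E).
  by apply/measurable_EFinP; exact: uF.1.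
have F0 r : (0 <= (child_integrand B1 B2 b r)%:E)%E by rewrite lee_fin; case/andP: (uF.2 r).
have [<- _] := Eexp_fin mu uF.
rewrite -(lam_integral_pos mu_cyl mEF F0).
rewrite -(weight_integral mu_cyl false (isT : [:: i] != [::]) mEF F0).
apply: eq_integral => xi _; rewrite /child_integrand.
have sub y : subtree i (mix pred0 sw (xi, y)) = subtree i y.
  rewrite /subtree /shift /=; congr pair; apply/funext => u; apply/funext => c.
  by case: u => [|j u] //=; rewrite /sw ?eqseq_cons ?andbF.
have up y : up_w i (mix pred0 sw (xi, y)) = up_w i y.
  by rewrite /up_w /mix /= /sw andbF.
have dw y : down_w i (mix pred0 sw (xi, y)) = xi.2 [:: i] false.
  by rewrite /down_w /mix /= /sw eqxx.
have ok y : child_ok B1 B2 i (b, mix pred0 sw (xi, y)) =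
    if xi.2 [:: i] false <= b then B1 (b - xi.2 [:: i] false + up_w i y, subtree i y)
    else B2 (up_w i y, subtree i y).
  by rewrite -(sub y) -(up y) -(dw y).
case: ifP => h.
  rewrite -(fresh_law _ i)//; congr (mu _).
  by apply/seteqP; split=> y; rewrite /mkset ok h.
rewrite -(fresh_law _ i)//; congr (mu _).
by apply/seteqP; split=> y; rewrite /mkset ok h add0r.
Qed.

Lemma offspring_prb k : mu [set xi : confT R | xi.1 [::] = k] = (p k)%:E.
Proof.
have := mu_cyl (us := [:: ([::], k)]) (es := [::]).
rewrite big_nil mulr1 big_seq1 /= => <-//.
by congr (mu _); apply/seteqP; split=> xi; rewrite /cyl /= !andbT => /eqP.
Qed.

Lemma children_law B1 B2 b : measurable B1 -> measurable B2 ->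
  mu [set xi | children_ok B1 B2 (b, xi)] = (genf p (child_prb B1 B2 b))%:E.
Proof.
move=> mB1 mB2; have uF := unit_meas_child b mB1 mB2.
have [_ c01] := Eexp_fin mu uF.
rewrite -(genf_esum lawp c01).
(* Separating the number [k] of children from the number [j] of children examined allows an
   induction on [j] with [k] fixed. *)
pose Q k j := [set xi : confT R | xi.1 [::] = k /\
  forall i, (i < j)%N -> child_ok B1 B2 i (b, xi)].
have mC i : measurable [set xi | child_ok B1 B2 i (b, xi)].
  exact: (measurable_section b (measurable_child_ok i mB1 mB2)).
have QS k j : Q k j.+1 = Q k j `&` [set xi | child_ok B1 B2 j (b, xi)].
  apply/seteqP; split=> xi.
    by move=> [Zk H]; split; [split=> // i ij; apply: H; exact: ltnW|exact: H].
  move=> [[Zk H] Hj]; split=> // i; rewrite ltnS leq_eqVlt => /orP[/eqP ->//|]; exact: H.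
have mQ k j : measurable (Q k j).
  elim: j => [|j IH]; last by rewrite QS; exact: measurableI.
  rewrite (_ : Q k 0%N = [set xi | xi.1 [::] = k]); first exact: measurable_Z.
  by apply/seteqP; split=> xi //= [].
have muQ k j : mu (Q k j) = (p k * child_prb B1 B2 b ^+ j)%:E.
  elim: j => [|j IH].
    rewrite expr0 mulr1 -offspring_prb; congr (mu _).
    by apply/seteqP; split=> xi //= [].
  (* Everything at and below child [j] comes from one copy; the offspring number of the root and the
     earlier children come from the other. *)
  pose sz (u : label) := if u is i :: _ then i == j else false.
  rewrite -(mix_law mu_cyl sz (fun c _ => sz c) (mQ _ _)).
  rewrite (_ : _ @^-1` _ = [set xi | child_ok B1 B2 j (b, xi)] `*` Q k j).
    apply: (etrans (product_measure1E mu mu (mC j) (mQ k j))).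
    rewrite [X in (X * _)%E = _](child_law _ _ mB1 mB2) [X in (_ * X)%E = _]IH.
    by rewrite -EFinM exprSr mulrCA [_ * child_prb _ _ _]mulrC.
  have sub i x : subtree i (mix sz (fun c _ => sz c) x) =
      if i == j then subtree i x.1 else subtree i x.2.
    by rewrite /subtree /shift /=; case: ifP.
  have okE i x : child_ok B1 B2 i (b, mix sz (fun c _ => sz c) x) <->
      child_ok B1 B2 i (b, if i == j then x.1 else x.2).
    rewrite /child_ok /= sub /up_w /down_w /mix /=.
    by case: (i == j).
  apply/seteqP; split=> x.
    rewrite QS => -[[Zk H] /okE]; rewrite eqxx => Hj; split=> //; split=> // i ij.
    by have /okE := H i ij; rewrite ltn_eqF.
  move=> [Hj [Zk H]]; rewrite QS; split; last by apply/okE; rewrite eqxx.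
  by split=> // i ij; apply/okE; rewrite ltn_eqF//; exact: H.
rewrite (_ : [set xi | children_ok B1 B2 (b, xi)] = \bigcup_k Q k k).
  rewrite measure_bigcup//=; last first.
    apply/trivIsetP => k l _ _ kl; apply/seteqP; split=> // xi [[Zk _] [Zl _]].
    by move: kl; rewrite -Zk -Zl eqxx.
  transitivity (\sum_(k <oo | k \in [set: nat]) (p k * child_prb B1 B2 b ^+ k)%:E)%E.
    by apply: eq_eseriesr => k _; exact: muQ.
  by apply: eq_eseriesl => k; rewrite in_setT.
apply/seteqP; split=> xi; first by move=> H; exists (xi.1 [::]) => //; split=> //.
by move=> [k _ [Zk H]] i; rewrite /= Zk; exact: H.
Qed.

End Branching.

(** * Energy comparison for dying and for a finite past *)

Section Extinction.
Variables (R : realType) (p : nat -> R) (mu : probability (confT R) R).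
Hypothesis lawp : offspring_law p.
Hypothesis mu_cyl : forall us es, proper_keys us es ->
  mu (cyl us es : set (confT R)) = ((\prod_(uk <- us) p uk.2) * (\prod_(et <- es) exp1_cdf et.2))%:E.
Local Notation budgets := (R * confT R)%type.
Implicit Types (B : set budgets) (xi : confT R).
Local Notation prb := (prb mu).
Local Notation fresh_prb := (fresh_prb mu).
Local Notation child_prb := (child_prb mu).
Local Notation K := (potential p).

Section OneStep.
Variables B1 B2 : set budgets.
Hypotheses (mB1 : measurable B1) (mB2 : measurable B2).
Let B := children_ok B1 B2.
Let mB : measurable B := measurable_children_ok mB1 mB2.

Lemma unit_valued_prb : unit_valued (prb B1).
Proof. by move=> x _; exact: prb01. Qed.

Lemma unit_valued_fresh : unit_valued (fresh_prb B1).
Proof. by move=> x _; exact: (unit_meas_fresh mu_cyl mB1).2. Qed.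

Lemma unit_valued_child : unit_valued (child_prb B1 B2).
Proof. by move=> x _; have [] := Eexp_fin mu (unit_meas_child mu_cyl x mB1 mB2). Qed.

Lemma prb_children x : prb B x = genf p (child_prb B1 B2 x).
Proof. by rewrite /prb (children_law lawp mu_cyl). Qed.

Lemma fresh_ahead : avg_ahead (prb B1) (fresh_prb B1).
Proof.
move=> x d lo hi x0 d0 win.
have e : fresh_prb B1 (x + d) = Eexp mu (fun r => prb B1 (x + (r + d))).
  by congr (Eexp _ _); apply/funext => r; rewrite addrA addrAC.
by rewrite e; exact: (Eexp_window mu_cyl (unit_meas_shift x (unit_meas_prb mu mB1)) d0 win).
Qed.

(** With budget [b + d], downward weights below [d] leave budgets between [b] and [b + d]; a weight
    above [d] is, after subtracting [d], a fresh weight facing budget [b]. *)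
Lemma child_behind : avg_behind (fresh_prb B1) (child_prb B1 B2).
Proof.
move=> b d lo hi b0 d0 win.
have win' r : 0 <= r <= d -> lo <= child_integrand mu B1 B2 (b + d) r <= hi.
  move=> /andP[r0 rd]; rewrite /child_integrand (_ : r <= b + d); last by lra.
  by rewrite -addrA; apply: win; apply/andP; split; lra.
have e : child_prb B1 B2 b = Eexp mu (fun r => child_integrand mu B1 B2 (b + d) (r + d)).
  congr (Eexp _ _); apply/funext => r.
  by rewrite /child_integrand lerD2r; congr (if _ then fresh_prb _ _ else _); ring.
by rewrite e; exact: (Eexp_window mu_cyl (unit_meas_child mu_cyl (b + d) mB1 mB2) d0 win').
Qed.

Lemma fresh_lip : forall x d : R, 0 <= x -> 0 <= d -> `|fresh_prb B1 (x + d) - fresh_prb B1 x| <= d.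
Proof. exact: avg_ahead_lip unit_valued_prb unit_valued_fresh fresh_ahead. Qed.

Lemma fresh_sup (x c : R) : 0 <= x -> (forall r, 0 <= r -> prb B1 (x + r) <= c) -> fresh_prb B1 x <= c.
Proof. by move=> x0; exact: (Eexp_le mu_cyl (unit_meas_shift x (unit_meas_prb mu mB1))). Qed.

(** Weights are almost surely positive, so budget 0 pays for no child. Through this boundary value
    [B2] determines the energy at 0. *)
Lemma child_prb0 : child_prb B1 B2 0 = fresh_prb B2 0.
Proof.
rewrite -[RHS](Eexp_cst mu_cyl); apply: Eexp_eq => r r0.
by rewrite /child_integrand leNgt r0.
Qed.

End OneStep.

Let mean0 : 0 <= mean p := mean_ge0 lawp.
Let C0 : 0 <= mean p + 1. Proof. by rewrite addr_ge0. Qed.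
Let kap0 : 0 < 1 - p 1%N. Proof. by rewrite subr_gt0; exact: p1_lt1. Qed.
Let K1K0 : K 1 < K 0.
Proof. exact: (K_decr C0 kap0 (genf_le lawp) (potential_quad lawp) (lexx _) ltr01). Qed.

Lemma children_vanishing B1 B2 : measurable B1 -> measurable B2 ->
  vanishing (fresh_prb B1) -> vanishing (fresh_prb (children_ok B1 B2)).
Proof.
move=> mB1 mB2 v1; have mB := measurable_children_ok mB1 mB2.
apply: (vanishing_ph (fresh_sup mB)).
apply: (vanishing_f kap0 (genf_le lawp) (unit_valued_child mB1 mB2)).
  by move=> x _; exact: prb_children.
exact: (vanishing_h (unit_valued_fresh mB1) (unit_valued_child mB1 mB2) (child_behind mB1 mB2) v1).
Qed.

Lemma children_energy_ge B1 B2 (B := children_ok B1 B2) : measurable B1 -> measurable B2 ->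
  vanishing (fresh_prb B1) ->
  (forall x, 0 <= x -> fresh_prb B x <= prb B x /\ fresh_prb B1 x <= fresh_prb B x) ->
  K 0 <= energy K (fresh_prb B) (child_prb B1 B2) 0.
Proof.
move=> mB1 mB2 v1 H; have mB : measurable B := measurable_children_ok mB1 mB2.
apply: (flow_energy_ge mean0 C0 kap0 (genf_ge0 lawp) (genf_le lawp) (genf_lip lawp)
  (potential_quad lawp) (unit_valued_prb mB) (unit_valued_fresh mB) (unit_valued_fresh mB1)
  (unit_valued_child mB1 mB2) (fun x _ => prb_children mB1 mB2 x) (fresh_ahead mB)
  (child_behind mB1 mB2) (fresh_lip mB1) (fresh_sup mB) v1 H).
Qed.

Lemma fixpoint_energy B1 B2 : measurable B1 -> measurable B2 -> children_ok B1 B2 = B1 ->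
  vanishing (prb B1) -> energy K (fresh_prb B1) (child_prb B1 B2) 0 = K 0.
Proof.
move=> mB1 mB2 fix1 v1.
have fgh x : 0 <= x -> prb B1 x = genf p (child_prb B1 B2 x).
  by move=> _; rewrite -prb_children// fix1.
exact: (flow_energy_eq mean0 C0 (genf_ge0 lawp) (genf_le lawp) (genf_lip lawp)
  (potential_quad lawp) (unit_valued_prb mB1) (unit_valued_fresh mB1) (unit_valued_fresh mB1)
  (unit_valued_child mB1 mB2) fgh (fresh_ahead mB1)
  (child_behind mB1 mB2) (fresh_lip mB1) (fresh_sup mB1) (fun _ _ => erefl) v1).
Qed.

Lemma fixpoint_vanishing B1 B2 : measurable B1 -> measurable B2 -> children_ok B1 B2 = B1 ->
  (forall x y : R, 0 <= x -> x <= y -> prb B1 y <= prb B1 x) -> fresh_prb B1 0 < 1 ->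
  vanishing (prb B1).
Proof.
move=> mB1 mB2 fix1 anti lt1.
have fgh x : 0 <= x -> prb B1 x = genf p (child_prb B1 B2 x).
  by move=> _; rewrite -prb_children// fix1.
exact: (flow_vanishing kap0 (genf_le lawp)
  (unit_valued_prb mB1) (unit_valued_fresh mB1) (unit_valued_fresh mB1)
  (unit_valued_child mB1 mB2) fgh (fresh_ahead mB1)
  (child_behind mB1 mB2) (fresh_sup mB1) (fun _ _ => erefl) anti lt1).
Qed.

Lemma children_ok_mono B1 B2 B1' B2' : B1 `<=` B1' -> B2 `<=` B2' ->
  children_ok B1 B2 `<=` children_ok B1' B2'.
Proof.
move=> h1 h2 x H i iz; have := H i iz; rewrite /child_ok /=.
by case: ifP => _; [exact: h1|exact: h2].
Qed.

(** A vertex has finitely many children, so the largest of their indices serves for all of them.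
    Hence increasing unions of iterates are fixed points. *)
Lemma children_ok_bigcup (C1 C2 : nat -> set budgets) :
  (forall n, C1 n `<=` C1 n.+1) -> (forall n, C2 n `<=` C2 n.+1) ->
  children_ok (\bigcup_n C1 n) (\bigcup_n C2 n) = \bigcup_n children_ok (C1 n) (C2 n).
Proof.
move=> inc1 inc2.
have mono (C : nat -> set budgets) : (forall n, C n `<=` C n.+1) ->
    forall m n, (m <= n)%N -> C m `<=` C n.
  move=> inc m n /subnK <-; elim: (n - m)%N => [//|k IH] x /IH; exact: inc.
apply/seteqP; split=> x; last first.
  by move=> [n _]; apply: children_ok_mono => y h; exists n.
move=> H.
have {}H : forall i, (i < x.2.1 [::])%N -> child_ok (\bigcup_n C1 n) (\bigcup_n C2 n) i x := H.
suff [n Hn] : exists n, forall i, (i < x.2.1 [::])%N -> child_ok (C1 n) (C2 n) i x.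
  by exists n.
elim: (x.2.1 [::]) H => [|k IH] H; first by exists 0%N.
have [|n Hn] := IH; first by move=> i ik; exact: (H i (leqW ik)).
have [n' Hn'] : exists n, child_ok (C1 n) (C2 n) k x.
  by have := H k (ltnSn k); rewrite /child_ok /=; case: ifP => _ [n' _ hn']; exists n'.
exists (maxn n n') => i; rewrite ltnS leq_eqVlt => /orP[/eqP ->|/Hn].
  move: Hn'; rewrite /child_ok /=; case: ifP => _.
    by apply: (mono C1) => //; exact: leq_maxr.
  by apply: (mono C2) => //; exact: leq_maxr.
rewrite /child_ok /=; case: ifP => _.
  by apply: (mono C1) => //; exact: leq_maxl.
by apply: (mono C2) => //; exact: leq_maxl.
Qed.

(* The branching walk started with the given budget dies out within n steps. *)
Fixpoint dies_by (n : nat) : set budgets :=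
  if n is m.+1 then children_ok (dies_by m) setT else set0.

Definition dies : set budgets := \bigcup_n dies_by n.

(* ... and moreover no chain of restarted walks that all die is longer than n. *)
Fixpoint short_past (n : nat) : set budgets :=
  if n is m.+1 then children_ok (short_past m) (~` dies `|` short_past m) else set0.

Definition finite_past : set budgets := \bigcup_n short_past n.

Lemma dies_byS n : dies_by n `<=` dies_by n.+1.
Proof. by elim: n => [//|n IH]; exact: children_ok_mono. Qed.

Lemma diesE : children_ok dies setT = dies.
Proof.
rewrite -[setT](bigcup_const (P := [set: nat])); last by exists 0%N.
rewrite children_ok_bigcup//; last exact: dies_byS.
apply/seteqP; split=> x [n _]; first by move=> h; exists n.+1.
by case: n => [//|n] h; exists n.
Qed.

Lemma measurable_dies_by n : measurable (dies_by n).
Proof. by elim: n => [|n IH]; [exact: measurable0|exact: measurable_children_ok]. Qed.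

Lemma measurable_dies : measurable dies.
Proof. by apply: bigcupT_measurable; exact: measurable_dies_by. Qed.

Lemma measurable_short_past n : measurable (short_past n).
Proof.
elim: n => [|n IH]; first exact: measurable0.
by apply: measurable_children_ok => //; apply: measurableU => //; apply: measurableC; exact: measurable_dies.
Qed.

Lemma measurable_finite_past : measurable finite_past.
Proof. by apply: bigcupT_measurable; exact: measurable_short_past. Qed.

Lemma short_pastS n : short_past n `<=` short_past n.+1.
Proof. by elim: n => [//|n IH]; apply: children_ok_mono => //; apply: setUS. Qed.

Lemma finite_pastE : children_ok finite_past (~` dies `|` finite_past) = finite_past.
Proof.
have -> : ~` dies `|` finite_past = \bigcup_n (~` dies `|` short_past n).
  apply/seteqP; split=> x.
    by case=> [h|[n _ h]]; [exists 0%N => //; left|exists n => //; right].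
  by move=> [n _ []]; [left|right; exists n].
rewrite children_ok_bigcup//; first last.
- by move=> n; apply: setUS; exact: short_pastS.
- exact: short_pastS.
apply/seteqP; split=> x [n _]; first by move=> h; exists n.+1.
by case: n => [//|n] h; exists n.
Qed.

Lemma finite_past_dies : finite_past `<=` dies.
Proof.
move=> x [n _]; elim: n x => [//|n IH] x /= h.
by rewrite -diesE; apply: children_ok_mono h.
Qed.

Lemma dies_by_anti n (x y : R) xi : x <= y -> dies_by n (y, xi) -> dies_by n (x, xi).
Proof.
elim: n x y xi => [//|n IH] x y xi xy H i iz; have := H i iz; rewrite /child_ok /=.
case: (leP (down_w i xi) x) => // dx; rewrite (le_trans dx xy).
by apply: IH; rewrite lerD2r lerB.
Qed.

Lemma dies_anti (x y : R) xi : x <= y -> dies (y, xi) -> dies (x, xi).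
Proof. by move=> xy [n _ h]; exists n => //; exact: dies_by_anti h. Qed.

Lemma prb_mono B B' (x y : R) : measurable B -> measurable B' ->
  (forall xi, B (x, xi) -> B' (y, xi)) -> prb B x <= prb B' y.
Proof.
move=> mB mB' sub; rewrite -lee_fin -!prbE//.
by apply: le_measure => //; rewrite inE; exact: measurable_section.
Qed.

Lemma fresh_mono B B' (x : R) : measurable B -> measurable B' -> B `<=` B' ->
  fresh_prb B x <= fresh_prb B' x.
Proof.
move=> mB mB' sub; apply: (Eexp_mono _ (unit_meas_shift x (unit_meas_prb mu mB))
  (unit_meas_shift x (unit_meas_prb mu mB'))) => r _.
by apply: prb_mono => // xi; exact: sub.
Qed.

Lemma fresh_prbT x : fresh_prb setT x = 1.
Proof.
rewrite -[RHS](Eexp_cst mu_cyl); apply: Eexp_eq => r _.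
by rewrite /prb (_ : [set _ | _] = setT)// [mu _]probability_setT.
Qed.

Lemma vanishing_dies_by n : vanishing (fresh_prb (dies_by n)).
Proof.
elim: n => [|n IH]; last first.
  by apply: children_vanishing => //; exact: measurable_dies_by.
move=> e e0; exists 0 => // x x0; apply: (fresh_sup (measurable_dies_by 0)) => // r r0.
by rewrite /prb (_ : [set _ | _] = set0)// measure0 ltW.
Qed.

(** With consecutive depths as [ps] and [ph], both sign conditions hold: dying gets easier with
    depth and harder with budget. The energy inequality at 0 reads (1 - f)^2 / 2 >= K(0) - K(1), and
    1 - f >= (1 - f)^2; the bound is uniform in [n], so it passes to [dies]. *)
Lemma fresh_dies_by n : fresh_prb (dies_by n) 0 <= 1 - Num.min 1 (2 * (K 0 - K 1)).
Proof.
pose c := Num.min 1 (2 * (K 0 - K 1)).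
have c1 : c <= 1 by rewrite ge_min lexx.
have md := measurable_dies_by.
apply: (@le_trans _ _ (fresh_prb (dies_by n.+1) 0)).
  by apply: fresh_mono => //; exact: dies_byS.
have := @children_energy_ge (dies_by n) setT (md n) measurableT (vanishing_dies_by n).
rewrite /energy child_prb0// fresh_prbT -/(dies_by n.+1) => /(_ _) H.
have {}H : K 0 <= (fresh_prb (dies_by n.+1) 0 - 1) ^+ 2 / 2 + K 1.
  apply: H => x x0; split; last by apply: fresh_mono => //; exact: dies_byS.
  apply: (fresh_sup (md n.+1)) => // r r0; apply: prb_mono => // xi.
  by apply: dies_by_anti; rewrite lerDl.
have /andP[f0 f1] := unit_valued_fresh (md n.+1) (lexx 0).
set f := fresh_prb _ _ in H f0 f1 *.
have c2 : c <= 2 * (K 0 - K 1) by rewrite ge_min lexx orbT.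
have : (f - 1) ^+ 2 <= 1 - f.
  by rewrite -sqrrN opprB expr2 ler_piMl ?subr_ge0//; lra.
by rewrite -/c; lra.
Qed.

Lemma fresh_dies_lt1 : fresh_prb dies 0 < 1.
Proof.
pose c := Num.min 1 (2 * (K 0 - K 1)).
have c0 : 0 < c by rewrite lt_min ltr01 mulr_gt0// subr_gt0.
suff : fresh_prb dies 0 <= 1 - c by lra.
rewrite -lee_fin -(fresh_law mu_cyl 0 0 measurable_dies).
pose S n := [set xi | dies_by n (0 + up_w 0 xi, subtree 0 xi)].
have mS n : measurable (S n).
  exact: (measurable_section 0 (measurable_fresh 0 (measurable_dies_by n))).
have incS : nondecreasing_seq S.
  move=> m n mn; apply/subsetPset => xi; rewrite /S /=.
  move: mn => /subnK <-; elim: (n - m)%N => [//|k IH] h; exact/dies_byS/IH.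
have H := @nondecreasing_cvg_mu _ _ _ mu S mS (bigcupT_measurable _ mS) incS.
have -> : [set xi | dies (0 + up_w 0 xi, subtree 0 xi)] = \bigcup_n S n.
  by apply/seteqP; split=> xi [n _ h]; exists n.
rewrite -(cvg_lim _ H)//; apply: lime_le; first by apply/cvg_ex; exists (mu (\bigcup_n S n)).
apply: nearW => n; rewrite /= /S (fresh_law mu_cyl 0 0 (measurable_dies_by n)) lee_fin.
exact: fresh_dies_by.
Qed.

Lemma vanishing_dies : vanishing (prb dies).
Proof.
apply: (fixpoint_vanishing measurable_dies measurableT diesE _ fresh_dies_lt1).
move=> x y _ xy; apply: (prb_mono measurable_dies measurable_dies) => xi; exact: dies_anti.
Qed.

Lemma vanishing_finite_past : vanishing (prb finite_past).
Proof.
move=> e e0; have [B B0 HB] := vanishing_dies e0; exists B => // x Bx.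
apply: le_trans (HB _ Bx).
by apply: (prb_mono measurable_finite_past measurable_dies) => xi; exact: finite_past_dies.
Qed.

Lemma fresh_finite_past : fresh_prb finite_past 0 = fresh_prb dies 0.
Proof.
have mF := measurable_finite_past; have mD := measurable_dies.
have mU : measurable (~` dies `|` finite_past) by apply: measurableU => //; exact: measurableC.
have e1 := fixpoint_energy mD measurableT diesE vanishing_dies.
have e2 := fixpoint_energy mF mU finite_pastE vanishing_finite_past.
move: e1 e2; rewrite /energy !child_prb0// fresh_prbT.
pose g (xi : confT R) : budgets := (0 + up_w 0 xi, subtree 0 xi).
have mg A : measurable A -> measurable [set xi | A (g xi)].
  by move=> mA; exact: (measurable_section 0 (measurable_fresh 0 mA)).
(* The union is disjoint, since a finite past implies dying. *)
have eU : fresh_prb (~` dies `|` finite_past) 0 = 1 - fresh_prb dies 0 + fresh_prb finite_past 0.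
  apply: EFin_inj; rewrite EFinD EFinB.
  rewrite -(fresh_law mu_cyl 0 0 mU) -(fresh_law mu_cyl 0 0 mD) -(fresh_law mu_cyl 0 0 mF).
  have -> : [set xi | (~` dies `|` finite_past) (g xi)] =
      ~` [set xi | dies (g xi)] `|` [set xi | finite_past (g xi)] by [].
  rewrite measureU; [|by apply: measurableC; apply: mg|exact: mg|].
    by congr (_ + _)%E; exact: (probability_setC mu (mg _ mD)).
  by apply/seteqP; split=> // xi [] /= h /finite_past_dies.
rewrite eU; set q := fresh_prb dies 0; set s := fresh_prb finite_past 0.
move=> e1 e2.
have /andP[s0 s1] : 0 <= s <= 1 := unit_valued_fresh mF (lexx 0).
have sq : s <= q by apply: fresh_mono => //; exact: finite_past_dies.
apply/eqP; rewrite eq_le sq /= leNgt; apply/negP => lt.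
have q1 : q < 1 := fresh_dies_lt1.
have : K 1 < K (1 - q + s).
  by apply: (K_decr C0 kap0 (genf_le lawp) (potential_quad lawp)); lra.
(* The two kinetic terms agree, so equality of energies leaves K(1 - q + s) = K(1), impossible if s
   < q. *)
have : (s - (1 - q + s)) ^+ 2 = (q - 1) ^+ 2 by congr (_ ^+ 2); ring.
by move: e1 e2; lra.
Qed.

Lemma infinite_past_null i : mu [set xi : confT R |
  dies (up_w i xi, subtree i xi) /\ ~ finite_past (up_w i xi, subtree i xi)] = 0%E.
Proof.
have mF := measurable_finite_past; have mD := measurable_dies.
pose g (xi : confT R) : budgets := (0 + up_w i xi, subtree i xi).
have mg A : measurable A -> measurable [set xi | A (g xi)].
  by move=> mA; exact: (measurable_section 0 (measurable_fresh i mA)).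
have -> : [set xi | dies (up_w i xi, subtree i xi) /\ ~ finite_past (up_w i xi, subtree i xi)] =
    [set xi | dies (g xi)] `\` [set xi | finite_past (g xi)].
  by apply/seteqP; split=> xi; rewrite /g /= add0r.
rewrite measureD; [|exact: mg|exact: mg|by apply: le_lt_trans (probability_le1 mu (mg _ mD)) _; rewrite ltry].
rewrite setIidr; last by move=> xi; exact: finite_past_dies.
rewrite [X in (X - _)%E](fresh_law mu_cyl 0 i mD).
by rewrite [X in (_ - X)%E](fresh_law mu_cyl 0 i mF) fresh_finite_past subee.
Qed.

(** The event lies in each [dies (n%:R, xi)], whose probability tends to 0 as the budget grows. *)
Lemma never_survives_null :
  mu [set xi : confT R | forall n : nat, dies (n%:R, xi)] = 0%E.
Proof.
have mD := measurable_dies.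
have mS n : measurable [set xi : confT R | dies (n%:R, xi)] by exact: measurable_section.
have mA : measurable [set xi : confT R | forall n : nat, dies (n%:R, xi)].
  rewrite (_ : [set _ | _] = \bigcap_n [set xi : confT R | dies (n%:R, xi)]).
    exact: bigcapT_measurable.
  by apply/seteqP; split=> xi H; [move=> n _; exact: H|move=> n; exact: (H n I)].
apply/eqP; rewrite eq_le measure_ge0 andbT; apply/lee_addgt0Pr => e e0; rewrite add0e.
have [B B0 HB] := vanishing_dies e0.
apply: le_trans (_ : mu [set xi : confT R | dies ((Num.truncn B).+1%:R, xi)] <= _)%E.
  by apply: le_measure; rewrite ?inE// => xi; exact.
by rewrite prbE// lee_fin; apply: HB; rewrite ltW// truncnS_gt.
Qed.

End Extinction.

(** * Uniqueness of the best neighbour *)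

Section Ties.
Variables (R : realType) (nch : label -> nat).
Implicit Types W : label -> bool -> R.

Lemma surv_ext W W' (Q : label -> label -> Prop) k x y b :
  (forall x y, Q x y -> owt W x y = owt W' x y /\ owt W y x = owt W' y x) ->
  (forall x y z, Q x y -> tadj nch y z -> z <> x -> Q y z) ->
  Q x y -> surv nch W k x y b -> surv nch W' k x y b.
Proof.
move=> eqW cont; elim: k x y b => [//|k IH] x y b Qxy [wb [z [yz zx s]]].
have [e1 e2] := eqW _ _ Qxy; rewrite /= -e1 -e2; split=> //.
by exists z; split=> //; apply: IH => //; exact: (cont x).
Qed.

(* Oriented edges pointing away from the edge between P and its child C. *)
Definition away (P C x y : label) :=
  (exists2 j, x = rcons y j & prefix x P) \/
  (exists2 j, y = rcons x j & ~~ prefix y P && (y != C)).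

Lemma prefix_rcons_size (P : label) i : ~~ prefix (rcons P i) P.
Proof.
by apply/negP => /size_prefix; rewrite size_rcons ltnn.
Qed.

Lemma away_cont (P C : label) i x y z : C = rcons P i -> away P C x y -> tadj nch y z -> z <> x ->
  away P C y z.
Proof.
move=> eC [[j ex px]|[j ey /andP[py yC]]] yz zx.
  case/tadjP: yz => -[_ [l e _]]; last first.
    left; exists l => //; apply: prefix_trans px.
    by rewrite ex prefix_rcons.
  right; exists l => //; apply/andP; split.
    apply/negP => pz; apply: zx.
    move/prefixP: px => [s es]; move/prefixP: pz => [s' es'].
    have sz : size z = size x by rewrite ex e !size_rcons.
    have := congr1 (take (size x)) es'; rewrite {1}es take_size_cat// -sz take_size_cat//.
  apply/eqP => zC; move: px; rewrite ex.
  have -> : y = P by move: zC; rewrite e eC => /rcons_inj[].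
  by rewrite (negbTE (prefix_rcons_size _ _)).
right; rewrite ey in yz; have [|l ez _] := nonback_down yz; first by [].
exists l; first by rewrite ey.
rewrite ez -ey; apply/andP; split.
  by apply: contra py; apply: prefix_trans; rewrite prefix_rcons.
apply/eqP; rewrite eC => /rcons_inj[yP _]; move: py; rewrite yP.
by rewrite prefix_refl.
Qed.

Lemma away_start (P C : label) i x y : C = rcons P i -> tadj nch x y ->
  (x = P /\ y <> C) \/ (x = C /\ y <> P) -> away P C x y.
Proof.
move=> eC xy [[xP yC]|[xC yP]].
  case/tadjP: (xy) => -[_ [l e _]]; rewrite xP in e *.
    right; exists l => //; rewrite {1}e prefix_rcons_size /=; exact/eqP.
  by left; exists l => //; exact: prefix_refl.
rewrite xC eC in xy; have [|l ey _] := nonback_down xy; first by [].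
right; exists l; first by rewrite xC eC.
rewrite ey; apply/andP; split.
  by apply: contra (prefix_rcons_size P i); apply: prefix_trans; rewrite prefix_rcons.
apply/eqP => /(congr1 size); rewrite eC !size_rcons => /eqP.
by rewrite -[X in _ == X]addn0 -addn1 eqn_add2l.
Qed.

Lemma away_owt W W' (P C : label) x y : (forall c b, c <> C -> W c b = W' c b) ->
  ~~ prefix C P -> away P C x y -> owt W x y = owt W' x y /\ owt W y x = owt W' y x.
Proof.
move=> eqW CP [[j ex px]|[j ey /andP[py /eqP yC]]].
  have xC : x <> C by move=> xC; move: CP; rewrite -xC px.
  by rewrite /owt ex size_rcons leqnn ltnNge leqnSn -ex /= !eqW.
by rewrite /owt ey size_rcons leqnn ltnNge leqnSn -ey /= !eqW.
Qed.

(** A non-backtracking walk never returns to the edge it started along, nor meets it when started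
    along another edge. So changing the weight of v -> a translates the surviving budgets of [a] and
    leaves those of the other neighbours fixed. *)
Lemma survives_shift W W' v a b : tadj nch v a ->
  (forall x y, (x, y) <> (v, a) -> tadj nch x y -> owt W x y = owt W' x y) ->
  (forall c d, c <> (if (size v < size a)%N then a else v) -> W c d = W' c d) ->
  (survives nch W v a b -> survives nch W' v a (b - owt W v a + owt W' v a)) /\
  (forall a', tadj nch v a' -> a' <> a -> survives nch W v a' b -> survives nch W' v a' b).
Proof.
move=> va eqO eqW.
have [P [C [i [eC CP vaPC eqC]]]] : exists P C i, [/\ C = rcons P i, ~~ prefix C P,
    (v = P /\ a = C) \/ (v = C /\ a = P) & forall c d, c <> C -> W c d = W' c d].
  move: eqW; case/tadjP: (va) => -[_ [i e _]]; rewrite e size_rcons.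
    rewrite leqnn => eqW; exists v, a, i; rewrite e prefix_rcons_size; split=> //; by left.
  by rewrite ltnNge leqnSn => eqW; exists a, v, i; rewrite e prefix_rcons_size; split=> //; right.
have ext k x y b' : tadj nch x y -> (x = P /\ y <> C) \/ (x = C /\ y <> P) ->
    surv nch W k x y b' -> surv nch W' k x y b'.
  move=> xy st; apply: (@surv_ext _ _ (away P C)).
  - by move=> x' y'; exact: away_owt.
  - by move=> x' y' z; exact: away_cont eC.
  - exact: away_start eC xy st.
have av : tadj nch a v by rewrite tadjC.
split; last first.
  move=> a' va' a'a s k; apply: ext (s k) => //.
  by case: vaPC => -[ev ea]; [left|right]; split=> //; rewrite -ea.
move=> /survivesP[wb [c [ac cv s]]]; apply/survivesP; split.
  by move: wb; lra.
exists c; split=> // k.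
have -> : b - owt W v a + owt W' v a - owt W' v a + owt W' a v = b - owt W v a + owt W a v.
  rewrite (eqO a v)//; last by move=> [av' _]; move: va; rewrite av' tadj_irr.
  by ring.
apply: ext (s k) => //.
by case: vaPC => -[ev ea]; [right|left]; split=> //; rewrite -ev.
Qed.

(** Only rational budgets are compared, so that the event is a countable combination of measurable
    ones. The last clause excludes neighbours that never survive. *)
Definition tie W v a a' := [/\ tadj nch v a, tadj nch v a',
  forall q : rat, survives nch W v a (ratr q) <-> survives nch W v a' (ratr q) &
  exists q : rat, survives nch W v a (ratr q)].

Lemma survives_ge W v a b : survives nch W v a b -> owt W v a <= b.
Proof. by case/survivesP. Qed.

(** Raising the weight of v -> a by [d] translates the surviving budgets of [a] by [d] but not those
    of [a']. Ties before and after would make these budgets invariant under subtracting [d],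
    although they are bounded below by the weight. *)
Lemma tie_unique W W' v a a' : a' <> a -> tie W v a a' -> tie W' v a a' ->
  (forall x y, (x, y) <> (v, a) -> tadj nch x y -> owt W x y = owt W' x y) ->
  (forall c d, c <> (if (size v < size a)%N then a else v) -> W c d = W' c d) ->
  owt W' v a <= owt W v a.
Proof.
move=> aa [va va' eqT [q0 sq0]] [_ _ eqT' _] eqO eqW.
rewrite leNgt; apply/negP => lt; pose d := owt W' v a - owt W v a.
have d0 : 0 < d by rewrite subr_gt0.
have eqO' x y : (x, y) <> (v, a) -> tadj nch x y -> owt W' x y = owt W x y.
  by move=> h1 h2; rewrite eqO.
have eqW' c e : c <> (if (size v < size a)%N then a else v) -> W' c e = W c e.
  by move=> h; rewrite eqW.
have step (q : rat) : survives nch W v a (ratr q) -> survives nch W v a (ratr q - d).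
  move=> /eqT s; have [_ h] := survives_shift (ratr q) va eqO eqW.
  have /eqT' s' := h _ va' aa s.
  have [h' _] := survives_shift (ratr q) va eqO' eqW'.
  have -> : ratr q - d = ratr q - owt W' v a + owt W v a by rewrite /d; ring.
  exact: h' s'.
(* [d] need not be rational: half of each decrement is given up to land on a rational budget. *)
have iterq n : exists2 q : rat, survives nch W v a (ratr q) & ratr q <= ratr q0 - n%:R * (d / 2).
  elim: n => [|n [q sq qle]]; first by exists q0 => //; rewrite mul0r subr0.
  have [|q'] := @rat_in_itvoo R (ratr q - d) (ratr q - d / 2); first by lra.
  rewrite in_itv/= => /andP[q1 q2].
  exists q'; last by rewrite -natr1; lra.
  by apply: survives_mono (step _ sq); exact: ltW.
pose n := (Num.truncn ((ratr q0 - owt W v a) / (d / 2))).+1.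
have [q /survives_ge wq qle] := iterq n.
have : (ratr q0 - owt W v a) / (d / 2) < n%:R by exact: truncnS_gt.
rewrite ltr_pdivrMr ?divr_gt0//; lra.
Qed.

(** A running winner is kept along the list of neighbours. When a newcomer also survives on [b], the
    absence of a tie gives a rational budget below [b] separating the two, and earlier losers stay
    dead on it. *)
Lemma best_exists W v : in_tree nch v ->
  (forall a a', a' <> a -> ~ tie W v a a') ->
  (exists a b, tadj nch v a /\ survives nch W v a b) ->
  exists a, tadj nch v a /\ exists b, survives nch W v a b /\
    forall a', tadj nch v a' -> a' <> a -> ~ survives nch W v a' b.
Proof.
move=> tv notie [a0 [b0 [va0 s0]]].
suff main (s : seq label) : (exists2 a, a \in s & tadj nch v a /\ exists b, survives nch W v a b) ->
    exists a, tadj nch v a /\ exists b, survives nch W v a b /\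
    forall a', a' \in s -> tadj nch v a' -> a' <> a -> ~ survives nch W v a' b.
  have [|a [va [b [sb H]]]] := main (nbrs nch v).
    by exists a0; [exact: tadj_nbrs|split=> //; exists b0].
  exists a; split=> //; exists b; split=> // a' va'; apply: H => //; exact: tadj_nbrs.
elim: s => [[]//|x s IH] Hs.
have [/IH [a [va [b [sb H]]]]|none] :=
  pselect (exists2 a, a \in s & tadj nch v a /\ exists b, survives nch W v a b); last first.
  have [a] := Hs; rewrite inE => /orP[/eqP -> [vx [b sb]]|ain ha]; last by case: none; exists a.
  exists x; split=> //; exists b; split=> // a'; rewrite inE => /orP[/eqP ->//|a's] va' _ sa'.
  by apply: none; exists a' => //; split=> //; exists b.
have [[vx xa sx]|ok] := pselect [/\ tadj nch v x, x <> a & survives nch W v x b]; last first.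
  exists a; split=> //; exists b; split=> // a'; rewrite inE => /orP[/eqP ->|]; last exact: H.
  by move=> vx xa sx; apply: ok.
have [q Hq] : exists q : rat, ~ (survives nch W v a (ratr q) <-> survives nch W v x (ratr q)).
  apply/existsNP => eqT; apply: (notie a x xa); split=> //.
  have [|q] := @rat_in_itvoo R b (b + 1); first by rewrite ltrDl.
  rewrite in_itv/= => /andP[q1 _].
  by exists q; apply: survives_mono sb; exact: ltW.
have qb : ratr q < b.
  rewrite ltNge; apply/negP => bq; apply: Hq.
  by split=> _; [apply: survives_mono sx|apply: survives_mono sb].
have Hlow a' : a' \in s -> tadj nch v a' -> a' <> a -> ~ survives nch W v a' (ratr q).
  by move=> h1 h2 h3 h4; apply: (H a') => //; apply: survives_mono h4; exact: ltW.
have [saq|nsaq] := pselect (survives nch W v a (ratr q)).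
  exists a; split=> //; exists (ratr q); split=> // a'; rewrite inE => /orP[/eqP -> _ _ sxq|].
    by apply: Hq.
  exact: Hlow.
have sxq : survives nch W v x (ratr q) by apply: contrapT => nsxq; apply: Hq.
exists x; split=> //; exists (ratr q); split=> // a'; rewrite inE => /orP[/eqP -> //|a's va' _].
by have [->|/eqP a'a] := eqVneq a' a; [|exact: Hlow].
Qed.

End Ties.

Lemma negligible_countable_bigcup d (T : measurableType d) (R : realType)
  (mu : {measure set T -> \bar R}) (I : countType) (F : I -> set T) :
  (forall i, mu.-negligible (F i)) -> mu.-negligible (\bigcup_i F i).
Proof.
move=> nF.
rewrite (_ : \bigcup_i F i = \bigcup_n (if unpickle n is Some i then F i else set0)).
  apply: negligible_bigcup => n; case: (unpickle n : option I) => [i|]; first exact: nF.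
  exact: negligible_set0.
apply/seteqP; split=> x.
  by move=> [i _ Fx]; exists (pickle i) => //; rewrite pickleK.
by move=> [n _]; case: (unpickle n : option I) => // i Fx; exists i.
Qed.

(** * Measurability of survival and negligibility of ties *)

Section NullSets.
Variables (R : realType) (p : nat -> R) (mu : probability (confT R) R) (aug : bool).
Hypothesis lawp : offspring_law p.
Hypothesis mu_cyl : forall us es, proper_keys us es ->
  mu (cyl us es : set (confT R)) = ((\prod_(uk <- us) p uk.2) * (\prod_(et <- es) exp1_cdf et.2))%:E.
Local Notation budgets := (R * confT R)%type.
Local Notation lam := (lam mu).
Local Notation nch xi := (nchildren aug (xi : confT R).1).

Lemma measurable_nch u (S : set nat) : measurable [set xi : confT R | S (nch xi u)].
Proof.
rewrite (_ : [set _ | _] = (fun xi : confT R => xi.1 u) @^-1`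
  [set k | S (k + (aug && (u == [::])))%N])//.
by apply: measurable_preimage => //; exact: measurable_funZ.
Qed.

Lemma measurable_in_tree u : measurable [set xi : confT R | in_tree (nch xi) u].
Proof.
elim/last_ind: u => [|u i IH].
  by rewrite (_ : [set _ | _] = setT)//; apply/seteqP; split.
rewrite (_ : [set _ | _] = [set xi : confT R | in_tree (nch xi) u] `&`
  [set xi : confT R | (i < nch xi u)%N]).
  by apply: measurableI => //; exact: (measurable_nch u (fun k => (i < k)%N)).
by apply/seteqP; split=> xi /=; rewrite in_tree_rcons => /andP.
Qed.

Lemma measurable_tadj u v : measurable [set xi : confT R | tadj (nch xi) u v].
Proof.
have [st|st] := boolP (parent_of u v || parent_of v u); last first.
  rewrite (_ : [set _ | _] = set0)//; apply/seteqP; split=> xi //=.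
  by rewrite /tadj (negbTE st) !andbF.
rewrite (_ : [set _ | _] = [set xi : confT R | in_tree (nch xi) u] `&`
  [set xi : confT R | in_tree (nch xi) v]).
  by apply: measurableI; exact: measurable_in_tree.
by apply/seteqP; split=> xi /=; rewrite /tadj st andbT => /andP.
Qed.

Definition lower_end (v a : label) : label := if (size v < size a)%N then a else v.

Lemma lower_end_neq0 v a : parent_of v a || parent_of a v -> lower_end v a != [::].
Proof.
rewrite /lower_end => /orP[/parent_ofP[i ->]|/parent_ofP[i ->]]; rewrite size_rcons.
  by rewrite leqnn -size_eq0 size_rcons.
by rewrite ltnNge leqnSn /= -size_eq0 size_rcons.
Qed.

Lemma lower_end_inj v a u u' : parent_of v a || parent_of a v ->
  parent_of u u' || parent_of u' u -> lower_end u u' = lower_end v a ->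
  (size u < size u')%N = (size v < size a)%N -> (u, u') = (v, a).
Proof.
move=> st st' e1 e2; move: e1; rewrite /lower_end e2.
case: ifP => lt e1; rewrite e1 in st' e2 *.
  rewrite lt in e2.
  case/orP: st => /parent_ofP[i ei]; last by move: lt; rewrite ei size_rcons ltnNge leqnSn.
  case/orP: st' => /parent_ofP[j ej]; last by move: e2; rewrite ej size_rcons ltnNge leqnSn.
  have /rcons_inj[-> _] : rcons v i = rcons u j by rewrite -ei -ej.
  by [].
rewrite lt in e2.
case/orP: st => /parent_ofP[i ei]; first by move: lt; rewrite ei size_rcons leqnn.
case/orP: st' => /parent_ofP[j ej]; first by move: e2; rewrite ej size_rcons leqnn.
have /rcons_inj[-> _] : rcons a i = rcons u' j by rewrite -ei -ej.
by [].
Qed.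

Lemma owtE (W : label -> bool -> R) v a :
  owt W v a = W (lower_end v a) (~~ (size v < size a)%N).
Proof. by rewrite /owt /lower_end; case: ifP. Qed.

Lemma measurable_owt v a : parent_of v a || parent_of a v ->
  measurable_fun setT (fun x : budgets => owt x.2.2 v a).
Proof.
move=> st; rewrite (_ : (fun _ => _) = (fun x : budgets =>
   x.2.2 (lower_end v a) (~~ (size v < size a)%N))).
  apply: (measurableT_comp (measurable_funW _ _) measurable_snd).
  exact: lower_end_neq0.
by apply/funext => x; rewrite owtE.
Qed.

Lemma measurable_surv k v a : parent_of v a || parent_of a v ->
  measurable [set x : budgets | surv (nch x.2) x.2.2 k v a x.1].
Proof.
elim: k v a => [|k IH] v a st.
  by rewrite (_ : [set _ | _] = setT)//; apply/seteqP; split.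
have mva := measurable_owt st.
have mav : measurable_fun setT (fun x : budgets => owt x.2.2 a v).
  by apply: measurable_owt; rewrite orbC.
pose next (x : budgets) : budgets := (x.1 - owt x.2.2 v a + owt x.2.2 a v, x.2).
have mnext : measurable_fun setT next.
  apply: measurable_fun_pair; last exact: measurable_snd.
  apply: measurable_funD => //; apply: measurable_funB => //; exact: measurable_fst.
(* The test in the union keeps only pairs of labels that are parent and child; for these the weights
   read sit at a non-root label and are measurable. *)
rewrite (_ : [set _ | _] = [set x : budgets | owt x.2.2 v a <= x.1] `&`
  \bigcup_(c in [set: label]) (if (c != v) && (parent_of a c || parent_of c a) then
    (snd @^-1` [set xi : confT R | tadj (nch xi) a c]) `&`
      next @^-1` [set x : budgets | surv (nch x.2) x.2.2 k a c x.1] else set0)).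
  apply: measurableI.
    have := measurable_fun_ler mva (measurable_fst : measurable_fun setT (fst : budgets -> R)).
    by move=> /(_ measurableT [set true])/(_ _); rewrite setTI; apply.
  apply: countable_bigcupT_measurable => [|c]; first exact: countableP.
  case: ifP => // /andP[cv st'].
  apply: measurableI; first exact: (measurable_preimage measurable_snd (measurable_tadj a c)).
  exact: (measurable_preimage mnext (IH _ _ st')).
apply/seteqP; split=> x /=.
  move=> [wb [c [ac cv s]]]; split=> //; exists c => //.
  move/eqP: cv => ->; have /and3P[_ _ ->] := ac; split=> //.
move=> [wb [c _]]; case: ifP => // /andP[/eqP cv _] [ac s]; split=> //; by exists c.
Qed.

Lemma measurable_survives v a (b : R) : parent_of v a || parent_of a v ->
  measurable [set xi : confT R | survives (nch xi) xi.2 v a b].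
Proof.
move=> st; rewrite (_ : [set _ | _] = \bigcap_k [set xi : confT R | surv (nch xi) xi.2 k v a b]).
  apply: bigcapT_measurable => k.
  exact: (measurable_section b (measurable_surv k st)).
by apply/seteqP; split=> xi H; [move=> k _; exact: H|move=> k; exact: (H k I)].
Qed.

Lemma measurable_tie v a a' : parent_of v a || parent_of a v -> parent_of v a' || parent_of a' v ->
  measurable [set xi : confT R | tie (nch xi) xi.2 v a a'].
Proof.
move=> st st'.
pose S a (q : rat) := [set xi : confT R | survives (nch xi) xi.2 v a (ratr q)].
rewrite (_ : [set _ | _] = [set xi : confT R | tadj (nch xi) v a] `&`
   [set xi : confT R | tadj (nch xi) v a'] `&`
   (\bigcap_q ((S a q `&` S a' q) `|` (~` S a q `&` ~` S a' q))) `&` \bigcup_q S a q).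
  have mS q : measurable (S a q) by exact: measurable_survives.
  have mS' q : measurable (S a' q) by exact: measurable_survives.
  apply: measurableI; last exact: bigcupT_measurable_rat.
  apply: measurableI; first by apply: measurableI; exact: measurable_tadj.
  rewrite -[X in measurable X]setCK setC_bigcap; apply: measurableC.
  apply: bigcupT_measurable_rat => q; apply: measurableC; apply: measurableU.
    exact: measurableI.
  by apply: measurableI; exact: measurableC.
apply/seteqP; split=> xi.
  move=> [va va' eqT [q sq]]; split; last by exists q.
  split=> // q' _; have [s|ns] := pselect (survives (nch xi) xi.2 v a (ratr q')).
    by left; split=> //; exact/eqT.
  by right; split=> // /eqT.
move=> [[[va va'] eqT] [q _ sq]]; split=> //; last by exists q.
move=> q'; case: (eqT q' I) => -[] h1 h2; split=> //.
Qed.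

(** For w > 0, memorylessness moves the atom down to a point d <= w, whose mass is at most that of
    the window ending at d, hence at most d. *)
Lemma lam_set1 (w : R) : lam [set w] = 0%E.
Proof.
have le0 (A B : set R) : measurable A -> measurable B -> A `<=` B -> (lam A <= lam B)%E.
  by move=> mA mB AB; apply: le_measure; rewrite ?inE.
apply/eqP; rewrite eq_le measure_ge0 andbT.
have [w0|w0] := lerP w 0.
  have <- : lam (~` `]0, +oo[%classic) = 0%E.
    by rewrite probability_setC// (lam_gt_ge0 mu_cyl)// oppr0 expR0 subee.
  apply: le0 => //; first exact: measurableC.
  by move=> _ -> /=; rewrite in_itv/= andbT; apply/negP; rewrite -leNgt.
apply/lee_addgt0Pr => e e0; rewrite add0e.
pose d := Num.min e w.
have d0 : 0 < d by rewrite lt_min e0.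
have dw : 0 <= w - d by rewrite subr_ge0 ge_min lexx orbT.
have -> : [set w] = [set w] `&` `]w - d, +oo[.
  by apply/seteqP; split=> [_ ->|_ []//]; split=> //=; rewrite in_itv/= andbT ltrBlDr ltrDl.
rewrite (lam_memoryless mu_cyl dw)//.
have -> : [set r | [set w] (r + (w - d))] = [set d].
  by apply/seteqP; split=> r /=; [move=> h|move=> ->]; lra.
have l1 : (lam [set d] <= (1 - expR (- d))%:E)%E.
  rewrite -(lam_window mu_cyl (ltW d0)); apply: le0 => // _ -> /=.
  by rewrite in_itv/= d0 lexx.
have [_ l2 _] := expR_quad (ltW d0).
have de : d <= e by rewrite ge_min lexx.
apply: (@le_trans _ _ (1%E * lam [set d])%E).
  by apply: lee_wpmul2r => //; rewrite lee_fin; have /andP[] := expRN01 dw.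
by rewrite mul1e; apply: (le_trans l1); rewrite lee_fin; lra.
Qed.

Lemma tie_null v a a' : a' <> a -> mu.-negligible [set xi : confT R | tie (nch xi) xi.2 v a a'].
Proof.
move=> aa.
have [st|st] := boolP (parent_of v a || parent_of a v); last first.
  rewrite (_ : [set _ | _] = set0); first exact: negligible_set0.
  by apply/seteqP; split=> xi //= [/and3P[_ _]]; rewrite (negbTE st).
have [st'|st'] := boolP (parent_of v a' || parent_of a' v); last first.
  rewrite (_ : [set _ | _] = set0); first exact: negligible_set0.
  by apply/seteqP; split=> xi //= [_ /and3P[_ _]]; rewrite (negbTE st').
have mT := measurable_tie st st'; apply/negligibleP => //.
pose C := lower_end v a; pose bit := ~~ (size v < size a)%N.
have C0 : C != [::] := lower_end_neq0 st.
(* All coordinates are frozen except the weight of v -> a, which is resampled. By [tie_unique] at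
   most one of its values produces a tie. *)
pose sw c b := ~~ ((c == C) && (b == bit)).
apply: (etrans (mix_integral mu_cyl predT sw mT)); apply: integral0_eq => x _.
pose S := [set y | [set xi : confT R | tie (nch xi) xi.2 v a a'] (mix predT sw (x, y))].
rewrite -/S.
have [[y0 T0]|none] := pselect (exists y, S y); last first.
  by rewrite (_ : S = set0)//; apply/seteqP; split=> y // Sy; apply: none; exists y.
have keyE y : owt (mix predT sw (x, y)).2 v a = y.2 C bit.
  by rewrite owtE /mix /= /sw -/C -/bit !eqxx.
have other y y' c b : (c, b) <> (C, bit) ->
    (mix predT sw (x, y)).2 c b = (mix predT sw (x, y')).2 c b.
  move=> cb; rewrite /mix /= /sw.
  by have -> : (c == C) && (b == bit) = false
    by apply/negP => /andP[/eqP ec /eqP eb]; apply: cb; rewrite ec eb.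
have keyle y y' : S y -> S y' -> y'.2 C bit <= y.2 C bit.
  move=> Ty Ty'; rewrite -!keyE; apply: (tie_unique aa Ty Ty').
    move=> u u' uu' /and3P[_ _ adj]; rewrite !owtE; apply: other => -[e1 e2]; apply: uu'.
    by apply: (lower_end_inj st adj e1); exact: negb_inj.
  move=> c d cC; apply: other => -[ec _]; exact: cC.
have subS : S `<=` [set y : confT R | [set y0.2 C bit] (y.2 C bit)].
  by move=> y Sy /=; apply/eqP; rewrite eq_le !keyle.
apply/eqP; rewrite eq_le measure_ge0 andbT.
apply: (@le_trans _ _ (mu [set y : confT R | [set y0.2 C bit] (y.2 C bit)])).
  apply: le_measure => //; rewrite inE; last first.
    exact: (measurable_preimage (measurable_funW bit C0) (measurable_set1 _)).
  have := measurable_xsection x (measurable_preimage (measurable_mix predT sw) mT).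
  by congr measurable; apply/seteqP; split=> y /=; rewrite /xsection /= inE.
by rewrite (weight_law mu_cyl bit C0 (measurable_set1 _)) lam_set1.
Qed.

End NullSets.

(** * The almost sure conclusion *)

Section Reading.
Variables (R : realType) (aug : bool) (xi : confT R).
Local Notation nch := (nchildren aug xi.1).
Local Notation W := xi.2.

Lemma nchildren_nonroot u : u <> [::] -> nch u = xi.1 u.
Proof. by move=> /eqP/negbTE u0; rewrite /nchildren u0 andbF addn0. Qed.

Lemma shift_rcons c i : shift [:: i] (shift c xi) = shift (rcons c i) xi.
Proof.
congr (_, _); apply/funext => u; first by rewrite /= -cat_rcons.
by apply/funext => b; rewrite /= -cat_rcons.
Qed.

Lemma child_okE B1 B2 (b : R) c i : child_ok B1 B2 i (b, shift c xi) =
  if W (rcons c i) false <= b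
  then B1 (b - W (rcons c i) false + W (rcons c i) true, shift (rcons c i) xi)
  else B2 (W (rcons c i) true, shift (rcons c i) xi).
Proof. by rewrite /child_ok /down_w /up_w /subtree /= shift_rcons !cats1. Qed.

Lemma children_okP B1 B2 (b : R) c : children_ok B1 B2 (b, shift c xi) <->
  forall i, (i < xi.1 c)%N -> child_ok B1 B2 i (b, shift c xi).
Proof. by rewrite /children_ok /= cats0. Qed.

Lemma not_diesP (b : R) c : ~ dies (b, shift c xi) -> exists i, [/\ (i < xi.1 c)%N,
  W (rcons c i) false <= b &
  ~ dies (b - W (rcons c i) false + W (rcons c i) true, shift (rcons c i) xi)].
Proof.
rewrite -{1}diesE => h; apply: contrapT => none; apply: h; apply/children_okP => i iz.
rewrite child_okE; case: ifP => // wb; apply: contrapT => nd; apply: none.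
by exists i.
Qed.

Lemma survives_child v i (b : R) (c := rcons v i) : in_tree nch c -> W c false <= b ->
  ~ dies (b - W c false + W c true, shift c xi) -> survives nch W v c b.
Proof.
rewrite /c => + + + k; elim: k v i b {c} => [//|k IH] v i b tc wb nd.
rewrite /= owt_down owt_up; split=> //.
have [j [jz wj ndj]] := not_diesP nd.
have nz : rcons v i <> [::] by case: v {IH tc wb nd jz wj ndj}.
have jn : (j < nch (rcons v i))%N by rewrite nchildren_nonroot.
exists (rcons (rcons v i) j); split.
- exact: tadj_child.
- move=> /(congr1 size)/eqP.
  by rewrite !size_rcons -addn2 -[X in _ == X]addn0 eqn_add2l.
- by apply: IH => //; rewrite in_tree_rcons tc.
Qed.

Lemma upward_dies c : c <> [::] -> in_tree nch c -> upward nch W c ->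
  dies (W c true, shift c xi).
Proof.
move=> c0 tc up; apply: contrapT => /not_diesP[i [iz wi nd]].
have ic : (i < nch c)%N by rewrite nchildren_nonroot.
by apply: (up i ic); apply: survives_child => //; rewrite in_tree_rcons tc.
Qed.

(** Each vertex of the chain dies when restarted on its own upward weight, so the escape clause
    [~ dies] is never available along the chain. The depth [m] in [short_past m] then drops by one
    at every step until it reaches the empty set. *)
Lemma chain_infinite_past (p : nat -> label) : p 0%N <> [::] ->
  (forall n, exists2 i, p n.+1 = rcons (p n) i & (i < nch (p n))%N) ->
  (forall n, in_tree nch (p n)) -> (forall n, upward nch W (p n)) ->
  dies (W (p 0%N) true, shift (p 0%N) xi) /\ ~ finite_past (W (p 0%N) true, shift (p 0%N) xi).
Proof.
move=> p0 pS tp up.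
have pn0 n : p n <> [::] by case: n => // n; have [i -> _] := pS n; case: (p n).
have pd n := upward_dies (pn0 n) (tp n) (up n).
split=> // -[m _]; move: (pd 0%N).
move: (W (p 0%N) true); move: 0%N; elim: m => [//|m IH] n b db.
have [i ei ilt] := pS n; rewrite nchildren_nonroot// in ilt.
rewrite -diesE in db; move/children_okP: db => /(_ _ ilt); rewrite child_okE -ei.
move=> db /children_okP /(_ _ ilt); rewrite child_okE -ei.
case: ifP db => _ db; first exact: IH.
by case=> [/(_ (pd _))//|]; exact: IH.
Qed.

Lemma reading_conclusion :
  (forall u, xi.1 u <> 0%N) ->
  (forall m, exists2 n, (m <= n)%N & xi.1 (nseq n 0%N) <> 1%N) ->
  (forall v a a', a' <> a -> ~ tie nch W v a a') ->
  (forall c, ~ forall n : nat, dies (n%:R : R, shift c xi)) ->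
  (forall c i, let c' := rcons c i in
     dies (W c' true, shift c' xi) -> finite_past (W c' true, shift c' xi)) ->
  conclusion nch W.
Proof.
move=> Z0 Z1 notie surviving past.
have nch0 u : (0 < nch u)%N by rewrite /nchildren ltn_addr// lt0n; apply/eqP.
have best v : exists y, in_tree nch v -> tadj nch v y /\ exists b, survives nch W v y b /\
    forall a, tadj nch v a -> a <> y -> ~ survives nch W v a b.
  have [tv|ntv] := boolP (in_tree nch v); last by exists v => tv; case/negP: ntv.
  suff : exists a b, tadj nch v a /\ survives nch W v a b.
    by move=> /(best_exists tv (notie v))[a h]; exists a.
  pose c := rcons v 0%N.
  have [n nd] : exists n : nat, ~ dies (n%:R : R, shift c xi) by exact/existsNP.
  have tc : in_tree nch c by rewrite in_tree_rcons tv nch0.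
  (* Enough to pay for the edge to [c] and to have at least [n] left after the refund. *)
  exists c, (Num.max (W c false) (n%:R + W c false - W c true)).
  split; first exact: tadj_child.
  apply: survives_child => //; first by rewrite le_max lexx.
  move=> d; apply: nd; apply: dies_anti d.
  rewrite -/c; set M := Num.max _ _.
  have : n%:R + W c false - W c true <= M by rewrite le_max lexx orbT.
  by lra.
have [F FP] := choice best.
apply: (best_conclusion FP) => //.
  move=> [p [p0 pS tp up]]; have [d nf] := chain_infinite_past p0 pS tp up.
  move: d nf p0; case/lastP: (p 0%N) => // c i d nf _; exact/nf/past.
move=> m; have [n mn Zn] := Z1 m; exists n => //.
rewrite /nchildren; apply: leq_trans (leq_addr _ _).
by have := Z0 (nseq n 0%N); move: Zn; case: (xi.1 _) => [|[|]].
Qed.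

End Reading.

Section AlmostSure.
Variables (R : realType) (p : nat -> R) (mu : probability (confT R) R) (aug : bool).
Hypothesis lawp : offspring_law p.
Hypothesis mu_cyl : forall us es, proper_keys us es ->
  mu (cyl us es : set (confT R)) = ((\prod_(uk <- us) p uk.2) * (\prod_(et <- es) exp1_cdf et.2))%:E.

Lemma negligible_shift c (A : set (confT R)) : measurable A -> mu A = 0%E ->
  mu.-negligible (shift c @^-1` A).
Proof.
move=> mA A0; apply/negligibleP; first exact: (measurable_preimage (measurable_shift c) mA).
by apply: (etrans (shift_law mu_cyl c mA)).
Qed.

Lemma no_offspring_null u : mu.-negligible [set xi : confT R | xi.1 u = 0%N].
Proof.
rewrite (_ : [set _ | _] = shift u @^-1` [set xi : confT R | xi.1 [::] = 0%N]).
  apply: negligible_shift; first exact: measurable_Z.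
  by apply: (etrans (offspring_prb mu_cyl 0%N)); case: lawp => _ [_ [_ ->]].
by apply/seteqP; split=> xi; rewrite /= cats0.
Qed.

(** The next N vertices of the leftmost line all have a single child with probability p_1^N, which
    tends to 0. *)
Lemma no_branching_null m : mu.-negligible
  [set xi : confT R | forall n, (m <= n)%N -> xi.1 (nseq n 0%N) = 1%N].
Proof.
pose us N := [seq (nseq (m + i) 0%N, 1%N) | i <- iota 0 N].
have pk N : proper_keys (us N) ([::] : seq ((label * bool) * R)).
  rewrite /proper_keys /= !andbT -map_comp map_inj_uniq ?iota_uniq// => i j /(congr1 size) /=.
  by rewrite !size_nseq => /addnI.
have muN N : mu (cyl (us N) [::] : set (confT R)) = (p 1%N ^+ N)%:E.
  rewrite (mu_cyl (pk N)) big_nil mulr1 big_map; congr (_%:E).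
  by rewrite /= big_const_seq count_predT size_iota iter_mulr_1.
have mcyl N : measurable (cyl (us N) [::] : set (confT R)).
  by apply: sub_sigma_algebra; right; exists (us N), [::].
exists (\bigcap_N cyl (us N) [::]); split.
- exact: bigcapT_measurable.
- apply/eqP; rewrite eq_le measure_ge0 andbT; apply/lee_addgt0Pr => e e0; rewrite add0e.
  have [p0 _] := lawp; have p1 := p1_lt1 lawp.
  have : (fun N => p 1%N ^+ N) @ \oo --> 0.
    by apply: cvg_expr; rewrite ger0_norm.
  move=> /cvgrPdist_lt /(_ _ e0) [N _ /(_ N (leqnn N))] /=.
  rewrite sub0r normrN ger0_norm ?exprn_ge0// => le.
  apply: (@le_trans _ _ (mu (cyl (us N) [::]))).
    apply: le_measure; rewrite ?inE//; first exact: bigcapT_measurable.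
    by move=> xi /(_ N I).
  by rewrite muN lee_fin ltW.
- move=> xi H N _; rewrite /cyl /= andbT; apply/allP => _ /mapP[i _ ->] /=.
  by apply/eqP/H; rewrite leq_addr.
Qed.

Lemma always_dying_null c : mu.-negligible [set xi : confT R | forall n : nat, dies (n%:R : R, shift c xi)].
Proof.
apply: (@negligible_shift c [set xi | forall n : nat, dies (n%:R : R, xi)]).
  rewrite (_ : [set _ | _] = \bigcap_n [set xi : confT R | dies (n%:R : R, xi)]).
    by apply: bigcapT_measurable => n; exact: (measurable_section _ (@measurable_dies R)).
  by apply/seteqP; split=> xi H; [move=> n _; exact: H|move=> n; exact: (H n I)].
exact: never_survives_null lawp mu_cyl.
Qed.

Lemma long_past_null c i (c' := rcons c i) : mu.-negligible [set xi : confT R |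
  dies (xi.2 c' true, shift c' xi) /\ ~ finite_past (xi.2 c' true, shift c' xi)].
Proof.
pose A := [set xi : confT R | dies (up_w i xi, subtree i xi) /\ ~ finite_past (up_w i xi, subtree i xi)].
rewrite (_ : [set _ | _] = shift c @^-1` A).
  apply: negligible_shift; last exact: infinite_past_null lawp mu_cyl i.
  have mg (B : set (R * confT R)) : measurable B -> measurable [set xi | B (up_w i xi, subtree i xi)].
    move=> mB; have := measurable_section (0 : R) (measurable_fresh i mB).
    by congr measurable; apply/seteqP; split=> xi /=; rewrite add0r.
  apply: measurableI; first exact: (mg _ (@measurable_dies R)).
  by apply: measurableC; exact: (mg _ (@measurable_finite_past R)).
apply/seteqP; split=> xi; rewrite /A /= /up_w /subtree /= shift_rcons cats1//.
Qed.

Lemma ae_conclusion : mu.-negligible [set xi : confT R | ~ conclusion (nchildren aug xi.1) xi.2].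
Proof.
pose A1 := \bigcup_u [set xi : confT R | xi.1 u = 0%N].
pose A2 := \bigcup_m [set xi : confT R | forall n, (m <= n)%N -> xi.1 (nseq n 0%N) = 1%N].
pose A3 := \bigcup_(t : label * label * label) [set xi : confT R | t.2 <> t.1.2 /\
  tie (nchildren aug xi.1) xi.2 t.1.1 t.1.2 t.2].
pose A4 := \bigcup_c [set xi : confT R | forall n : nat, dies (n%:R : R, shift c xi)].
pose A5 := \bigcup_(t : label * nat) [set xi : confT R | let c' := rcons t.1 t.2 in
  dies (xi.2 c' true, shift c' xi) /\ ~ finite_past (xi.2 c' true, shift c' xi)].
apply: (@negligibleS _ _ _ mu (A1 `|` A2 `|` A3 `|` A4 `|` A5)).
  move=> xi nc; apply: contrapT => good; apply: nc; apply: reading_conclusion.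
  - by move=> u h; apply: good; do 4 left; exists u.
  - move=> m; apply: contrapT => none; apply: good; do 3 left; right; exists m => // n mn.
    by apply: contrapT => h; apply: none; exists n.
  - by move=> v a a' aa h; apply: good; do 2 left; right; exists (v, a, a').
  - by move=> c h; apply: good; left; right; exists c.
  - by move=> c i c' d; apply: contrapT => nf; apply: good; right; exists (c, i).
do ! apply: negligibleU; apply: negligible_countable_bigcup.
- exact: no_offspring_null.
- exact: no_branching_null.
- move=> [[v a] a'] /=; have [->|aa] := eqVneq a' a.
    by apply: negligibleS (negligible_set0 mu) => xi [].
  apply: negligibleS (tie_null aug mu_cyl v (elimN eqP aa)) => xi [] //.
- exact: always_dying_null.
- by move=> [c i]; exact: long_past_null.
Qed.

End AlmostSure.

Theorem mainTheorem6 (R : realType) (d : measure_display) (Omega : measurableType d)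
  (P : probability Omega R) (p : nat -> R)
  (Z : label -> Omega -> nat) (W : label -> bool -> Omega -> R) (aug : bool) :
  offspring_law p -> iid_model P p Z W ->
  exists N : set Omega, measurable N /\ tree_law P aug Z N = 0%E /\
    forall w, ~ N w ->
      conclusion (nchildren aug (fun u => Z u w)) (fun c b => W c b w).
Proof.
move=> lawp [mZ [mW iid]].
pose X (w : Omega) : confT R := (fun u => Z u w, fun c b => W c b w).
have mX : measurable_fun setT X by apply: measurable_to_conf => *; [exact: mZ|exact: mW].
pose Xf : {mfun Omega >-> confT R} := HB.pack X (isMeasurableFun.Build _ _ _ _ X mX).
have mu_cyl us es : proper_keys us es -> distribution P Xf (cyl us es : set (confT R)) =
    ((\prod_(uk <- us) p uk.2) * (\prod_(et <- es) exp1_cdf et.2))%:E.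
  by move=> /and3P[h1 h2 h3]; rewrite -iid.
have [B [mB B0 BP]] := ae_conclusion aug lawp mu_cyl.
have mN : measurable (X @^-1` B) by exact: measurable_preimage.
exists (X @^-1` B); split=> //; split; last first.
  by move=> w nB; apply: contrapT => nc; apply: nB; exact: BP.
(* The biased law has a density with respect to [P], so [P]-null sets remain null. *)
rewrite /tree_law; case: aug BP => // _.
rewrite null_set_integral ?mul0e//.
apply: (@measurable_funS _ _ _ _ setT) => //; apply/measurable_EFinP.
apply: (@measurableT_comp _ _ _ _ _ _ (fun n : nat => (n.+1%:R^-1 : R))) => //.
move=> _ A _; rewrite setTI (_ : _ @^-1` A = \bigcup_(k in A) [set w | Z [::] w = k]).
  by apply: bigcup_measurable => k _; exact: mZ.
by apply/seteqP; split=> w /=; [move=> Aw; exists (Z [::] w)|move=> [k Ak ->]].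
Qed.
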